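(* Let $K$ be a complete discrete valuation field and $M \in M_n(K)$ such that the differential $d\chi_M$ is surjective. Then one can compute, in $O\tilde{~}(n^\omega)$ operations in $K$, a quadruple $(\alpha, P, Q, \chi_M)$, where $\alpha \in K[X]$, $P, Q \in \mathrm{GL}_n(K)$ and $\chi_M$ is the characteristic polynomial of $M$, such that $$\mathrm{Com}(X-M) \equiv \alpha \cdot P V^t \cdot V Q^t \pmod{\chi_M},$$ where $V = (1, X, \ldots, X^{n-1})$.
   Context: $\chi$ is the characteristic polynomial map $M \mapsto \chi_M = \det(X I_n - M)$ from $M_n(K)$ to monic polynomials of degree $n$, and $d\chi_M : M_n(K) \to K_{<n}[X]$ is its differential at $M$, a $K$-linear map to the space of polynomials of degree less than $n$; up to sign, $d\chi_M(dM) = \mathrm{Tr}(\mathrm{Com}(X-M)\cdot dM)$. $\mathrm{Com}(A)$ is the comatrix (adjugate) of $A$, so that $A\cdot\mathrm{Com}(A) = \det(A) I_n$; $X-M$ means $XI_n - M$; $A^t$ is the transpose of $A$; congruences modulo $\chi_M$ are entrywise. $\omega$ is a fixed real number such that two $n\times n$ matrices over a ring can be multiplied in $O(n^\omega)$ ring operations. $f(n) = O\tilde{~}(g(n))$ means $f(n) = O(g(n)\log(n)^k)$ for some $k \in \mathbb{N}$. Complexity is counted in arithmetic operations (including divisions) in $K$. *)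

(* Defs.v *)
From HB Require Import structures.
From mathcomp Require Import all_boot all_order all_algebra.
From mathcomp Require Import all_classical all_reals all_analysis.

Set Implicit Arguments.
Unset Strict Implicit.
Unset Printing Implicit Defensive.

Import Order.TTheory GRing.Theory Num.Theory.
Import numFieldNormedType.Exports.

Local Open Scope classical_set_scope.
Local Open Scope ring_scope.

(** * Complete discrete valuation fields *)

(* [v] is only meaningful on nonzero elements; [vge v x N] reads
   "v(x) >= N" with the convention v(0) = +oo. *)
Definition vge (K : fieldType) (v : K -> int) (x : K) (N : int) : Prop :=
  x = 0 \/ N <= v x.

(* Normalized: [v] maps onto the integers as soon as it takes the value 1. *)
Definition discrete_valuation (K : fieldType) (v : K -> int) : Prop :=
  [/\ forall x y, x != 0 -> y != 0 -> v (x * y) = v x + v y,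
      forall x y N, vge v x N -> vge v y N -> vge v (x + y) N
    & exists2 pi, pi != 0 & v pi = 1].

Definition v_cauchy (K : fieldType) (v : K -> int) (u : nat -> K) : Prop :=
  forall N : int, exists n0 : nat, forall m n : nat,
    (n0 <= m)%N -> (n0 <= n)%N -> vge v (u m - u n) N.

Definition v_converges (K : fieldType) (v : K -> int) (u : nat -> K) (l : K)
    : Prop :=
  forall N : int, exists n0 : nat, forall n : nat,
    (n0 <= n)%N -> vge v (u n - l) N.

Definition complete_discrete_valuation (K : fieldType) (v : K -> int) : Prop :=
  discrete_valuation v /\
  forall u : nat -> K, v_cauchy v u -> exists l : K, v_converges v u l.

(** * Differentials over a valued field *)

(* Frechet differential for the sup norms on matrix entries and on
   coefficients: |f (M + H) - f M - L H| <= |pi|^N |H| for H small enough,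
   for every N. *)
Definition is_differential (K : fieldType) (v : K -> int) (n : nat)
    (f : 'M[K]_n -> {poly K}) (M : 'M[K]_n) (L : {linear 'M[K]_n -> {poly K}})
    : Prop :=
  forall N : int, exists d : int, forall (H : 'M[K]_n) (r : int),
    d <= r -> (forall i j, vge v (H i j) r) ->
    forall l : nat, vge v (f (M + H) - f M - L H)`_l (r + N).

(* The differential of the characteristic polynomial takes its values in
   polynomials of degree < n, which is the target of the surjectivity. *)
Definition surjective_dchi (K : fieldType) (v : K -> int) (n : nat)
    (M : 'M[K]_n) : Prop :=
  exists L : {linear 'M[K]_n -> {poly K}},
    is_differential v (@char_poly K n) M L /\
    forall p : {poly K}, (size p <= n)%N -> exists H : 'M[K]_n, L H = p.

(** * Algebraic complexity *)

(* Computations act on a growing memory, the list of values known so far: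
   the inputs, then the result of each instruction, appended on the right.
   Operands are positions in that list; an out-of-range position reads 0. *)
Variant ring_op (A : Type) : Type :=
  | Cst of A
  | Add of nat & nat
  | Sub of nat & nat
  | Mul of nat & nat.
Arguments Cst {A} _.
Arguments Add {A} _ _.
Arguments Sub {A} _ _.
Arguments Mul {A} _ _.

Definition ring_op_eval (A : nzRingType) (m : seq A) (o : ring_op A) : A :=
  match o with
  | Cst a => a
  | Add i j => m`_i + m`_j
  | Sub i j => m`_i - m`_j
  | Mul i j => m`_i * m`_j
  end.

Definition ring_op_cost (A : Type) (o : ring_op A) : nat :=
  if o is Cst _ then 0%N else 1%N.

Definition slp_run (A : nzRingType) (m : seq A) (s : seq (ring_op A)) : seq A :=
  foldl (fun m o => rcons m (ring_op_eval m o)) m s.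

Definition slp_cost (A : Type) (s : seq (ring_op A)) : nat :=
  sumn [seq ring_op_cost o | o <- s].

(* Algebraic computation trees; a leaf carries the memory addresses of the
   outputs, organized in a type [O]. *)
Inductive act (K O : Type) : Type :=
  | Halt of O
  | Op of ring_op K & act K O
  | Div of nat & nat & act K O
  | Test0 of nat & act K O & act K O.
Arguments Halt {K O} _.
Arguments Op {K O} _ _.
Arguments Div {K O} _ _ _.
Arguments Test0 {K O} _ _ _.

Definition tick (T : Type) (c : nat) (r : option (T * nat)) :
    option (T * nat) :=
  omap (fun x => (x.1, (c + x.2)%N)) r.

(* Final memory, output addresses, and number of operations performed along
   the branch that is followed. Additions, subtractions, multiplications,
   divisions and zero tests are charged; a division by zero is a failure. *)
Fixpoint act_run (K : fieldType) (O : Type) (t : act K O) (m : seq K) :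
    option (seq K * O * nat) :=
  match t with
  | Halt o => Some (m, o, 0%N)
  | Op o t' => tick (ring_op_cost o) (act_run t' (rcons m (ring_op_eval m o)))
  | Div i j t' =>
      if m`_j == 0 then None else tick 1 (act_run t' (rcons m (m`_i / m`_j)))
  | Test0 i t0 t1 =>
      if m`_i == 0 then tick 1 (act_run t0 m) else tick 1 (act_run t1 m)
  end.

Definition mx_input (A : Type) (n : nat) (M : 'M[A]_n) : seq A :=
  [seq M i j | i <- enum 'I_n, j <- enum 'I_n].

Definition read_mx (A : nzRingType) (n : nat) (m : seq A) (a : 'M[nat]_n) :
    'M[A]_n :=
  map_mx (fun i : nat => m`_i) a.

Definition read_poly (A : nzRingType) (m : seq A) (a : seq nat) : {poly A} :=
  Poly [seq m`_i | i <- a].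

Definition softO (R : realType) (f g : nat -> R) : Prop :=
  exists k : nat, f =O_\oo (fun n => g n * ln (n%:R : R) ^+ k).

Definition matmul_exponent (R : realType) (omega : R) : Prop :=
  forall A : nzRingType,
  exists (s : nat -> seq (ring_op A)) (out : forall n : nat, 'M[nat]_n),
    (forall (n : nat) (B C : 'M[A]_n),
       read_mx (slp_run (mx_input B ++ mx_input C) (s n)) (out n) = B *m C) /\
    (fun n : nat => (slp_cost (s n))%:R : R) =O_\oo
      (fun n : nat => (n%:R : R) `^ omega).

(** * Factorization of the comatrix *)

Definition powers_row (K : fieldType) (n : nat) : 'rV[{poly K}]_n :=
  \row_(j < n) 'X^j.

(* MathComp's [\adj] is the comatrix in the convention A * Com(A) = det(A) I,
   and [char_poly_mx M] is X I - M. *)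
Definition comatrix_factorization (K : fieldType) (n : nat) (M : 'M[K]_n)
    (alpha : {poly K}) (P Q : 'M[K]_n) : Prop :=
  forall i j : 'I_n,
    (char_poly M %|
       (\adj (char_poly_mx M)
        - alpha *: (map_mx polyC P *m (powers_row K n)^T
                    *m (powers_row K n *m (map_mx polyC Q)^T))) i j)%R.

(* Main.v *)
Require Import Defs.
From mathcomp Require Import all_boot all_order all_algebra.
From mathcomp Require Import all_classical all_reals all_analysis.
From mathcomp Require Import zify ring.
Import Order.TTheory GRing.Theory Num.Theory.
Import numFieldNormedType.Exports.
Local Open Scope ring_scope.

(** Why the theorem is true.

    Reduction to a cyclic vector.  Moving [M] along an elementary matrix changes
    its characteristic polynomial chi affinely, with slope minus a cofactor of
    X - M; so the differential sends elementary matrices to the entries of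
    Com(X - M), up to sign, and surjectivity makes 1 a linear combination of
    those entries.  Since (X - M) Com(X - M) = chi, multiplying Com(X - M) by
    [M] or by X is the same modulo chi.  Hence p(M) = 0 forces chi to divide
    p times each entry, and so to divide p: the powers I, M, ..., M^(n-1) are
    linearly independent ([surjective_dchi_nonderog]).  Such a matrix has a
    cyclic row vector r, one for which the matrix R with rows r M^i is
    invertible.  Then r Com(X - M) = V H R, where H is the Hankel matrix of the
    coefficients of chi, and R Com(X - M) is congruent to V^t (r Com(X - M)).
    So alpha = 1, P = R^-1 and Q = (H R)^t are solutions
    ([comatrix_factorization_kry]), and chi is read off r M^n R^-1.

    Finding r without randomness.  No fixed vector is cyclic for all matrices,
    and a list of candidates that works for all of them is too long to be
    tried, so the tree adapts to [M].  Start from generating rows and cut them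
    into halves U1, U2.  The Krylov space of U1 gives a basis in which [M] is
    block triangular, with diagonal blocks A1, A2 generated by what remains of
    U1, of U2, and again with independent powers; recursion yields cyclic
    vectors x and y for the two blocks.  The sizes of the blocks of one level
    add up to at most n and there are log n levels.  To glue x and y, let
    g = chi_A2 and write (0, y) g(M) = (x b(A1), 0).  Independence of the powers
    of [M] means gcd(chi_A1, g, b) = 1.  In the Fitting decomposition for b(A1),
    let s be the component of x on which b(A1) is nilpotent.  There g(A1) is
    invertible, elsewhere b(A1) is, and (s, y) is cyclic ([merge_generates]).
    Everything is linear algebra: s = x - x T G T with T = b(A1)^(2^l) and G a
    generalized inverse of T^2.

    Generalized inverses, ranks and bases.  If R = A - A Z A is what a partial
    generalized inverse Z misses, adding a correction built from Y turns R into
    R - R Y R ([pivot_step_residue]).  Taking for Y a generalized inverse of one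
    quadrant of R clears that quadrant and keeps the cleared ones, so four calls
    at half size suffice.  The pivots met on the way form a nonsingular minor of
    maximal size, hence give a basis of the row space with its complement and
    its inverse ([rowbasisVK]).  Four calls at half size cost O(n^omega log n)
    because omega >= 2, which holds because the n^2 entries of a product must be
    computed by as many instructions ([matmul_cost_ge]).

    Costs.  A program is a term of the monad [comp], whose continuations receive
    the addresses of the values just computed; it compiles to a computation
    tree, and [runs] is a Hoare triple with a cost bound.  Multiplication of n x n
    matrices is charged F(n) = n^2 h(n) with h nondecreasing; this F is
    superadditive, satisfies 4 F(n) <= F(2n), and is still O(n^omega)
    ([regular_cost_bound]). *)

Set Implicit Arguments.
Unset Strict Implicit.
Unset Printing Implicit Defensive.

(** * Generalized inverses carrying a nonsingular minor *)

Section Pivots.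
Variable K : fieldType.

Definition coord_proj (m : nat) (I : seq nat) : 'M[K]_m :=
  diag_mx (\row_i (val i \in I)%:R).

Lemma coord_projE m I i j : coord_proj m I i j = ((i == j) && (val i \in I))%:R.
Proof. by rewrite !mxE; case: eqP => //= _; rewrite mulr1n. Qed.

Lemma coord_proj_nil m : coord_proj m [::] = 0.
Proof. by apply/matrixP => i j; rewrite coord_projE andbF mxE. Qed.

Lemma coord_proj_mul m I (p : nat) (A : 'M[K]_(m, p)) i j :
  (coord_proj m I *m A) i j = (val i \in I)%:R * A i j.
Proof. by rewrite mul_diag_mx !mxE. Qed.

Lemma mul_dsel m I (p : nat) (A : 'M[K]_(p, m)) i j :
  (A *m coord_proj m I) i j = A i j * (val j \in I)%:R.
Proof. by rewrite mul_mx_diag !mxE. Qed.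

Lemma coord_proj_absorb m (I J : seq nat) :
  {subset J <= I} -> coord_proj m I *m coord_proj m J = coord_proj m J /\
                     coord_proj m J *m coord_proj m I = coord_proj m J.
Proof.
move=> sJI; split; apply/matrixP => i j; rewrite ?coord_proj_mul ?mul_dsel !coord_projE;
  case: eqP => [eij|_] /=; rewrite ?eij; rewrite ?mulr0n ?mulr0 ?mul0r //;
  by case: (boolP (_ \in J)) => [/sJI ->|]; rewrite ?mulr1n ?mulr1 ?mulr0 ?mul0r.
Qed.

Lemma coord_proj_cat m I J :
  (forall i, i \in I -> i \in J -> False) ->
  coord_proj m (I ++ J) = coord_proj m I + coord_proj m J.
Proof.
move=> dIJ; apply/matrixP => i j; rewrite [RHS]mxE !coord_projE mem_cat.
case: eqP => //= _; last by rewrite addr0.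
case: (boolP (_ \in I)) => [/dIJ nJ|_] /=; last by rewrite add0r.
by case: (_ \in J) nJ => [/(_ isT)|_] //; rewrite addr0.
Qed.

(** [A] has the nonsingular minor with rows [I] and columns [J], and [Z] is the
    inverse of that minor extended by 0: the last two fields give the support
    of [Z], the two before say that it inverts the minor.  In this form no
    submatrix has to be extracted and no index renumbered. *)
Record pivoting (m p : nat) (A : 'M[K]_(m, p)) (Z : 'M[K]_(p, m))
    (I J : seq nat) : Prop := Pivoting {
  piv_uniqI : uniq I;
  piv_uniqJ : uniq J;
  piv_size : size I = size J;
  piv_ltI : all (fun i => i < m)%N I;
  piv_ltJ : all (fun j => j < p)%N J;
  piv_row : coord_proj m I *m A *m Z = coord_proj m I;
  piv_col : Z *m A *m coord_proj p J = coord_proj p J;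
  piv_suppl : coord_proj p J *m Z = Z;
  piv_suppr : Z *m coord_proj m I = Z }.

Lemma pivoting0 m p (A : 'M[K]_(m, p)) : pivoting A 0 [::] [::].
Proof. by split; rewrite ?coord_proj_nil ?mul0mx ?mulmx0. Qed.

(** For R = A - A Z A this is Z + (1 - Z A) Y (1 - A Z), the inverse of the
    enlarged minor when [Y] inverts a minor of R (a Schur complement). *)
Definition pivot_step m p (A : 'M[K]_(m, p)) (Z Y : 'M[K]_(p, m)) :=
  let Q := Y - Z *m A *m Y in Z + Q - Q *m A *m Z.

Lemma pivot_step_residue m p (A : 'M[K]_(m, p)) Z Y :
  let R := A - A *m Z *m A in
  let Z' := pivot_step A Z Y in
  A - A *m Z' *m A = R - R *m Y *m R.
Proof.
move=> R Z'; have AQ : A *m (Y - Z *m A *m Y) = R *m Y.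
  by rewrite mulmxBr mulmxBl !mulmxA.
have AZ' : A *m Z' = A *m Z + R *m Y - R *m Y *m A *m Z.
  by rewrite /Z' /pivot_step mulmxBr mulmxDr AQ !mulmxA AQ.
have RYR : R *m Y *m R = R *m Y *m A - R *m Y *m A *m Z *m A.
  by rewrite [in X in _ *m X]/R mulmxBr !mulmxA.
by rewrite AZ' RYR mulmxBl mulmxDl -addrA opprD addrA.
Qed.

(** R vanishes on the rows [I] and the columns [J], so the pivots of [Y] are new
    ones and the two minors combine. *)
Lemma pivoting_step m p (A : 'M[K]_(m, p)) Z I J Y I' J' :
  pivoting A Z I J -> pivoting (A - A *m Z *m A) Y I' J' ->
  pivoting A (pivot_step A Z Y) (I ++ I') (J ++ J').
Proof.
move=> [uI uJ sIJ lI lJ r1 c1 sl sr] [uI' uJ' sIJ' lI' lJ' r1' c1' sl' sr'].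
set R := A - _ in r1' c1' *.
have DR : coord_proj m I *m R = 0 by rewrite mulmxBr !mulmxA r1 subrr.
have RD : R *m coord_proj p J = 0.
  by rewrite mulmxBl -!mulmxA [Z *m _]mulmxA c1 subrr.
have AQ : A *m (Y - Z *m A *m Y) = R *m Y.
  by rewrite mulmxBr mulmxBl !mulmxA.
have AZ' : A *m pivot_step A Z Y = A *m Z + R *m Y - R *m Y *m A *m Z.
  by rewrite /pivot_step mulmxBr mulmxDr AQ !mulmxA AQ.
have ZA' : pivot_step A Z Y *m A = Z *m A + (Y - Z *m A *m Y) *m R.
  rewrite /pivot_step mulmxBl mulmxDl -addrA; congr (_ + _).
  by rewrite [in RHS]mulmxBr !mulmxA.
have dI i : i \in I -> i \in I' -> False.
  move=> iI iI'; have im := allP lI i iI.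
  have /matrixP/(_ (Ordinal im) (Ordinal im)) : coord_proj m I *m coord_proj m I' = 0.
    by rewrite -r1' !mulmxA [coord_proj m I *m coord_proj m I']diag_mxC -!mulmxA
       [coord_proj m I *m _]mulmxA DR mul0mx mulmx0.
  rewrite coord_proj_mul coord_projE eqxx /= iI iI' mulr1 mxE => /eqP.
  by rewrite oner_eq0.
have dJ j : j \in J -> j \in J' -> False.
  move=> jJ jJ'; have jp := allP lJ j jJ.
  have /matrixP/(_ (Ordinal jp) (Ordinal jp)) : coord_proj p J' *m coord_proj p J = 0.
    by rewrite -c1' -!mulmxA [coord_proj p J' *m coord_proj p J]diag_mxC [R *m _]mulmxA
       RD mul0mx mulmx0.
  rewrite coord_proj_mul coord_projE eqxx /= jJ jJ' mulr1 mxE => /eqP.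
  by rewrite oner_eq0.
have subl (T : seq nat) T' : {subset T <= T ++ T'}.
  by move=> x xT; rewrite mem_cat xT.
have subr (T : seq nat) T' : {subset T' <= T ++ T'}.
  by move=> x xT; rewrite mem_cat xT orbT.
split.
- rewrite cat_uniq uI uI' andbT; apply/hasPn => x xI'; apply/negP => xI.
  exact: (dI x).
- rewrite cat_uniq uJ uJ' andbT; apply/hasPn => x xI'; apply/negP => xI.
  exact: (dJ x).
- by rewrite !size_cat sIJ sIJ'.
- by rewrite all_cat lI.
- by rewrite all_cat lJ.
- rewrite -mulmxA AZ' coord_proj_cat // mulmxDl !mulmxBr !mulmxDr !mulmxA.
  rewrite r1 DR !mul0mx subr0 addr0; congr (_ + _).
  by rewrite r1' [X in X - _]addrC addrK.
- rewrite ZA' coord_proj_cat // mulmxDr mulmxDl c1 -mulmxA RD mulmx0 addr0.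
  congr (_ + _); rewrite mulmxDl mulmxBl mulmxBl -!mulmxA [Y *m _]mulmxA c1'.
  by rewrite addrC subrK.
- have aZ : coord_proj p (J ++ J') *m Z = Z.
    by rewrite -{1}sl mulmxA (proj1 (coord_proj_absorb p (subl J J'))).
  have aY : coord_proj p (J ++ J') *m Y = Y.
    by rewrite -{1}sl' mulmxA (proj1 (coord_proj_absorb p (subr J J'))).
  by rewrite /pivot_step mulmxBr mulmxDr !mulmxA !mulmxBr !mulmxA aZ aY.
- have aZ : Z *m coord_proj m (I ++ I') = Z.
    by rewrite -{1}sr -mulmxA (proj2 (coord_proj_absorb m (subl I I'))).
  have aY : Y *m coord_proj m (I ++ I') = Y.
    by rewrite -{1}sr' -mulmxA (proj2 (coord_proj_absorb m (subr I I'))).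
  by rewrite /pivot_step mulmxBl mulmxDl !mulmxBl -!mulmxA aZ aY.
Qed.

Definition half_sel (h : nat) (a : bool) : 'M[K]_(h, h + h) :=
  if a then row_mx 0 1%:M else row_mx 1%:M 0.

Definition half_shift (h : nat) (a : bool) (I : seq nat) :=
  if a then [seq (h + i)%N | i <- I] else I.

Lemma half_selK h a : half_sel h a *m (half_sel h a)^T = 1%:M.
Proof.
by case: a; rewrite /half_sel tr_row_mx mul_row_col trmx0 trmx1
  !(mulmx0, mul0mx) mulmx1 ?add0r ?addr0.
Qed.

Lemma half_sel_total h :
  (half_sel h false)^T *m half_sel h false
  + (half_sel h true)^T *m half_sel h true = 1%:M.
Proof.
rewrite /half_sel !tr_row_mx !mul_col_row !trmx0 !trmx1.
by rewrite !(mulmx0, mul0mx, mulmx1) add_block_mx !(addr0, add0r)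
  -scalar_mx_block.
Qed.

Lemma coord_proj_half_shift h a I : all (fun i => i < h)%N I ->
  coord_proj (h + h) (half_shift h a I) = (half_sel h a)^T *m coord_proj h I *m half_sel h a.
Proof.
move=> lI; rewrite /half_sel /half_shift; case: a.
  rewrite tr_row_mx trmx0 trmx1 mul_col_mx mul_col_row.
  rewrite !(mulmx0, mul0mx, mulmx1, mul1mx).
  apply/matrixP => i j; rewrite coord_projE.
  case: (split_ordP i) => i' ->; case: (split_ordP j) => j' ->.
  - rewrite block_mxEul mxE (_ : _ \in _ = false) ?andbF //.
    by apply/negP => /mapP[x _ /= e]; have := ltn_ord i'; rewrite e; lia.
  - by rewrite block_mxEur mxE eq_lrshift.
  - by rewrite block_mxEdl mxE eq_rlshift.
  - rewrite block_mxEdr coord_projE eq_rshift /= mem_map //; exact: addnI.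
rewrite tr_row_mx trmx0 trmx1 mul_col_mx mul_col_row.
rewrite !(mulmx0, mul0mx, mulmx1, mul1mx).
apply/matrixP => i j; rewrite coord_projE.
case: (split_ordP i) => i' ->; case: (split_ordP j) => j' ->.
- by rewrite block_mxEul coord_projE eq_lshift.
- by rewrite block_mxEur mxE eq_lrshift.
- by rewrite block_mxEdl mxE eq_rlshift.
- rewrite block_mxEdr mxE eq_rshift (_ : _ \in _ = false) ?andbF //.
  by apply/negP => /(allP lI) /=; lia.
Qed.

(** A minor of a quadrant is a minor of the whole matrix. *)
Lemma pivoting_quadrant h (a b : bool) (R : 'M[K]_(h + h)) (Y : 'M[K]_h) I J :
  pivoting (half_sel h a *m R *m (half_sel h b)^T) Y I J ->
  pivoting R ((half_sel h b)^T *m Y *m half_sel h a)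
    (half_shift h a I) (half_shift h b J).
Proof.
move=> [uI uJ sIJ lI lJ r1 c1 sl sr].
have uniqs c T : uniq T -> uniq (half_shift h c T).
  by case: c => //= uT; rewrite map_inj_uniq //; apply: addnI.
have alls c T : all (fun i => i < h)%N T ->
    all (fun i => i < h + h)%N (half_shift h c T).
  case: c => /allP lT; apply/allP => x /=.
    by move=> /mapP[y /lT yh ->]; lia.
  by move/lT; lia.
have sizes c T : size (half_shift h c T) = size T.
  by case: c => //=; rewrite size_map.
split; rewrite ?sizes ?alls ?uniqs // !coord_proj_half_shift //.
- by rewrite -[in RHS]r1 !mulmxA.
- rewrite -[in RHS]c1 !mulmxA; congr (_ *m _ *m _).
- by rewrite -!mulmxA (mulmxA (half_sel h b)) half_selK mul1mx (mulmxA _ Y) sl.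
- by rewrite !mulmxA -(mulmxA _ (half_sel h a)) half_selK mulmx1 -(mulmxA _ Y) sr.
Qed.
End Pivots.

(** * Bases and padding read off the pivots *)

Section RowBasis.
Variable K : fieldType.

Definition rowsel (m : nat) (I : seq nat) : 'M[K]_(size I, m) :=
  \matrix_(t, i) (nth 0%N I t == i)%:R.

Definition compl (d : nat) (J : seq nat) : seq nat :=
  [seq j <- iota 0 d | j \notin J].

Lemma mul_rowsel m p (I : seq nat) (A : 'M[K]_(m, p)) (t : 'I_(size I))
    (i : 'I_m) j :
  nth 0%N I t = i -> (rowsel m I *m A) t j = A i j.
Proof.
move=> tE; rewrite mxE (bigD1 i) //= mxE tE eqxx mul1r big1 ?addr0 // => i' ii'.
by rewrite mxE tE eq_sym -val_eqE in ii' *; rewrite (negPf ii') mul0r.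
Qed.

Lemma tr_rowselK m (I : seq nat) : uniq I ->
  (rowsel m I)^T *m rowsel m I = coord_proj K m I.
Proof.
move=> uI; apply/matrixP => i j; rewrite coord_projE mxE.
under eq_bigr do rewrite !mxE -natrM mulnb.
case: (boolP (val i \in I)) => [iI|iI]; last first.
  rewrite andbF big1 // => t _; case: eqP => //= ti.
  by case/negP: iI; have := mem_nth 0%N (ltn_ord t); rewrite ti.
have ti : (index (val i) I < size I)%N by rewrite index_mem.
rewrite (bigD1 (Ordinal ti)) //= nth_index // eqxx andbT /= big1 ?addr0.
  by rewrite -val_eqE.
move=> t; rewrite -val_eqE /= => ne; case: eqP => //= te; case/negP: ne.
by rewrite -te index_uniq.
Qed.

Lemma uniq_compl d J : uniq (compl d J).
Proof. by rewrite filter_uniq // iota_uniq. Qed.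

Lemma size_compl d J : uniq J -> all (fun j => j < d)%N J ->
  (size J + size (compl d J))%N = d.
Proof.
move=> uJ /allP lJ; rewrite -[RHS](size_iota 0 d).
rewrite -(count_predC [in J] (iota 0 d)) -!size_filter; congr (_ + _)%N.
apply/perm_size/uniq_perm => // [|j]; first by rewrite filter_uniq // iota_uniq.
rewrite mem_filter mem_iota /=; apply/idP/andP => [jJ|[]//].
by rewrite jJ lJ.
Qed.

Lemma coord_proj_compl d J : coord_proj K d (compl d J) = 1%:M - coord_proj K d J.
Proof.
apply/matrixP => i j; rewrite coord_projE.
have -> : (1%:M - coord_proj K d J) i j = (i == j)%:R - coord_proj K d J i j by rewrite !mxE.
rewrite coord_projE mem_filter mem_iota /= ltn_ord andbT.
by case: eqP => _; case: (_ \in J); rewrite ?subr0 ?subrr.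
Qed.

Section Basis.
Variables (m d : nat) (A : 'M[K]_(m, d)) (Z : 'M[K]_(d, m)) (I J : seq nat).
Hypothesis piv : pivoting A Z I J.
Hypothesis AZA : A *m Z *m A = A.

(** The pivot rows of [A], completed by the coordinate vectors of the columns
    without pivot. *)
Definition rowbasis : 'M[K]_(size I + size (compl d J), d) :=
  col_mx (rowsel m I *m A) (rowsel d (compl d J)).

Definition rowbasis_inv : 'M[K]_(d, size I + size (compl d J)) :=
  row_mx (Z *m (rowsel m I)^T) ((1%:M - Z *m A) *m (rowsel d (compl d J))^T).

Lemma rowbasis_dim : (size I + size (compl d J))%N = d.
Proof. by case: piv => _ uJ -> _ lJ _ _ _ _; apply: size_compl. Qed.

(** [Z A] is a projector that fixes the pivot coordinates, so
    Z A + (1 - Z A) (1 - D_J) = 1, where D_J projects on the pivot columns. *)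
Lemma rowbasisVK : rowbasis_inv *m rowbasis = 1%:M.
Proof.
case: piv => uI uJ _ _ _ r1 c1 sl sr; rewrite mul_row_col.
rewrite mulmxA -(mulmxA Z) tr_rowselK // sr -mulmxA tr_rowselK ?uniq_compl //.
rewrite coord_proj_compl mulmxBr mulmx1 mulmxBl mul1mx c1 subrr subr0.
by rewrite addrC subrK.
Qed.

Lemma rowbasis_span : (usubmx rowbasis :=: A)%MS.
Proof.
case: piv => uI uJ _ _ _ r1 c1 sl sr; rewrite col_mxKu.
apply/eqmxP/andP; split; first exact: submxMl.
apply/submxP; exists (A *m Z *m (rowsel m I)^T).
by rewrite mulmxA -(mulmxA _ _ (rowsel m I)) tr_rowselK // -(mulmxA A) sr AZA.
Qed.
End Basis.

Definition pad (N m p : nat) (A : 'M[K]_(m, p)) : 'M[K]_N :=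
  pid_mx m *m A *m pid_mx p.

Lemma pid_mxK N m : (m <= N)%N ->
  (pid_mx m : 'M[K]_(m, N)) *m (pid_mx m : 'M[K]_(N, m)) = 1%:M.
Proof. by move=> mN; rewrite mul_pid_mx minnn (minn_idPr mN) pid_mx_1. Qed.

Lemma padE N m p (A : 'M[K]_(m, p)) (i j : 'I_N) :
  pad N A i j = if insub (val i) is Some i' then
                  if insub (val j) is Some j' then A i' j' else 0 else 0.
Proof.
have lE q (B : 'M[K]_(m, q)) k : ((pid_mx m : 'M[K]_(N, m)) *m B) i k =
    if insub (val i) is Some i' then B i' k else 0.
  rewrite mxE; case: insubP => [i' _ ii'|im].
    rewrite (bigD1 i') //= mxE -ii' eqxx (ltn_ord i') mul1r big1 ?addr0 // => i2 ne.
    by rewrite mxE -ii' eq_sym (inj_eq val_inj) (negPf ne) mul0r.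
  by apply: big1 => i' _; rewrite mxE (negPf im) andbF mul0r.
rewrite /pad -mulmxA lE; case: insubP => // i' _ _.
rewrite mxE; case: insubP => [j' _ jj'|jp].
  rewrite (bigD1 j') //= mxE -jj' eqxx (ltn_ord j') mulr1 big1 ?addr0 // => j2 ne.
  by rewrite mxE -jj' (inj_eq val_inj) (negPf ne) mulr0.
apply: big1 => j' _; rewrite mxE; case: eqP => [e|_] /=; rewrite ?mulr0 //.
by case/negP: jp; have := ltn_ord j'; rewrite e.
Qed.

Lemma pad_mul N m p q (A : 'M[K]_(m, p)) (B : 'M[K]_(p, q)) :
  (m <= N)%N -> (p <= N)%N -> (q <= N)%N ->
  A *m B = pid_mx m *m (pad N A *m pad N B) *m pid_mx q.
Proof.
move=> mN pN qN; rewrite /pad !mulmxA pid_mxK // mul1mx -!mulmxA.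
by rewrite (mulmxA (pid_mx p)) pid_mxK // mul1mx pid_mxK // mulmx1.
Qed.

Lemma unpadE N m p (C : 'M[K]_N) (i : 'I_m) (j : 'I_p) (i' j' : 'I_N) :
  i' = i :> nat -> j' = j :> nat ->
  ((pid_mx m : 'M[K]_(m, N)) *m C *m (pid_mx p : 'M[K]_(N, p))) i j = C i' j'.
Proof.
move=> ii' jj'; have Pi k : (pid_mx m : 'M[K]_(m, N)) i k = (k == i')%:R.
  by rewrite mxE ltn_ord andbT -ii' eq_sym (inj_eq val_inj).
have Pj k : (pid_mx p : 'M[K]_(N, p)) k j = (k == j')%:R.
  by rewrite mxE -jj' (inj_eq val_inj); case: eqP => // ->; rewrite jj' ltn_ord.
rewrite mxE (bigD1 j') //= Pj eqxx mulr1 big1 ?addr0 => [|k /negPf ne].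
  rewrite mxE (bigD1 i') //= Pi eqxx mul1r big1 ?addr0 // => k /negPf ne.
  by rewrite Pi ne mul0r.
by rewrite Pj ne mulr0.
Qed.

(** Padding adds rows and columns of zeros, which carry no pivot; so a result
    computed at a power of two restricts to the original size. *)
Lemma pivoting_unpad N m p (A : 'M[K]_(m, p)) (Z : 'M[K]_N) I J :
  (m <= N)%N -> (p <= N)%N -> pivoting (pad N A) Z I J ->
  let Z' : 'M[K]_(p, m) := pid_mx p *m Z *m pid_mx m in
  pivoting A Z' I J /\
  (pad N A *m Z *m pad N A = pad N A -> A *m Z' *m A = A).
Proof.
move=> mN pN [uI uJ sIJ lI lJ r1 c1 sl sr] Z'.
have pad0l (i j : 'I_N) : (m <= i)%N -> pad N A i j = 0.
  by move=> mi; rewrite padE insubF //= ltnNge mi.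
have pad0r (i j : 'I_N) : (p <= j)%N -> pad N A i j = 0.
  move=> pj; rewrite padE; case: insub => // i'.
  by rewrite insubF //= ltnNge pj.
have lIm : all (fun i => i < m)%N I.
  apply/allP => i iI; have iN := allP lI i iI; rewrite ltnNge; apply/negP => mi.
  have /matrixP/(_ (Ordinal iN) (Ordinal iN)) := r1.
  rewrite coord_projE eqxx /= iI mxE big1 => [/esym/eqP|k _]; first by rewrite oner_eq0.
  by rewrite coord_proj_mul pad0l // mulr0 mul0r.
have lJp : all (fun i => i < p)%N J.
  apply/allP => i iI; have iN := allP lJ i iI; rewrite ltnNge; apply/negP => mi.
  have /matrixP/(_ (Ordinal iN) (Ordinal iN)) := c1.
  rewrite coord_projE eqxx /= iI -mulmxA mxE big1 => [/esym/eqP|k _].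
    by rewrite oner_eq0.
  by rewrite mul_dsel pad0r // mul0r mulr0.
have dE (q : nat) T : (q <= N)%N ->
    (pid_mx q : 'M[K]_(q, N)) *m coord_proj K N T = coord_proj K q T *m pid_mx q /\
    coord_proj K N T *m (pid_mx q : 'M[K]_(N, q)) = pid_mx q *m coord_proj K q T.
  move=> qN; split; apply/matrixP => i j; rewrite coord_proj_mul mul_dsel !mxE;
    by case: eqP => [/= ->|_] /=; [rewrite mulrC | rewrite mulr0n mul0r mulr0].
have [mI mI'] := dE m I mN; have [pJ pJ'] := dE p J pN.
have AE : A = pid_mx m *m pad N A *m pid_mx p.
  by rewrite /pad !mulmxA pid_mxK // mul1mx -mulmxA pid_mxK // mulmx1.
have AZ : A *m Z' = pid_mx m *m (pad N A *m Z) *m pid_mx m.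
  by rewrite /Z' /pad !mulmxA pid_mxK // mul1mx.
have ZA : Z' *m A = pid_mx p *m (Z *m pad N A) *m pid_mx p.
  by rewrite /Z' /pad -!mulmxA pid_mxK // mulmx1.
split; last first.
  have PA : pad N A *m pid_mx p = pid_mx m *m A.
    by rewrite /pad -mulmxA pid_mxK // mulmx1.
  by move=> e; rewrite AZ -(mulmxA _ (pid_mx m) A) -PA mulmxA
    -(mulmxA (pid_mx m)) e -AE.
split=> //.
- rewrite -mulmxA AZ !(mulmxA (coord_proj K m I)) -mI -(mulmxA _ (coord_proj K N I)).
  by rewrite (mulmxA (coord_proj K N I)) r1 mI -mulmxA pid_mxK // mulmx1.
- rewrite ZA -mulmxA -pJ' -mulmxA (mulmxA (Z *m _)) c1 pJ' mulmxA pid_mxK //.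
  by rewrite mul1mx.
- by rewrite /Z' !mulmxA -pJ -(mulmxA _ _ Z) sl.
- by rewrite /Z' -mulmxA -mI' mulmxA -(mulmxA _ Z) sr.
Qed.
End RowBasis.

(** * Cyclic vectors and nonderogatory matrices *)

Section Cyclic.
Variable K : fieldType.

(** The rows of [U] generate the module of row vectors over K[X], where X acts
    by [A]; for a single row this says that it is cyclic. *)
Definition generates d h (A : 'M[K]_d) (U : 'M[K]_(h, d)) : Prop :=
  forall V : 'M[K]_d, (U <= V)%MS -> (V *m A <= V)%MS -> (1%:M <= V)%MS.

Definition kry w d (A : 'M[K]_d) (x : 'rV[K]_d) : 'M[K]_(w, d) :=
  \matrix_(i < w) (x *m A ^+ i).

Definition nonderog d (A : 'M[K]_d) : Prop :=
  forall c : 'rV[K]_d, \sum_i c 0 i *: A ^+ i = 0 -> c = 0.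

Lemma horner_mx_sum d (A : 'M[K]_d.+1) n (p : {poly K}) : (size p <= n)%N ->
  horner_mx A p = \sum_(i < n) p`_i *: A ^+ i.
Proof.
move=> sp; rewrite -[in LHS](coefK p) (poly_def (size p)) linear_sum /=.
rewrite (big_ord_widen n (fun i => horner_mx A (p`_i *: 'X^i)) sp) big_mkcond.
apply: eq_bigr => i _; case: ltnP => [_|pi].
  by rewrite linearZ /= rmorphXn /= horner_mx_X.
by rewrite nth_default // scale0r.
Qed.

Lemma mul_horner_mx d (A : 'M[K]_d.+1) n (p : {poly K}) h (U : 'M[K]_(h, _)) :
  (size p <= n)%N ->
  U *m horner_mx A p = \sum_(i < n) p`_i *: (U *m A ^+ i).
Proof.
move=> sp; rewrite (horner_mx_sum _ sp) mulmx_sumr.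
by apply: eq_bigr => i _; rewrite -scalemxAr.
Qed.

Lemma nonderogP d (A : 'M[K]_d.+1) :
  nonderog A <->
  (forall p : {poly K}, (size p <= d.+1)%N -> horner_mx A p = 0 -> p = 0).
Proof.
split=> nd => [p sp Ap0|c cA0].
  have : poly_rV p = 0 :> 'rV[K]_d.+1.
    apply: nd; rewrite -[RHS]Ap0 (horner_mx_sum _ sp).
    by apply: eq_bigr => i _; rewrite mxE.
  by move=> /(congr1 rVpoly); rewrite poly_rV_K // linear0.
have : rVpoly c = 0.
  apply: nd; first exact: size_poly.
  rewrite (@horner_mx_sum _ _ d.+1) ?size_poly // -[RHS]cA0.
  by apply: eq_bigr => i _; rewrite coef_rVpoly_ord.
by move=> /(congr1 (@poly_rV _ d.+1)); rewrite rVpolyK linear0.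
Qed.

Lemma row_kry w d (A : 'M[K]_d) x i : row i (kry w A x) = x *m A ^+ i.
Proof. by rewrite rowK. Qed.

Lemma mul_kry d (A : 'M[K]_d.+1) x n (p : {poly K}) : (size p <= n)%N ->
  (poly_rV p : 'rV[K]_n) *m kry n A x = x *m horner_mx A p.
Proof.
move=> sp; rewrite (mul_horner_mx _ _ sp) mulmx_sum_row.
by apply: eq_bigr => i _; rewrite row_kry mxE.
Qed.

Lemma expr_mx_span d (A : 'M[K]_d) :
  exists c : 'I_d -> K, A ^+ d = \sum_i c i *: A ^+ i.
Proof.
case: d A => [|d] A; first by exists (fun=> 0); rewrite big_ord0 [LHS]flatmx0.
exists (fun i => - (char_poly A)`_i).
have := Cayley_Hamilton A.
rewrite (@horner_mx_sum _ _ d.+2) ?size_char_poly // big_ord_recr /=.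
have := char_poly_monic A; rewrite monicE lead_coefE size_char_poly /= => /eqP ->.
rewrite scale1r => /eqP; rewrite addrC addr_eq0 => /eqP ->.
by rewrite -sumrN; apply: eq_bigr => i _; rewrite scaleNr.
Qed.

(** By Cayley-Hamilton the first d powers of [A] span all of them. *)
Lemma expr_mx_stable d h w (A : 'M[K]_d) (U : 'M[K]_(h, d)) (S : 'M[K]_(w, d)) :
  (forall i, (i < d)%N -> (U *m A ^+ i <= S)%MS) ->
  forall i, (U *m A ^+ i <= S)%MS.
Proof.
move=> US i; have [//|_] := ltnP i d; first exact: US.
have [c cE] := expr_mx_span A; elim: i {-2}i (leqnn i) => [|n IH] i.
  by rewrite leqn0 => /eqP ->; case: (d) A U S US c cE => [|d'] A' U' S' US *;
    [rewrite [_ *m _]thinmx0 sub0mx | exact: US].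
move=> le_in; have [|le_di] := ltnP i d; first exact: US.
rewrite -(subnKC le_di) exprD cE -mulmxE mulmxA mulmx_sumr mulmx_suml.
apply: summx_sub => j _; rewrite -scalemxAr -scalemxAl scalemx_sub //.
rewrite -mulmxA mulmxE -exprD; apply: IH.
have := ltn_ord j; lia.
Qed.

Lemma kry_full d (A : 'M[K]_d) x : generates A x -> kry d A x \in unitmx.
Proof.
move=> gx; rewrite -row_full_unit -sub1mx; apply: gx.
  case: d A x => [|d] A x; first by rewrite thinmx0 sub0mx.
  by have := row_sub 0 (kry d.+1 A x); rewrite row_kry expr0 mulmx1.
apply/row_subP => i; rewrite row_mul row_kry -mulmxA mulmxE -exprSr.
apply: expr_mx_stable => j lt_jd.
by have := row_sub (Ordinal lt_jd) (kry d A x); rewrite row_kry.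
Qed.

Lemma kry_generates d (A : 'M[K]_d) x : kry d A x \in unitmx -> generates A x.
Proof.
rewrite -row_full_unit -sub1mx => fx V xV AV; apply: submx_trans fx _.
apply/row_subP => i; rewrite row_kry.
elim: (val i) => [|n IH]; first by rewrite expr0 mulmx1.
by rewrite exprSr -mulmxE mulmxA (submx_trans _ AV) // submxMr.
Qed.

Lemma generates_inj d (A : 'M[K]_d.+1) (x : 'rV[K]_d.+1) (p : {poly K}) :
  generates A x -> (size p <= d.+1)%N -> x *m horner_mx A p = 0 -> p = 0.
Proof.
move=> /kry_full Ku sp; rewrite -(mul_kry _ _ sp).
move=> /(congr1 (mulmx^~ (invmx (kry d.+1 A x)))) /=.
rewrite mulmxK // mul0mx => /(congr1 rVpoly).
by rewrite poly_rV_K // linear0.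
Qed.

Lemma inj_generates d (A : 'M[K]_d.+1) (x : 'rV[K]_d.+1) :
  (forall p : {poly K}, (size p <= d.+1)%N -> x *m horner_mx A p = 0 -> p = 0) ->
  generates A x.
Proof.
move=> xinj; apply: kry_generates; rewrite -row_free_unit.
apply: inj_row_free => v vK0; rewrite -[v]rVpolyK (xinj (rVpoly v)) ?linear0 //.
  exact: size_poly.
by rewrite -(@mul_kry _ _ _ d.+1) ?size_poly // rVpolyK.
Qed.

Lemma generates_poly d (A : 'M[K]_d.+1) (x w : 'rV[K]_d.+1) :
  generates A x -> exists2 p : {poly K}, (size p <= d.+1)%N & w = x *m horner_mx A p.
Proof.
move=> /kry_full Ku; exists (rVpoly (w *m invmx (kry d.+1 A x))).
  exact: size_poly.
by rewrite -(@mul_kry _ _ _ d.+1) ?size_poly // rVpolyK mulmxKV.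
Qed.

Lemma horner_mx_intertwine d1 d2 (A : 'M[K]_d1.+1) (B : 'M[K]_d2.+1)
    (L : 'M[K]_(d1.+1, d2.+1)) p :
  L *m B = A *m L -> L *m horner_mx B p = horner_mx A p *m L.
Proof.
move=> LB; elim/poly_ind: p => [|p c IH]; first by rewrite !rmorph0 mulmx0 mul0mx.
rewrite !rmorphD !rmorphM /= !horner_mx_X !horner_mx_C mulmxDr mulmxDl.
rewrite mul_mx_scalar mul_scalar_mx; congr (_ + _).
by rewrite -!mulmxE mulmxA IH -!mulmxA LB.
Qed.

(** The greatest common divisor of X^2N and the characteristic polynomial is
    some X^k with k at most the size of [A], since it divides both; Bezout and
    Cayley-Hamilton conclude.  This identity gives the Fitting
    decomposition: A^N and A^2N have the same kernel and the same image. *)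
Lemma fitting d (A : 'M[K]_d.+1) N : (d.+1 <= N)%N ->
  exists s : {poly K}, A ^+ N = horner_mx A s *m A ^+ (N + N).
Proof.
move=> le_dN.
have X0 : ('X : {poly K}) = 'X - 0%:P by rewrite subr0.
have : gcdp ('X^(N + N)) (char_poly A) %| ('X - 0%:P) ^+ (N + N).
  by rewrite -X0 dvdp_gcdl.
case/dvdp_exp_XsubCP => k _ gk.
have le_kd : (k <= d.+1)%N.
  have : gcdp ('X^(N + N)) (char_poly A) %| char_poly A by rewrite dvdp_gcdr.
  rewrite (eqp_dvdl _ gk) => /dvdp_leq.
  rewrite -size_poly_eq0 size_char_poly => /(_ isT).
  by rewrite -X0 size_polyXn.
have [u uE] := Bezoutp ('X^(N + N)) (char_poly A).
have := eqp_trans uE gk; rewrite -X0 eqp_sym => /eqpP[[a b] /= /andP[a0 b0]].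
move=> e; exists ((a^-1 * b) *: ('X^(N - k) * u.1)).
have /(congr1 (horner_mx A)) : 'X^k = (a^-1 * b) *: (u.1 * 'X^(N + N) + u.2 * char_poly A).
  by rewrite -scalerA -e scalerA mulVf // scale1r.
rewrite linearZ rmorphD !rmorphM /= Cayley_Hamilton mulr0 addr0.
rewrite !rmorphXn /= horner_mx_X => kE.
rewrite -{1}(subnK (leq_trans le_kd le_dN)) exprD kE.
by rewrite linearZ /= rmorphM rmorphXn /= horner_mx_X mulmxE -scalerAr -scalerAl mulrA.
Qed.
End Cyclic.

(** * Gluing two cyclic vectors *)

Section Annihilators.
Variable K : fieldType.

Lemma horner_mx_dvdp d (A : 'M[K]_d.+1) h (v : 'M[K]_(h, d.+1)) p q :
  v *m horner_mx A p = 0 -> p %| q -> v *m horner_mx A q = 0.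
Proof.
move=> vp /dvdpP[r ->]; rewrite mulrC rmorphM /= -mulmxE mulmxA vp.
exact: mul0mx.
Qed.

Lemma horner_mx_gcdp d (A : 'M[K]_d.+1) h (v : 'M[K]_(h, d.+1)) p q :
  v *m horner_mx A p = 0 -> v *m horner_mx A q = 0 ->
  v *m horner_mx A (gcdp p q) = 0.
Proof.
move=> vp vq; have [u uE] := Bezoutp p q.
apply: (@horner_mx_dvdp _ _ _ _ (u.1 * p + u.2 * q)).
  rewrite rmorphD mulmxDr (horner_mx_dvdp vp (dvdp_mull _ (dvdpp _))).
  by rewrite (horner_mx_dvdp vq (dvdp_mull _ (dvdpp _))) addr0.
by case/andP: uE.
Qed.

Lemma horner_mxC d (A : 'M[K]_d.+1) p q :
  horner_mx A p *m horner_mx A q = horner_mx A q *m horner_mx A p.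
Proof. exact: comm_horner_mx2. Qed.

Lemma horner_mx_exprC d (A : 'M[K]_d.+1) p i :
  horner_mx A p *m A ^+ i = A ^+ i *m horner_mx A p.
Proof. by have := horner_mxC A p 'X^i; rewrite rmorphXn /= horner_mx_X. Qed.
End Annihilators.

(** Row vectors of block form (u, v); the first block is stable under M, the
    second is a quotient. *)
Section BlockTriangular.
Variables (K : fieldType) (d1' d2' : nat).
Local Notation d1 := d1'.+1.
Local Notation d2 := d2'.+1.
Variables (A1 : 'M[K]_d1) (B : 'M[K]_(d2, d1)) (A2 : 'M[K]_d2).
Let M : 'M[K]_(d1 + d2) := block_mx A1 0 B A2.
Let injl : 'M[K]_(d1, d1 + d2) := row_mx 1%:M 0.
Let projr : 'M[K]_(d1 + d2, d2) := col_mx 0 1%:M.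

Let injlM : injl *m M = A1 *m injl.
Proof.
by rewrite mul_row_block mul_mx_row !mul1mx !mul0mx !mulmx0 mulmx1 !addr0.
Qed.

Let Mprojr : M *m projr = projr *m A2.
Proof.
by rewrite mul_block_col mul_col_mx !mulmx1 !mulmx0 mul0mx mul1mx !add0r.
Qed.

Let horner_l p : injl *m horner_mx M p = horner_mx A1 p *m injl.
Proof. exact: horner_mx_intertwine injlM. Qed.

Let horner_r p : horner_mx M p *m projr = projr *m horner_mx A2 p.
Proof. by rewrite (horner_mx_intertwine p (esym Mprojr)). Qed.

Let through_l h (v : 'M[K]_(h, d1 + d2)) : v *m projr = 0 -> v = lsubmx v *m injl.
Proof.
rewrite -{1}[v]hsubmxK mul_row_col mulmx0 add0r mulmx1 => r0.
by rewrite mul_mx_row mulmx1 mulmx0 -[LHS]hsubmxK r0.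
Qed.

(** If p(A1) = 0 then chi_A2(M) p(M) = 0, because chi_A2(M) maps everything into
    the first block. *)
Lemma nonderog_ul : nonderog M -> nonderog A1.
Proof.
move=> /nonderogP nd; apply/nonderogP => p sp Ap0.
have c0 : char_poly A2 != 0 by rewrite -size_poly_eq0 size_char_poly.
suff : char_poly A2 * p = 0.
  by move/eqP; rewrite mulf_eq0 (negPf c0) => /eqP.
apply: nd.
  rewrite -[X in (_ <= X)%N]/(d1 + d2)%N; apply: leq_trans (size_polyMleq _ _) _.
  by rewrite size_char_poly; lia.
rewrite rmorphM /= -mulmxE (through_l (v := horner_mx M _)).
  by rewrite -mulmxA horner_l Ap0 mul0mx mulmx0.
by rewrite horner_r Cayley_Hamilton mulmx0.
Qed.

Lemma nonderog_dr : nonderog M -> nonderog A2.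
Proof.
move=> /nonderogP nd; apply/nonderogP => p sp Ap0.
have c0 : char_poly A1 != 0 by rewrite -size_poly_eq0 size_char_poly.
suff : p * char_poly A1 = 0.
  by move/eqP; rewrite mulf_eq0 (negPf c0) orbF => /eqP.
apply: nd.
  rewrite -[X in (_ <= X)%N]/(d1 + d2)%N; apply: leq_trans (size_polyMleq _ _) _.
  by rewrite size_char_poly; lia.
rewrite rmorphM /= -mulmxE (through_l (v := horner_mx M p)).
  by rewrite -mulmxA horner_l Cayley_Hamilton mul0mx mulmx0.
by rewrite horner_r Ap0 mulmx0.
Qed.

Variables (x : 'rV[K]_d1) (y : 'rV[K]_d2).
Let y0 : 'rV[K]_(d1 + d2) := row_mx 0 y.
Let Y := kry d2 M y0.

(** The row (0, y) chi_A2(M) lies in the first block and this is its value there: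
    a combination of the rows (0, y) M^i with leading coefficient 1 whose second
    block vanishes is unique. *)
Definition merge_defect : 'rV[K]_d1 :=
  let r := y0 *m M ^+ d2 in lsubmx r - rsubmx r *m invmx (rsubmx Y) *m lsubmx Y.

(** The endomorphism commuting with [A1] that maps x to the defect. *)
Definition merge_endo : 'M[K]_d1 := invmx (kry d1 A1 x) *m kry d1 A1 merge_defect.

Hypothesis ndM : nonderog M.
Hypothesis gx : generates A1 x.
Hypothesis gy : generates A2 y.

Let y0projr : y0 *m projr = y.
Proof. by rewrite mul_row_col mul0mx add0r mulmx1. Qed.

Lemma kry_quotient : rsubmx Y = kry d2 A2 y.
Proof.
have rE h (v : 'M[K]_(h, d1 + d2)) : rsubmx v = v *m projr.
  by rewrite -{2}[v]hsubmxK mul_row_col mulmx0 add0r mulmx1.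
apply/row_matrixP => i; rewrite rE row_mul !row_kry -mulmxA.
have -> : M ^+ i *m projr = projr *m A2 ^+ i.
  by have := horner_r 'X^i; rewrite !rmorphXn /= !horner_mx_X.
by rewrite mulmxA y0projr.
Qed.

Lemma merge_defectE :
  y0 *m horner_mx M (char_poly A2) = merge_defect *m injl.
Proof.
rewrite [LHS]through_l; last first.
  by rewrite -mulmxA horner_r Cayley_Hamilton mulmx0 mulmx0.
congr (_ *m _).
have rv h (v : 'M[K]_(h, d1 + d2)) : rsubmx v = v *m projr.
  by rewrite -{2}[v]hsubmxK mul_row_col mulmx0 add0r mulmx1.
have Yu : rsubmx Y \in unitmx by rewrite kry_quotient kry_full.
set c : 'rV[K]_d2 := \row_i (char_poly A2)`_i.
have gE : y0 *m horner_mx M (char_poly A2) = y0 *m M ^+ d2 + c *m Y.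
  rewrite (@mul_horner_mx _ _ _ d2.+1) ?size_char_poly // big_ord_recr /=.
  have := char_poly_monic A2; rewrite monicE lead_coefE size_char_poly /= => /eqP ->.
  rewrite scale1r addrC; congr (_ + _).
  by rewrite mulmx_sum_row; apply: eq_bigr => i _; rewrite row_kry mxE.
have cYl : lsubmx (c *m Y) = c *m lsubmx Y.
  by rewrite -{1}[Y]hsubmxK mul_mx_row row_mxKl.
have cYr : rsubmx (c *m Y) = c *m rsubmx Y.
  by rewrite -{1}[Y]hsubmxK mul_mx_row row_mxKr.
have cE : c = - (rsubmx (y0 *m M ^+ d2) *m invmx (rsubmx Y)).
  have : rsubmx (y0 *m horner_mx M (char_poly A2) : 'rV[K]_(d1 + d2)) = 0.
    by rewrite rv -mulmxA horner_r Cayley_Hamilton mulmx0 mulmx0.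
  rewrite gE linearD /= cYr => /eqP.
  rewrite addrC addr_eq0 => /eqP /(congr1 (mulmx^~ (invmx (rsubmx Y)))) /=.
  by rewrite mulmxK // mulNmx.
by rewrite gE linearD /= cYl cE mulNmx.
Qed.

Lemma merge_endo_poly :
  exists2 b : {poly K}, merge_endo = horner_mx A1 b &
                        merge_defect = x *m horner_mx A1 b.
Proof.
have [b _ bE] := generates_poly merge_defect gx; exists b => //.
rewrite /merge_endo; have Ku := kry_full gx.
apply: (canLR (mulKmx Ku)); apply/row_matrixP => i.
rewrite row_mul !row_kry bE -!mulmxA; congr (_ *m _).
by rewrite horner_mx_exprC.
Qed.

(** A nonconstant common divisor q of f = chi_A1, g = chi_A2 and b would make
    (f / q) g annihilate M, although its degree is less than the size of M.  So
    g(A1) and b(A1) have no common kernel vector. *)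
Lemma merge_common_kernel (b : {poly K}) (v : 'rV[K]_d1) :
  merge_defect = x *m horner_mx A1 b ->
  v *m horner_mx A1 (char_poly A2) = 0 -> v *m horner_mx A1 b = 0 -> v = 0.
Proof.
move=> bE v2 vb; set f := char_poly A1; set g := char_poly A2 in v2 *.
pose q := gcdp (gcdp f g) b.
have qf : q %| f by rewrite (dvdp_trans (dvdp_gcdl _ _)) // dvdp_gcdl.
have qg : q %| g by rewrite (dvdp_trans (dvdp_gcdl _ _)) // dvdp_gcdr.
have qb : q %| b by rewrite dvdp_gcdr.
have f0 : f != 0 by rewrite -size_poly_eq0 size_char_poly.
have g0 : g != 0 by rewrite -size_poly_eq0 size_char_poly.
have q0 : q != 0 by apply: contraNneq f0 => q0; rewrite q0 dvd0p in qf.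
have [q1|q1] := eqVneq (size q) 1.
  have v0 : v *m horner_mx A1 q = 0.
    by apply: horner_mx_gcdp => //; apply: horner_mx_gcdp => //;
      rewrite Cayley_Hamilton mulmx0.
  have /(horner_mx_dvdp v0) : q %| 1 by rewrite dvdp1 q1.
  by rewrite rmorph1 mulmx1.
have sq : (1 < size q)%N by rewrite ltn_neqAle eq_sym q1 size_poly_gt0.
pose p := (f %/ q) * g.
have p0 : p != 0.
  by rewrite mulf_neq0 // dvdp_div_eq0.
suff Mp0 : horner_mx M p = 0.
  move/nonderogP: ndM => /(_ p) /(_ _ Mp0) pz; rewrite pz ?eqxx // in p0.
  rewrite -[X in (_ <= X)%N]/(d1 + d2)%N; apply: leq_trans (size_polyMleq _ _) _.
  rewrite size_divp // /f /g !size_char_poly; lia.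
have hl : injl *m horner_mx M p = 0.
  rewrite horner_l /p.
  have -> : f %/ q * g = (g %/ q) * f.
    by rewrite -{1}(divpK qg) mulrCA (divpK qf).
  by rewrite rmorphM /= Cayley_Hamilton mulr0 mul0mx.
have hy : y0 *m horner_mx M p = 0.
  rewrite /p mulrC rmorphM /= -mulmxE mulmxA merge_defectE -mulmxA horner_l.
  rewrite mulmxA bE -(mulmxA x) mulmxE -rmorphM /= -(divpK qb).
  have -> : b %/ q * q * (f %/ q) = (b %/ q) * f.
    by rewrite -mulrA [q * _]mulrC (divpK qf).
  by rewrite rmorphM /= Cayley_Hamilton mulr0 mulmx0 mul0mx.
have : col_mx injl Y *m horner_mx M p = 0.
  rewrite mul_col_mx hl; apply/eqP; rewrite col_mx_eq0 eqxx /=; apply/eqP.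
  apply/row_matrixP => i; rewrite row_mul row_kry row0 -mulmxA.
  have -> : M ^+ i *m horner_mx M p = horner_mx M p *m M ^+ i.
    by rewrite horner_mx_exprC.
  by rewrite mulmxA hy mul0mx.
rewrite -[Y]hsubmxK => /(congr1 (mulmx (invmx (block_mx 1%:M 0 (lsubmx Y) (rsubmx Y))))).
rewrite mulmx0 mulKmx //.
by rewrite unitmxE det_lblock det1 mul1r -unitmxE kry_quotient kry_full.
Qed.

(** Let (v0, y) be the row of the conclusion and x = v0 + v1.  If it is killed
    by p(M), the second block shows p = q g with g = chi_A2, and the first block
    shows that q(A1) kills v0 (g(A1) + E) + v1 E, with E = [merge_endo].  The two
    terms lie in the kernel and the image of T, so each is killed.  The second gives
    v1 q(A1) = 0 as E is injective on the image.  The first gives v0 q(A1) = 0: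
    the last nonzero vector among the v0 q(A1) E^j would be killed by both E and
    g(A1).  Hence x q(A1) = 0 and q = 0. *)
Lemma merge_generates N (G : 'M[K]_d1) : (d1 <= N)%N ->
  let T := merge_endo ^+ N in
  T *m T *m G *m (T *m T) = T *m T ->
  generates M (row_mx (x - x *m T *m G *m T) y).
Proof.
move=> le_dN /=; have [b] := merge_endo_poly.
move: merge_endo => E bE wE; set T := E ^+ N; move=> TGT.
have [S scomm sT] : exists2 S : 'M[K]_d1, S *m T = T *m S & T = S *m (T *m T).
  have [s sE] := fitting E le_dN; exists (horner_mx E s).
    exact: horner_mx_exprC.
  by rewrite {1}/T sE exprD mulmxE.
have cT c : T *m horner_mx A1 c = horner_mx A1 c *m T.
  by rewrite /T bE -rmorphXn /= horner_mxC.
have cb c : E *m horner_mx A1 c = horner_mx A1 c *m E.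
  by rewrite bE horner_mxC.
have TTinj h (v : 'M[K]_(h, d1)) : v *m T *m T = 0 -> v *m T = 0.
  have sTT : S *m (T *m T) = T *m T *m S.
    by rewrite mulmxA scomm -mulmxA scomm mulmxA.
  by move=> vTT; rewrite sT sTT !mulmxA vTT mul0mx.
set v0 := x - _; pose v1 := x - v0.
have v1E : v1 = x *m T *m G *m T by rewrite /v1 /v0 subKr.
have bTc : E *m T = T *m E by rewrite {2}bE cT -bE.
have TG : T *m G *m (T *m T) = T by rewrite {1}sT -!(mulmxA S) TGT -sT.
have v0T : v0 *m T = 0.
  apply/eqP; rewrite mulmxBl subr_eq0 -(mulmxA _ T T) -(mulmxA x T) -(mulmxA x).
  by rewrite TG.
have bT h (v : 'M[K]_(h, d1)) : v *m T *m E = 0 -> v *m T = 0.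
  move=> vTb; apply: TTinj.
  have N0 : (0 < N)%N by lia.
  by rewrite {2}/T -(prednK N0) exprS -mulmxE mulmxA vTb mul0mx.
refine (@inj_generates _ (d1' + d2'.+1)%N M (row_mx v0 y) _) => p sp zp0.
have y2 : y *m horner_mx A2 p = 0.
  have := congr1 (mulmx^~ projr) zp0; rewrite /= mul0mx -mulmxA horner_r mulmxA.
  have -> : row_mx v0 y *m projr = y by rewrite mul_row_col mulmx0 add0r mulmx1.
  by [].
have gp : char_poly A2 %| p.
  apply/eqP; apply: (generates_inj gy).
    have := ltn_modp p (char_poly A2); rewrite -size_poly_eq0 size_char_poly.
    by move=> /esym; rewrite ltnS.
  move: y2; rewrite {1}(divp_eq p (char_poly A2)) rmorphD rmorphM /=.
  by rewrite Cayley_Hamilton mulr0 add0r.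
have [q pE] := dvdpP _ _ gp.
have sq : (size q <= d1)%N.
  have [->|q0] := eqVneq q 0; first by rewrite size_poly0.
  have c0 : char_poly A2 != 0 by rewrite -size_poly_eq0 size_char_poly.
  have : (size p <= d1 + d2)%N by [].
  by rewrite pE size_mul // size_char_poly addnS leq_add2r.
suff q0 : q = 0 by rewrite pE q0 mul0r.
have key : (v0 *m horner_mx A1 (char_poly A2) + x *m E) *m horner_mx A1 q = 0.
  have zE : row_mx v0 y = v0 *m injl + y0.
    by rewrite mul_mx_row mulmx1 mulmx0 add_row_mx addr0 add0r.
  have MpE : horner_mx M p = horner_mx M (char_poly A2) *m horner_mx M q.
    by rewrite pE mulrC rmorphM.
  have l1 : (v0 *m injl + y0) *m horner_mx M (char_poly A2) =
            (v0 *m horner_mx A1 (char_poly A2) + merge_defect) *m injl.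
    by rewrite mulmxDl merge_defectE -mulmxA horner_l mulmxA -mulmxDl.
  move: zp0; rewrite zE MpE mulmxA l1 -mulmxA horner_l mulmxA.
  have -> (u : 'rV[K]_d1) : u *m injl = row_mx u 0.
    by rewrite mul_mx_row mulmx1 mulmx0.
  rewrite wE -bE => /(congr1 (@lsubmx _ _ d1 d2)).
  by rewrite row_mxKl linear0.
have xE : x = v0 + v1 by rewrite addrC /v1 subrK.
pose u0 := v0 *m horner_mx A1 q; pose u1 := v1 *m horner_mx A1 q.
have u0T : u0 *m T = 0 by rewrite -mulmxA -cT mulmxA v0T mul0mx.
have u1E : u1 = x *m T *m G *m horner_mx A1 q *m T.
  by rewrite /u1 v1E -!mulmxA cT.
have key2 : u0 *m (horner_mx A1 (char_poly A2) + E) + u1 *m E = 0.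
  have qb (u : 'rV[K]_d1) : u *m horner_mx A1 q *m E =
      u *m E *m horner_mx A1 q.
    by rewrite -!mulmxA cb.
  have qg : u0 *m horner_mx A1 (char_poly A2) =
      v0 *m horner_mx A1 (char_poly A2) *m horner_mx A1 q.
    by rewrite -!mulmxA horner_mxC.
  rewrite -[RHS]key [in RHS]xE mulmxDr qg !qb mulmxDl -addrA; congr (_ + _).
  by rewrite !mulmxDl.
have u1b0 : u1 *m E = 0.
  have : u1 *m E *m T = 0.
    have := congr1 (mulmx^~ T) key2; rewrite /= mul0mx mulmxDl.
    have -> : u0 *m (horner_mx A1 (char_poly A2) + E) *m T = 0.
      rewrite -mulmxA mulmxDl -cT.
      by rewrite bTc -mulmxDr mulmxA u0T mul0mx.
    by rewrite add0r.
  have -> : u1 *m E = x *m T *m G *m horner_mx A1 q *m E *m T.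
    by rewrite u1E -(mulmxA _ T E) -bTc mulmxA.
  exact: TTinj.
have u1z : u1 = 0.
  by rewrite u1E; apply: bT; rewrite -u1E.
have u0g : u0 *m (horner_mx A1 (char_poly A2) + E) = 0.
  by move: key2; rewrite u1b0 addr0.
have u0b j : u0 *m E ^+ j = 0 -> u0 = 0.
  elim: j => [|j IH]; first by rewrite expr0 mulmx1.
  rewrite exprSr -mulmxE mulmxA => ubj; apply: IH.
  apply: (merge_common_kernel wE).
    have gE : horner_mx A1 (char_poly A2) *m E ^+ j =
              E ^+ j *m horner_mx A1 (char_poly A2).
      by rewrite bE -rmorphXn /= horner_mxC.
    have EE : E *m E ^+ j = E ^+ j *m E by rewrite !mulmxE -exprS -exprSr.
    have := congr1 (mulmx^~ (E ^+ j)) u0g.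
    by rewrite /= mul0mx -mulmxA mulmxDl mulmxDr gE EE !mulmxA ubj addr0.
  by rewrite -bE.
have u0z : u0 = 0 by apply: (u0b N).
apply: (generates_inj gx sq).
by rewrite xE mulmxDl -/u0 -/u1 u0z u1z addr0.
Qed.
End BlockTriangular.

(** * Block triangular form along a Krylov space *)

Section Splitting.
Variable K : fieldType.

Lemma generates_stable d h (A : 'M[K]_d) (U : 'M[K]_(h, d)) :
  generates A U -> forall m (V : 'M[K]_(m, d)),
  (U <= V)%MS -> (V *m A <= V)%MS -> (1%:M <= V)%MS.
Proof.
move=> gU m V UV AV; rewrite -(genmxE V); apply: gU; rewrite ?genmxE //.
by rewrite (eqmxMr A (genmxE V)).
Qed.

Lemma generates_conj d (A W Wi : 'M[K]_d) h (z : 'M[K]_(h, d)) :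
  W *m Wi = 1%:M -> generates (W *m A *m Wi) z -> generates A (z *m W).
Proof.
move=> WWi gz V zV AV; have WiW := mulmx1C WWi.
have : (1%:M <= V *m Wi)%MS.
  apply: gz; first by have := submxMr Wi zV; rewrite -mulmxA WWi mulmx1.
  by rewrite !mulmxA -(mulmxA V) WiW mulmx1 submxMr.
move/(submxMr W); rewrite -mulmxA WiW mulmx1 mul1mx; apply: submx_trans.
by rewrite -WiW submxMl.
Qed.

Lemma exprmx_conj d (A W Wi : 'M[K]_d) i : Wi *m W = 1%:M ->
  (W *m A *m Wi) ^+ i = W *m A ^+ i *m Wi.
Proof.
move=> WiW; elim: i => [|i IH]; first by rewrite !expr0 mulmx1 (mulmx1C WiW).
by rewrite !exprS IH -!mulmxE !mulmxA -(mulmxA _ Wi W) WiW mulmx1.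
Qed.

Lemma nonderog_conj d (A W Wi : 'M[K]_d) :
  W *m Wi = 1%:M -> nonderog A -> nonderog (W *m A *m Wi).
Proof.
move=> WWi nd c cA'; have WiW := mulmx1C WWi; apply: nd.
have /(congr1 (fun X => Wi *m X *m W)) := cA'.
rewrite mulmx0 mul0mx mulmx_sumr mulmx_suml => e; rewrite -[RHS]e.
apply: eq_bigr => i _; rewrite exprmx_conj // -scalemxAr -scalemxAl.
by rewrite !mulmxA WiW mul1mx -mulmxA WiW mulmx1.
Qed.

(** [S] contains the first 2^l Krylov iterates of [U] and nothing outside the
    submodule generated by [U].  Equality with the span of those iterates is not
    demanded, so that [S] may be replaced by any matrix with the same row
    space. *)
Definition krylov_upto d h w (A : 'M[K]_d) (U : 'M[K]_(h, d)) l
    (S : 'M[K]_(w, d)) : Prop :=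
  (forall i, (i < 2 ^ l)%N -> (U *m A ^+ i <= S)%MS) /\
  (forall V : 'M[K]_d, (U <= V)%MS -> (V *m A <= V)%MS -> (S <= V)%MS).

Lemma krylov_upto0 d h (A : 'M[K]_d) (U : 'M[K]_(h, d)) : krylov_upto A U 0 U.
Proof.
by split=> // i; rewrite expn0 ltnS leqn0 => /eqP ->; rewrite expr0 mulmx1.
Qed.

Lemma krylov_uptoS d h w w' (A : 'M[K]_d) (U : 'M[K]_(h, d)) l
    (S : 'M[K]_(w, d)) (S' : 'M[K]_(w', d)) :
  krylov_upto A U l S -> (S' :=: col_mx S (S *m A ^+ (2 ^ l)))%MS ->
  krylov_upto A U l.+1 S'.
Proof.
move=> [US SV] S'E; split=> [i lt_i|V UV AV].
  rewrite S'E -addsmxE; have [lt_il|le_li] := ltnP i (2 ^ l).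
    by apply: submx_trans (US _ lt_il) (addsmxSl _ _).
  apply: submx_trans (addsmxSr _ _); rewrite -(subnK le_li) exprD -mulmxE mulmxA.
  by apply/submxMr/US; move: lt_i; rewrite expnS; lia.
have VAi i : (V *m A ^+ i <= V)%MS.
  elim: i => [|i IH]; first by rewrite expr0 mulmx1.
  by rewrite exprSr -mulmxE mulmxA (submx_trans _ AV) // submxMr.
rewrite S'E col_mx_sub SV //=.
by apply: submx_trans (VAi (2 ^ l)%N); rewrite submxMr ?SV.
Qed.

(** Once 2^l >= d the iterates span a stable space. *)
Lemma krylov_upto_stable d h w (A : 'M[K]_d) (U : 'M[K]_(h, d)) l
    (S : 'M[K]_(w, d)) : (d <= 2 ^ l)%N ->
  krylov_upto A U l S -> (U <= S)%MS /\ (S *m A <= S)%MS.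
Proof.
move=> le_dl [US SV]; split.
  by have := US 0 (expn_gt0 2 l); rewrite expr0 mulmx1.
pose V := (\sum_(i < d.+1) <<U *m A ^+ i>>)%MS.
have UV i : (U *m A ^+ i <= V)%MS.
  apply: expr_mx_stable => j lt_jd.
  by rewrite (sumsmx_sup (Ordinal (leqW lt_jd))) // genmxE.
have AV : (V *m A <= V)%MS.
  rewrite sumsmxMr; apply/sumsmx_subP => i _.
  by rewrite (eqmxMr A (genmxE _)) -mulmxA mulmxE -exprSr.
have VS : (V <= S)%MS.
  apply/sumsmx_subP => i _; rewrite genmxE; apply: expr_mx_stable => j lt_jd.
  by apply: US; apply: leq_trans le_dl.
have SVV : (S <= V)%MS by apply: SV => //; have := UV 0%N; rewrite expr0 mulmx1.
exact: submx_trans (submxMr A SVV) (submx_trans AV VS).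
Qed.

Section Along.
Variables (d1 d2 h l : nat) (A W Wi : 'M[K]_(d1 + d2)).
Variables (U1 U2 : 'M[K]_(h, d1 + d2)).
Hypothesis WWi : W *m Wi = 1%:M.
Hypothesis ld : (d1 + d2 <= 2 ^ l)%N.
Hypothesis W1 : krylov_upto A U1 l (usubmx W).
Let A' := W *m A *m Wi.
Let WiW : Wi *m W = 1%:M := mulmx1C WWi.
Let top := row_mx 1%:M 0 : 'M[K]_(d1, d1 + d2).

Let topW : top *m W = usubmx W.
Proof. by rewrite -{1}[W]vsubmxK mul_row_col mul1mx mul0mx addr0. Qed.

Let topM m (C : 'M[K]_(m, d1)) : C *m top = row_mx C 0.
Proof. by rewrite mul_mx_row mulmx1 mulmx0. Qed.

Lemma split_block :
  A' = block_mx (ulsubmx A') 0 (dlsubmx A') (drsubmx A').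
Proof.
have [_ /submxP[D DE]] := krylov_upto_stable ld W1.
suff /(congr1 rsubmx) : usubmx A' = row_mx D 0.
  by rewrite row_mxKr -[rsubmx _]/(ursubmx A') => <-; rewrite submxK.
have tA (B : 'M[K]_(d1 + d2)) : usubmx B = top *m B.
  by rewrite -{2}[B]vsubmxK mul_row_col mul1mx mul0mx addr0.
by rewrite tA !mulmxA topW DE -topW -!mulmxA WWi mulmx1 topM.
Qed.

Let U1E : exists C : 'M[K]_(h, d1), U1 = row_mx C 0 *m W.
Proof.
have [/submxP[C CE] _] := krylov_upto_stable ld W1.
by exists C; rewrite -topM -mulmxA topW.
Qed.

Let AW m (V : 'M[K]_(m, d1 + d2)) : V *m W *m A = V *m A' *m W.
Proof. by rewrite /A' !mulmxA -[in RHS](mulmxA _ Wi) WiW mulmx1. Qed.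

(** A space stable under the first diagonal block lifts to an M-stable subspace
    of the span of the first rows of [W]. *)
Lemma split_generates_l : generates (ulsubmx A') (lsubmx (U1 *m Wi)).
Proof.
have [C CE] := U1E => V; rewrite CE -mulmxA WWi mulmx1 row_mxKl => CV AV.
have [_ Wmin] := W1.
have : (top *m W <= <<row_mx V 0 *m W>>)%MS.
  rewrite topW; apply: Wmin; rewrite genmxE.
    by rewrite CE -!topM submxMr // submxMr.
  rewrite (eqmxMr A (genmxE _)) AW split_block mul_row_block !mul0mx mulmx0 !addr0.
  by rewrite -!topM submxMr // submxMr.
rewrite genmxE => /(submxMr (Wi *m (col_mx 1%:M 0))).
rewrite !mulmxA -!(mulmxA _ W Wi) WWi !mulmx1 !mul_row_col.
by rewrite !mulmx1 !mul0mx !addr0.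
Qed.

(** A space stable under the second diagonal block has an M-stable preimage, and
    the image of [U1] in the quotient is 0. *)
Lemma split_generates_r : generates A (col_mx U1 U2) ->
  generates (drsubmx A') (rsubmx (U2 *m Wi)).
Proof.
move=> gU V UV AV; have [C CE] := U1E.
pose V' := col_mx top (row_mx 0 V).
have rV' m (v : 'M[K]_(m, d1 + d2)) : (rsubmx v <= V)%MS -> (v <= V')%MS.
  case/submxP => D vD; apply/submxP; exists (row_mx (lsubmx v) D).
  rewrite mul_row_col topM mul_mx_row mulmx0 add_row_mx addr0 add0r -vD.
  by rewrite hsubmxK.
have : (1%:M <= V' *m W)%MS.
  apply: (generates_stable gU).
    rewrite col_mx_sub {1}CE submxMr ?rV' ?row_mxKr ?sub0mx //=.
    rewrite -[U2]mulmx1 -WiW mulmxA submxMr // rV' //.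
  rewrite AW submxMr // split_block /V' mul_col_mx col_mx_sub.
  rewrite /top !mul_row_block !rV' ?row_mxKr //.
    by rewrite mul0mx add0r.
  by rewrite mulmx0 mul0mx addr0 sub0mx.
have VE : V' *m col_mx 0 1%:M = col_mx 0 V.
  by rewrite mul_col_mx !mul_row_col !mulmx1 !mulmx0 !add0r.
move/(submxMr (Wi *m (col_mx 0 1%:M))); rewrite mul1mx !mulmxA.
rewrite -(mulmxA _ W Wi) WWi mulmx1 VE => Vb.
have : (W *m (Wi *m col_mx 0 1%:M) <= V)%MS.
  apply: submx_trans (submxMl _ _) (submx_trans Vb _).
  by rewrite col_mx_sub sub0mx /=.
by rewrite mulmxA WWi mul1mx col_mx_sub => /andP[].
Qed.
End Along.
End Splitting.

(** * The comatrix modulo the characteristic polynomial *)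

Section Comatrix.
Variable K : fieldType.

Definition mxcong m n (c : {poly K}) (A B : 'M[{poly K}]_(m, n)) : Prop :=
  forall i j, c %| (A - B) i j.

Lemma dvdp_sum (I : Type) (r : seq I) (P : pred I) c (F : I -> {poly K}) :
  (forall i, P i -> c %| F i) -> c %| \sum_(i <- r | P i) F i.
Proof.
move=> cF; elim/big_rec: _ => [|i x Pi]; first exact: dvdp0.
by apply: dvdp_add; apply: cF.
Qed.

Lemma mxcong_trans m n c (A B C : 'M[{poly K}]_(m, n)) :
  mxcong c A B -> mxcong c B C -> mxcong c A C.
Proof.
move=> AB BC i j; have -> : (A - C) i j = (A - B) i j + (B - C) i j.
  by rewrite !mxE addrA subrK.
exact: dvdp_add.
Qed.

Lemma mxcong_mul m n p q c (A B : 'M[{poly K}]_(m, n)) (L : 'M[{poly K}]_(p, m))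
    (R : 'M[{poly K}]_(n, q)) : mxcong c A B -> mxcong c (L *m A *m R) (L *m B *m R).
Proof.
move=> AB i j; rewrite -mulmxBl -mulmxBr mxE; apply: dvdp_sum => k _.
rewrite mxE dvdp_mulr //; apply: dvdp_sum => k' _.
by rewrite dvdp_mull.
Qed.

(** Multiplication of the comatrix by [M] and by X agree modulo chi, because
    (X - M) Com(X - M) = chi. *)
Lemma comatrix_exp_cong n (M : 'M[K]_n) i :
  mxcong (char_poly M) (map_mx polyC (M ^+ i) *m \adj (char_poly_mx M))
         ('X^i *: \adj (char_poly_mx M)).
Proof.
elim: i => [|i IH].
  by move=> i j; rewrite !expr0 map_mx1 mul1mx scale1r subrr mxE dvdp0.
have XM : map_mx polyC M = 'X%:M - char_poly_mx M by rewrite subKr.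
rewrite exprS -mulmxE map_mxM -mulmxA.
apply: (mxcong_trans (B := map_mx polyC M *m ('X^i *: \adj (char_poly_mx M)))).
  by have := mxcong_mul (map_mx polyC M) 1%:M IH; rewrite !mulmx1.
rewrite XM mulmxBl mul_scalar_mx -scalemxAr mul_mx_adj => j k.
rewrite scalerA -exprS addrAC subrr sub0r !mxE dvdpNr.
by rewrite dvdp_mull // -mulr_natr dvdp_mulr.
Qed.

(** If p(M) = 0 then chi divides p times each entry of the comatrix, hence p. *)
Lemma surjective_comatrix_nonderog n (M : 'M[K]_n) (c : 'I_n -> 'I_n -> K) :
  \sum_i \sum_j c i j *: \adj (char_poly_mx M) i j = 1 -> nonderog M.
Proof.
case: n => [|n] in M c *; first by rewrite big_ord0 => /esym/eqP; rewrite oner_eq0.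
move=> c1; apply/nonderogP => p sp Mp0; apply/eqP; apply: contraTT isT => p0.
suff : char_poly M %| p.
  by move=> /(dvdp_leq p0); rewrite size_char_poly ltnNge sp.
have pdvd i j : char_poly M %| p * \adj (char_poly_mx M) i j.
  have : mxcong (char_poly M) 0 (p *: \adj (char_poly_mx M)).
    have e0 : map_mx polyC (horner_mx M p) *m \adj (char_poly_mx M) = 0.
      by rewrite Mp0 map_mx0 mul0mx.
    rewrite -[X in mxcong _ X]e0 -[X in X *: _](coefK p) poly_def scaler_suml.
    rewrite (horner_mx_sum M (leqnn (size p))) raddf_sum /= mulmx_suml.
    move=> i' j'; rewrite -sumrB summxE.
    apply: dvdp_sum => k _.
    rewrite map_mxZ /= -scalemxAl -mul_polyC -scalerA -scalerBr mxE.
    exact/dvdp_mull/comatrix_exp_cong.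
  by move=> /(_ i j); rewrite !mxE sub0r dvdpNr.
rewrite -[p]mulr1 -c1 mulr_sumr; apply: dvdp_sum => i _.
rewrite mulr_sumr; apply: dvdp_sum => j _.
by rewrite -scalerAr -mul_polyC dvdp_mull // pdvd.
Qed.

Definition hankel n (p : {poly K}) : 'M[K]_n := \matrix_(i, j) p`_(i + j + 1).

(** The matrix is triangular with unit diagonal once its columns are reversed. *)
Lemma hankel_unit n (p : {poly K}) :
  p \is monic -> size p = n.+1 -> hankel n p \in unitmx.
Proof.
move=> pm sp; rewrite -row_free_unit; apply: inj_row_free => v vH.
have pn : p`_n = 1 by have := monicP pm; rewrite lead_coefE sp.
suff v0 k : forall i : 'I_n, (i < k)%N -> v 0 i = 0.
  by apply/rowP => i; rewrite (v0 n) // mxE.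
elim: k => // k IH i; rewrite ltnS leq_eqVlt => /orP[/eqP ik|/IH //].
have jn : (n - i.+1 < n)%N by have := ltn_ord i; lia.
have /matrixP/(_ 0 (Ordinal jn)) := vH; rewrite !mxE (bigD1 i) //= mxE /=.
have -> : (i + (n - i.+1) + 1)%N = n by have := ltn_ord i; lia.
rewrite pn mulr1 big1 ?addr0 // => i' ne; rewrite mxE /=.
have [lt|gt|e] := ltngtP i' i; last by case/negP: ne; apply/eqP/val_inj.
  by rewrite IH ?mul0r // -ik.
by rewrite [p`__]nth_default ?mulr0 // sp; have := ltn_ord i; lia.
Qed.

(** The columns of V H are the Horner quotients of p. *)
Lemma powers_hankel n (p : {poly K}) i : size p = n.+1 ->
  (powers_row K n *m map_mx polyC (hankel n p)) 0 i = drop_poly i.+1 p.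
Proof.
move=> sp; rewrite mxE; under eq_bigr do rewrite !mxE.
apply/polyP => k; rewrite coef_sum coef_drop_poly.
under eq_bigr do rewrite mulrC coefCM coefXn mulr_natr.
have [kn|nk] := ltnP k n; last first.
  rewrite nth_default ?sp ?big1 //; last by lia.
  by move=> j _; case: eqP => // kj; move: nk; rewrite kj leqNgt ltn_ord.
rewrite (bigD1 (Ordinal kn)) //= eqxx big1 ?addr0 => [|j]; first by rewrite mulr1n addn1 addnS.
by rewrite -val_eqE /= eq_sym => /negPf ->; rewrite mulr0n.
Qed.

Lemma drop_polyS (p : {poly K}) i :
  'X * drop_poly i.+1 p = drop_poly i p - (p`_i)%:P.
Proof.
apply/polyP => k; rewrite mulrC coefMX coefB coefC !coef_drop_poly.
by case: k => [|k]; rewrite ?subrr //= subr0 addnS addSn.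
Qed.

Lemma cayley_sum n (M : 'M[K]_n) h (U : 'M[K]_(h, n)) :
  \sum_(i < n.+1) (char_poly M)`_i *: (U *m M ^+ i) = 0.
Proof.
case: n => [|n] in M U *; first by rewrite [LHS]thinmx0 [RHS]thinmx0.
by rewrite -mul_horner_mx ?size_char_poly // Cayley_Hamilton mulmx0.
Qed.

(** The row b = V H R is the sum of the Horner quotients of chi times r M^i, so
    b (X - M) telescopes to chi r by Cayley-Hamilton, that is
    b = r Com(X - M). *)
Lemma comatrix_factorization_kry n (M : 'M[K]_n) (r : 'rV[K]_n) :
  kry n M r \in unitmx ->
  comatrix_factorization M 1 (invmx (kry n M r))
    ((hankel n (char_poly M) *m kry n M r)^T).
Proof.
move=> Ru; set R := kry n M r; set chi := char_poly M; pose adjM := \adj (char_poly_mx M).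
have sp : size chi = n.+1 by apply: size_char_poly.
have chi0 : chi != 0 by rewrite -size_poly_eq0 sp.
have pn : chi`_n = 1.
  by have /monicP := char_poly_monic M; rewrite lead_coefE sp.
pose rho i : 'rV[{poly K}]_n := map_mx polyC (r *m M ^+ i).
pose V := powers_row K n.
pose b : 'rV[{poly K}]_n := V *m map_mx polyC (hankel n chi *m R).
have rhoX i : rho i *m char_poly_mx M = 'X *: rho i - rho i.+1.
  by rewrite mulmxBr mul_mx_scalar -map_mxM -mulmxA mulmxE -exprSr.
have bE : b = \sum_(i < n) drop_poly i.+1 chi *: rho i.
  rewrite /b map_mxM mulmxA mulmx_sum_row; apply: eq_bigr => i _.
  by rewrite powers_hankel // -map_row row_kry.
have CH : \sum_(i < n.+1) (chi`_i)%:P *: rho i = 0.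
  have /(congr1 (map_mx polyC)) := cayley_sum M r.
  rewrite map_mx0 raddf_sum /= => e; rewrite -[RHS]e.
  by apply: eq_bigr => i _; rewrite map_mxZ.
have bX : b *m char_poly_mx M = chi *: rho 0%N.
  rewrite bE mulmx_suml.
  have -> : chi *: rho 0%N =
      \sum_(0 <= i < n) (drop_poly i chi *: rho i - drop_poly i.+1 chi *: rho i.+1)
      + drop_poly n chi *: rho n.
    have := telescope_sumr (fun i => - (drop_poly i chi *: rho i)) (leq0n n).
    under eq_bigr do rewrite opprK addrC.
    by rewrite opprK addrC => ->; rewrite subrK drop_poly0l.
  have -> : drop_poly n chi = (chi`_n)%:P.
    apply/polyP => k; rewrite coef_drop_poly coefC.
    by case: k => [|k]; [rewrite add0n | rewrite nth_default // sp; lia].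
  have -> : (chi`_n)%:P *: rho n = - \sum_(i < n) (chi`_i)%:P *: rho i.
    apply/eqP; rewrite -addr_eq0 addrC; apply/eqP.
    by rewrite -[RHS]CH big_ord_recr.
  rewrite big_mkord -sumrN -big_split; apply: eq_bigr => i _ /=.
  rewrite -scalemxAl rhoX scalerBr scalerA mulrC drop_polyS scalerBl.
  by rewrite addrAC.
have badj : b = rho 0%N *m adjM.
  have : chi *: b = chi *: (rho 0%N *m adjM).
    by rewrite [RHS]scalemxAl -bX -[RHS]mulmxA mul_mx_adj mul_mx_scalar.
  by move/matrixP => e; apply/matrixP => i j; have := e i j; rewrite !mxE;
    apply: mulfI.
have RadjV : mxcong chi (map_mx polyC R *m adjM) (V^T *m b).
  move=> i j; have := mxcong_mul (map_mx polyC r) 1%:M (comatrix_exp_cong M i).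
  rewrite !mulmx1 mulmxA -map_mxM => /(_ 0 j).
  rewrite -scalemxAr -/adjM.
  have -> : map_mx polyC r *m adjM = b by rewrite badj /rho expr0 mulmx1.
  have subE m (A B : 'M[{poly K}]_(m, n)) k l : (A - B) k l = A k l - B k l.
    by rewrite !mxE.
  congr (_ %| _); rewrite !subE; congr (_ - _).
    by rewrite !mxE; apply: eq_bigr => k _; rewrite !mxE.
  by rewrite mxE [RHS]mxE big_ord1 !mxE.
move=> i j; have := mxcong_mul (map_mx polyC (invmx R)) 1%:M RadjV.
rewrite !mulmx1 mulmxA -map_mxM mulVmx // map_mx1 mul1mx => /(_ i j).
by rewrite scale1r map_trmx trmxK -!mulmxA.
Qed.

Lemma char_poly_kry n (M : 'M[K]_n) (r : 'rV[K]_n) :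
  kry n M r \in unitmx ->
  forall i : 'I_n, (r *m M ^+ n *m invmx (kry n M r)) 0 i = - (char_poly M)`_i.
Proof.
move=> Ru i; have := cayley_sum M r; rewrite big_ord_recr /=.
have := char_poly_monic M; rewrite monicE lead_coefE size_char_poly /= => /eqP ->.
rewrite scale1r addrC => /eqP; rewrite addr_eq0 => /eqP ->.
have -> : \sum_(j < n) (char_poly M)`_j *: (r *m M ^+ j) =
    (\row_j (char_poly M)`_j) *m kry n M r.
  by rewrite mulmx_sum_row; apply: eq_bigr => j _; rewrite row_kry mxE.
by rewrite mulNmx mulmxK // !mxE.
Qed.
End Comatrix.

(** * The differential of the characteristic polynomial *)

Section Differential.
Variables (K : fieldType) (v : K -> int).
Hypothesis hv : discrete_valuation v.

(** The perturbation touches one row only: expand the determinant along it. *)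
Lemma char_poly_delta n (M : 'M[K]_n) (t : K) i j :
  char_poly (M + t *: delta_mx i j) =
  char_poly M - t *: cofactor (char_poly_mx M) i j.
Proof.
set M' := M + _; rewrite /char_poly !(expand_det_row _ i).
have row'E : row' i (char_poly_mx M') = row' i (char_poly_mx M).
  apply/matrixP => k l; have ne : (lift i k == i) = false.
    by rewrite eq_sym (negPf (neq_lift i k)).
  by rewrite !mxE ne mulr0 addr0.
have cofE k : cofactor (char_poly_mx M') i k = cofactor (char_poly_mx M) i k.
  rewrite /cofactor; congr (_ * \det _); apply/matrixP => a b.
  by have /matrixP/(_ a (lift k b)) := row'E; rewrite !mxE.
under eq_bigr do rewrite cofE.
have -> : t *: cofactor (char_poly_mx M) i j =
    \sum_k (t * (k == j)%:R)%:P * cofactor (char_poly_mx M) i k.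
  rewrite (bigD1 j) //= eqxx mulr1 mul_polyC big1 ?addr0 // => k /negPf ->.
  by rewrite mulr0 polyC0 mul0r.
rewrite -sumrB; apply: eq_bigr => k _; rewrite -mulrBl; congr (_ * _).
by rewrite !mxE eqxx /= polyCD opprD addrA.
Qed.

Lemma valuation_expr : exists2 pi, pi != 0 & forall k : nat, v (pi ^+ k) = k%:Z.
Proof.
have [vM _ [pi pi0 vpi]] := hv; exists pi => // k; elim: k => [|k IH].
  by have := vM 1 1 (oner_neq0 _) (oner_neq0 _); rewrite mulr1 expr0; lia.
by rewrite exprS vM ?expf_neq0 // vpi IH; lia.
Qed.

(** Along t E_ij the remainder in the definition of the differential is linear in
    t, so it is at once of valuation v(t) + constant and beyond v(t) + N for every
    N: it vanishes. *)
Lemma differential_delta n (M : 'M[K]_n) (L : {linear 'M[K]_n -> {poly K}}) i j :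
  is_differential v (@char_poly K n) M L ->
  L (delta_mx i j) = - cofactor (char_poly_mx M) i j.
Proof.
move=> dL; have [vM _ _] := hv; have [pi pi0 vpi] := valuation_expr.
set C := cofactor _ _ _.
apply/eqP; rewrite -subr_eq0 -oppr_eq0 opprB; apply/eqP/polyP => l; rewrite coef0.
set e := _`_l; apply/eqP; apply: contraTT isT => e0.
(* with N = v e + 1 the bound gives e a valuation of at least v e + 1 *)
have [d dP] := dL (v e + 1); pose r := `|d|%N.
have pir0 : pi ^+ r != 0 by rewrite expf_neq0.
have le_dr : (d <= r%:Z)%R by lia.
have Hr a b : vge v ((pi ^+ r *: delta_mx i j : 'M[K]_n) a b) r%:Z.
  rewrite !mxE; case: (_ && _); rewrite ?mulr1 ?mulr0; last by left.
  by right; rewrite vpi.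
have := dP (pi ^+ r *: delta_mx i j) r%:Z le_dr Hr l.
have -> : char_poly (M + pi ^+ r *: delta_mx i j) - char_poly M
    - L (pi ^+ r *: delta_mx i j) = pi ^+ r *: (- C - L (delta_mx i j)).
  rewrite char_poly_delta -/C scalerBr scalerN.
  congr (_ - _); last by rewrite linearZ.
  by rewrite addrC addKr.
rewrite coefZ -/e.
case=> [/eqP|]; first by rewrite mulf_eq0 (negPf pir0) (negPf e0).
by rewrite vM // vpi; lia.
Qed.

Lemma surjective_dchi_nonderog n (M : 'M[K]_n) :
  surjective_dchi v M -> nonderog M.
Proof.
case: n => [|n] in M *; first by move=> _ c _; apply: thinmx0.
case=> L [dL Ls]; have [|H LH] := Ls 1; first by rewrite size_poly1.
apply: (surjective_comatrix_nonderog (c := fun i j => - H j i)).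
rewrite -[RHS]LH [in RHS](matrix_sum_delta H) linear_sum exchange_big /=.
apply: eq_bigr => i _; rewrite linear_sum; apply: eq_bigr => j _.
by rewrite linearZ /= (differential_delta _ _ dL) scalerN scaleNr mxE.
Qed.
End Differential.

(** * Programs producing computation trees *)

Section Programs.
Variable K : fieldType.

(** Unlike in [act], continuations receive the address of the new value, so that
    programs compose without knowing the length of the memory. *)
Inductive comp (X : Type) : Type :=
  | Ret of X
  | Emit of ring_op K & (nat -> comp X)
  | Quot of nat & nat & (nat -> comp X)
  | IfZero of nat & comp X & comp X.

Fixpoint bind X Y (c : comp X) (f : X -> comp Y) : comp Y :=
  match c with
  | Ret x => f x
  | Emit o k => Emit o (fun a => bind (k a) f)
  | Quot i j k => Quot i j (fun a => bind (k a) f)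
  | IfZero i c0 c1 => IfZero i (bind c0 f) (bind c1 f)
  end.

Fixpoint compile X (c : comp X) (n : nat) : act K X :=
  match c with
  | Ret x => Halt x
  | Emit o k => Op o (compile (k n) n.+1)
  | Quot i j k => Div i j (compile (k n) n.+1)
  | IfZero i c0 c1 => Test0 i (compile c0 n) (compile c1 n)
  end.

(** Hoare triple.  The memory only grows, so what is known about addresses
    survives ([prefix_onth]). *)
Definition runs X (m : seq K) (c : comp X) (b : nat) (Q : seq K -> X -> Prop) :=
  exists m' x n, [/\ act_run (compile c (size m)) m = Some (m', x, n),
                     (n <= b)%N, prefix m m' & Q m' x].

Lemma act_run_bind X Y (c : comp X) (f : X -> comp Y) m m' x n :
  act_run (compile c (size m)) m = Some (m', x, n) ->
  act_run (compile (bind c f) (size m)) m =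
  tick n (act_run (compile (f x) (size m')) m').
Proof.
have tick_inv T b (r : option (T * nat)) y k :
    tick b r = Some (y, k) -> exists2 k', r = Some (y, k') & k = (b + k')%N.
  by case: r => [[y' k']|] //= [<- <-]; exists k'.
have tickD T b b' (r : option (T * nat)) : tick b (tick b' r) = tick (b + b') r.
  by case: r => [[y k]|] //=; rewrite addnA.
elim: c m n => [x0|o k IH|i j k IH|i c0 IH0 c1 IH1] m n /=.
- by case=> <- <- <-; case: act_run => [[]|].
- move=> h; have [n' runk ->] := tick_inv _ _ _ _ _ h; rewrite -tickD.
  by have := IH (size m) (rcons m (ring_op_eval m o)) n'; rewrite size_rcons => ->.
- case: ifP => // _ h; have [n' runk ->] := tick_inv _ _ _ _ _ h; rewrite -tickD.
  by have := IH (size m) (rcons m (m`_i / m`_j)) n'; rewrite size_rcons => ->.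
- by case: ifP => _ h; have [n' runk ->] := tick_inv _ _ _ _ _ h; rewrite -tickD; congr (tick _ _);
    [apply: IH0 | apply: IH1].
Qed.

Lemma runs_ret X m (x : X) b (Q : seq K -> X -> Prop) : Q m x -> runs m (Ret x) b Q.
Proof. by move=> Qx; exists m, x, 0%N; rewrite prefix_refl. Qed.

Lemma runs_bind X Y m (c : comp X) (f : X -> comp Y) b1 b P Q :
  runs m c b1 P -> (b1 <= b)%N ->
  (forall m' x, prefix m m' -> P m' x -> runs m' (f x) (b - b1) Q) ->
  runs m (bind c f) b Q.
Proof.
move=> [m1 [x [n1 [run1 le1 pre1 Px]]]] le_b /(_ _ _ pre1 Px).
move=> [m2 [y [n2 [run2 le2 pre2 Qy]]]]; exists m2, y, (n1 + n2)%N.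
split=> //; [by rewrite (act_run_bind f run1) run2 | by lia |].
exact: prefix_trans pre1 pre2.
Qed.

Lemma runs_weaken X m (c : comp X) b b' (P Q : seq K -> X -> Prop) :
  runs m c b P -> (b <= b')%N ->
  (forall m' x, prefix m m' -> P m' x -> Q m' x) -> runs m c b' Q.
Proof.
move=> [m1 [x [n [r le p Px]]]] bb PQ; exists m1, x, n.
by split=> //; [exact: leq_trans bb | exact: PQ].
Qed.

Lemma runs_leq X m (c : comp X) b b' Q :
  (b <= b')%N -> runs m c b Q -> runs m c b' Q.
Proof. by move=> bb r; apply: runs_weaken r bb _. Qed.

(** Sequencing when costs are counted in multiples of a unit [u]: with numerals
    for [n] and [k] the arithmetic is by computation. *)
Lemma runs_bind_units X Y m (c : comp X) (f : X -> comp Y) k n u r P Q :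
  runs m c (k * u) P -> (k <= n)%N ->
  (forall m' x, prefix m m' -> P m' x -> runs m' (f x) ((n - k) * u + r) Q) ->
  runs m (bind c f) (n * u + r) Q.
Proof.
move=> cP kn fQ; have ku : (k * u <= n * u)%N by rewrite leq_mul2r kn orbT.
apply: (runs_bind cP) => [|m' x pre Px]; first by lia.
by rewrite -addnBAC // -mulnBl; apply: fQ.
Qed.

(** Sequencing when the first program spends a whole summand of the budget. *)
Lemma runs_bind_rest X Y m (c : comp X) (f : X -> comp Y) b n u r P Q :
  runs m c b P ->
  (forall m' x, prefix m m' -> P m' x -> runs m' (f x) (n * u + r) Q) ->
  runs m (bind c f) (n * u + (b + r)) Q.
Proof.
move=> cP fQ; apply: (runs_bind cP) => [|m' x pre Px]; first by lia.
by rewrite addnCA addKn; apply: fQ.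
Qed.

Lemma prefix_onth (m m' : seq K) i x :
  prefix m m' -> onth m i = Some x -> onth m' i = Some x.
Proof.
case/prefixP => s -> mi; rewrite onth_cat; case: ifP => // im.
by move: mi; rewrite onth_default // leqNgt im.
Qed.

Lemma onth_last (m : seq K) x : onth (rcons m x) (size m) = Some x.
Proof. by rewrite -cats1 onth_cat ltnn subnn. Qed.

Lemma onth_val (m : seq K) i x : onth m i = Some x -> m`_i = x.
Proof. exact: onth_nth. Qed.

Lemma runs_emit X m o (k : nat -> comp X) b x Q :
  ring_op_eval m o = x ->
  (0 < b)%N -> 
  (forall m', prefix m m' -> onth m' (size m) = Some x ->
    runs m' (k (size m)) b.-1 Q) ->
  runs m (Emit o k) b Q.
Proof.
move=> ox b0 /(_ (rcons m x) (prefix_rcons _ _) (onth_last _ _)).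
move=> [m' [y [n [r le p Qy]]]]; exists m', y, (ring_op_cost o + n)%N; split=> //.
- by move: r; rewrite /= size_rcons ox => ->.
- by case: (o) => *; rewrite /=; lia.
- exact: prefix_trans (prefix_rcons _ _) p.
Qed.

Lemma runs_cst m x b :
  runs m (Emit (Cst x) (@Ret _)) b (fun m' a => onth m' a = Some x).
Proof.
exists (rcons m x), (size m), 0%N; split=> //; last exact: onth_last.
exact: prefix_rcons.
Qed.

Lemma runs_quot m i j x y : onth m i = Some x -> onth m j = Some y -> y != 0 ->
  runs m (Quot i j (@Ret _)) 1 (fun m' a => onth m' a = Some (x / y)).
Proof.
move=> ix jy y0; exists (rcons m (x / y)), (size m), 1%N; split=> //=.
- by rewrite (onth_val ix) (onth_val jy) (negPf y0).
- exact: prefix_rcons.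
- exact: onth_last.
Qed.

Lemma runs_ifzero X m i x (c0 c1 : comp X) b Q :
  onth m i = Some x -> (0 < b)%N ->
  (x = 0 -> runs m c0 b.-1 Q) -> (x != 0 -> runs m c1 b.-1 Q) ->
  runs m (IfZero i c0 c1) b Q.
Proof.
move=> /onth_val ix b0 r0 r1; have [xz|xz] := eqVneq x 0.
  have [m' [y [n [r le p Qy]]]] := r0 xz; exists m', y, n.+1; split=> //; last by lia.
  by rewrite /= ix xz eqxx r.
have [m' [y [n [r le p Qy]]]] := r1 xz; exists m', y, n.+1; split=> //; last by lia.
by rewrite /= ix (negPf xz) r.
Qed.
End Programs.

(** * Matrix programs *)

Section MatrixPrograms.
Variable K : fieldType.
Implicit Types m : seq K.

(** Addresses of the entries of a matrix whose dimensions are known from the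
    context; extracting blocks or rows is then free. *)
Definition addrs := nat -> nat -> nat.

Definition holds m (a : addrs) p q (A : 'M[K]_(p, q)) : Prop :=
  forall (i : 'I_p) (j : 'I_q), onth m (a i j) = Some (A i j).

Lemma holds_prefix m m' a p q (A : 'M[K]_(p, q)) :
  prefix m m' -> holds m a A -> holds m' a A.
Proof. by move=> pre mA i j; apply: prefix_onth (mA i j). Qed.

Fixpoint emits (l : seq (ring_op K)) : comp K (seq nat) :=
  if l is o :: l' then
    Emit o (fun a => bind (emits l') (fun s => Ret K (a :: s)))
  else Ret K [::].

Lemma runs_emits m l (x : nat -> K) o0 b : (size l <= b)%N ->
  (forall k m', (k < size l)%N -> prefix m m' ->
     ring_op_eval m' (nth o0 l k) = x k) ->
  runs m (emits l) b
    (fun m' s => forall k, (k < size l)%N -> onth m' (nth 0%N s k) = Some (x k)).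
Proof.
elim: l m x b => [|o l IH] m x b /= lb lx; first exact: runs_ret.
apply: (@runs_emit _ _ m o _ _ (x 0%N)); [exact: (lx 0%N m isT (prefix_refl m)) | lia |] => m1 pre1 a1.
have lx1 k m' : (k < size l)%N -> prefix m1 m' ->
    ring_op_eval m' (nth o0 l k) = x k.+1.
  by move=> kl pre'; apply: (lx k.+1) => //; apply: prefix_trans pre1 pre'.
apply: (runs_bind (IH m1 (x \o S) _ (leqnn _) lx1)); first by case: b lb.
move=> m2 s pre2 sP; apply: runs_ret => -[_|k]; last exact: sP.
exact: prefix_onth a1.
Qed.

Definition opmx (p q : nat) (F : nat -> nat -> ring_op K) : comp K addrs :=
  bind (emits [seq F (k %/ q)%N (k %% q)%N | k <- iota 0 (p * q)])
       (fun s => Ret K (fun i j => nth 0%N s (i * q + j))).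

Lemma runs_opmx m p q (F : nat -> nat -> ring_op K) (A : 'M[K]_(p, q)) b : (p * q <= b)%N ->
  (forall (i : 'I_p) (j : 'I_q) m', prefix m m' ->
    ring_op_eval m' (F i j) = A i j) ->
  runs m (opmx p q F) b (fun m' a => holds m' a A).
Proof.
move=> le_b FA.
pose x k := if insub (k %/ q)%N is Some i then
              if insub (k %% q)%N is Some j then A i j else 0 else 0.
apply: (@runs_bind _ _ _ _ _ _ _ _ _ _ (runs_emits (o0 := Cst 0) (x := x) (leqnn _) _)).
- move=> k m'; rewrite size_map size_iota => kpq pre.
  have q0 : (0 < q)%N by case: (q) kpq => //; rewrite muln0.
  rewrite (nth_map 0%N) ?size_iota // nth_iota // add0n /x.
  have ip : (k %/ q < p)%N by rewrite ltn_divLR.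
  have jq : (k %% q < q)%N by rewrite ltn_mod.
  by rewrite (insubT (fun i => (i < p)%N) ip) (insubT (fun j => (j < q)%N) jq) -(FA _ _ m').
- by rewrite size_map size_iota.
move=> m' s _; rewrite size_map size_iota => sP; apply: runs_ret => i j.
have kpq : (i * q + j < p * q)%N.
  by have := ltn_ord i; have := ltn_ord j; nia.
have q0 : (0 < q)%N by have := ltn_ord j; lia.
rewrite sP // /x divnMDl // modnMDl divn_small // addn0 modn_small //.
by rewrite !valK.
Qed.

Lemma runs_cstmx m p q (f : nat -> nat -> K) b : (p * q <= b)%N ->
  runs m (opmx p q (fun i j => Cst (f i j))) b
    (fun m' a => holds m' a (\matrix_(i < p, j < q) f i j)).
Proof. by move=> le_b; apply: runs_opmx => // i j m' _; rewrite mxE. Qed.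

Lemma runs_addmx m p q a a' (A A' : 'M[K]_(p, q)) b : (p * q <= b)%N ->
  holds m a A -> holds m a' A' ->
  runs m (opmx p q (fun i j => Defs.Add (a i j) (a' i j))) b
    (fun m' c => holds m' c (A + A')).
Proof.
move=> le_b aA aA'; apply: runs_opmx => // i j m' pre /=.
by rewrite (onth_val (prefix_onth pre (aA i j)))
  (onth_val (prefix_onth pre (aA' i j))) mxE.
Qed.

Lemma runs_submx m p q a a' (A A' : 'M[K]_(p, q)) b : (p * q <= b)%N ->
  holds m a A -> holds m a' A' ->
  runs m (opmx p q (fun i j => Defs.Sub (a i j) (a' i j))) b
    (fun m' c => holds m' c (A - A')).
Proof.
move=> le_b aA aA'; apply: runs_opmx => // i j m' pre /=.
by rewrite (onth_val (prefix_onth pre (aA i j)))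
  (onth_val (prefix_onth pre (aA' i j))) !mxE.
Qed.

(** [env] lists the addresses, in the actual memory, of the successive cells of
    the memory assumed by the straight-line program; positions out of range,
    which read 0, are sent to the address [z] of a zero. *)
Definition relocate (z : nat) (env : seq nat) (o : ring_op K) : ring_op K :=
  match o with
  | Cst x => Cst x
  | Defs.Add i j => Defs.Add (nth z env i) (nth z env j)
  | Defs.Sub i j => Defs.Sub (nth z env i) (nth z env j)
  | Defs.Mul i j => Defs.Mul (nth z env i) (nth z env j)
  end.

Fixpoint simulate (z : nat) (env : seq nat) (s : seq (ring_op K)) :
    comp K (seq nat) :=
  if s is o :: s' then
    Emit (relocate z env o) (fun a => simulate z (rcons env a) s')
  else Ret K env.

Lemma onth_relocate m z env (mem : seq K) i : onth m z = Some 0 ->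
  map (onth m) env = map (@Some K) mem -> onth m (nth z env i) = Some mem`_i.
Proof.
move=> z0 e; have se : size env = size mem.
  by have := congr1 size e; rewrite !size_map.
have [im|mi] := ltnP i (size mem); last by rewrite !nth_default ?se.
have := congr1 (fun s => nth None s i) e.
by rewrite (nth_map z) ?se // (nth_map 0).
Qed.

Lemma runs_simulate m z env mem s b : (slp_cost s <= b)%N ->
  onth m z = Some 0 -> map (onth m) env = map (@Some K) mem ->
  runs m (simulate z env s) b
    (fun m' env' => onth m' z = Some 0 /\
       map (onth m') env' = map (@Some K) (slp_run mem s)).
Proof.
elim: s m env mem b => [|o s IH] m env mem b /= le_b z0 envE.
  exact: runs_ret.
have rel i : m`_(nth z env i) = mem`_i by apply/onth_val/onth_relocate.
have oE : ring_op_eval m (relocate z env o) = ring_op_eval mem o.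
  by case: o {le_b} => [x|i j|i j|i j] //=; rewrite !rel.
have oc : ring_op_cost (relocate z env o) = ring_op_cost o by case: (o).
set x := ring_op_eval mem o in oE *.
have pre : prefix m (rcons m x) by apply: prefix_rcons.
have [||| m' [env' [n [r le p Q]]]] :=
  IH (rcons m x) (rcons env (size m)) (rcons mem x) (b - ring_op_cost o)%N.
- by move: le_b; rewrite /slp_cost /=; lia.
- exact: prefix_onth z0.
- rewrite !map_rcons onth_last -envE; congr rcons; apply/eq_in_map => i ienv.
  have /mapP[y _ iy] : onth m i \in map (@Some K) mem by rewrite -envE map_f.
  by rewrite iy; apply: prefix_onth iy.
exists m', env', (ring_op_cost o + n)%N; split=> //.
- by move: r; rewrite /= oE oc size_rcons => ->.
- by move: le_b le; rewrite /slp_cost /=; lia.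
- exact: prefix_trans p.
Qed.

Definition mx_at T (x0 : T) n (A : 'M[T]_n) (i j : nat) : T :=
  if insub i is Some i' then if insub j is Some j' then A i' j' else x0 else x0.

Lemma mx_atE T (x0 : T) n (A : 'M[T]_n) (i j : 'I_n) : mx_at x0 A i j = A i j.
Proof. by rewrite /mx_at !valK. Qed.

Definition padaddr (p q z : nat) (a : addrs) : addrs :=
  fun i j => if (i < p)%N && (j < q)%N then a i j else z.

Lemma holds_pad m N p q z a (A : 'M[K]_(p, q)) : onth m z = Some 0 ->
  holds m a A -> holds m (padaddr p q z a) (pad N A).
Proof.
move=> z0 aA i j; rewrite padE /padaddr; case: insubP => [i' -> ii'|/negPf ->] //=.
case: insubP => [j' -> jj'|/negPf ->] //=; rewrite ?andbF //.
by rewrite -ii' -jj'; apply: aA.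
Qed.

Lemma holds_sub m N p q a (C : 'M[K]_N) : (p <= N)%N -> (q <= N)%N ->
  holds m a C -> holds m a (pid_mx p *m C *m pid_mx q : 'M[K]_(p, q)).
Proof.
move=> pN qN aC i j.
by rewrite (@unpadE _ N p q C i j (widen_ord pN i) (widen_ord qN j)) // -aC.
Qed.

Variable mm : forall N : nat, seq (ring_op K).
Variable mmout : forall N : nat, 'M[nat]_N.
Hypothesis mmP : forall N (B C : 'M[K]_N),
  read_mx (slp_run (mx_input B ++ mx_input C) (mm N)) (mmout N) = B *m C.
Variable F : nat -> nat.
Hypothesis F_mm : forall N, (slp_cost (mm N) <= F N)%N.
Hypothesis F_sq : forall N, (N * N <= F N)%N.
Hypothesis F_mono : forall N N', (N <= N')%N -> (F N <= F N')%N.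

Definition mulsq (N z : nat) (a b : addrs) : comp K addrs :=
  let inp (a : addrs) := [seq a (val i) (val j) | i <- enum 'I_N, j <- enum 'I_N] in
  bind (simulate z (inp a ++ inp b) (mm N))
       (fun env => Ret K (fun i j => nth z env (mx_at 0%N (mmout N) i j))).

Lemma runs_mulsq m N z a b (A B : 'M[K]_N) : onth m z = Some 0 ->
  holds m a A -> holds m b B ->
  runs m (mulsq N z a b) (F N) (fun m' c => holds m' c (A *m B)).
Proof.
move=> z0 aA bB.
apply: (runs_bind (runs_simulate (mem := mx_input A ++ mx_input B) (F_mm N) z0 _)).
- by rewrite !map_cat; congr (_ ++ _); rewrite /mx_input !map_allpairs;
    apply: eq_allpairs => i j; rewrite ?aA ?bB.
- by [].
move=> m' env _ [z0' envE]; apply: runs_ret => i j; rewrite mx_atE.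
by rewrite (onth_relocate _ z0' envE) -mmP mxE.
Qed.

(** Rectangular products are computed at the size of the largest dimension. *)
Definition mulp (p q r : nat) (a b : addrs) : comp K addrs :=
  let N := maxn p (maxn q r) in
  bind (Emit (Cst 0) (@Ret K nat)) (fun z =>
    mulsq N z (padaddr p q z a) (padaddr q r z b)).

Lemma runs_mulp m p q r a b (A : 'M[K]_(p, q)) (B : 'M[K]_(q, r)) D c :
  (p <= D)%N -> (q <= D)%N -> (r <= D)%N -> (F D <= c)%N ->
  holds m a A -> holds m b B ->
  runs m (mulp p q r a b) c (fun m' c => holds m' c (A *m B)).
Proof.
move=> pD qD rD FDc aA bB; set N := maxn p (maxn q r).
have ND : (N <= D)%N by rewrite !geq_max pD qD rD.
have pN : (p <= N)%N by rewrite leq_maxl.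
have qN : (q <= N)%N by rewrite /N; lia.
have rN : (r <= N)%N by rewrite /N; lia.
apply: (runs_bind (runs_cst _ _ 0)) => // m1 z pre z0.
have aA' := holds_pad (N := N) z0 (holds_prefix pre aA).
have bB' := holds_pad (N := N) z0 (holds_prefix pre bB).
apply: (runs_weaken (runs_mulsq z0 aA' bB')).
  by rewrite subn0 (leq_trans _ FDc) // F_mono.
by move=> m2 x _ xC; rewrite (pad_mul A B pN qN rN); apply: holds_sub xC.
Qed.
End MatrixPrograms.

(** * Generalized inverses by recursion on quadrants *)

Notation "'let!' x ':=' c 'in' f" := (bind c (fun x => f))
  (at level 200, x pattern, c at level 100, f at level 200).

(** Transports to the current memory all that is known about addresses. *)
Ltac refresh pre :=
  match type of pre with
  | is_true (prefix ?m ?m') =>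
    repeat match goal with
    | H : holds m _ _ |- _ => apply (holds_prefix pre) in H
    | H : onth m _ = Some _ |- _ => apply (prefix_onth pre) in H
    end
  end.

(** In this section [F D] bounds the cost of one multiplication or addition of
    matrices with dimensions at most [D]. *)
Section FastLinearAlgebra.
Variable K : fieldType.
Implicit Types m : seq K.
Variable mul : nat -> nat -> nat -> addrs -> addrs -> comp K addrs.
Variable F : nat -> nat.
Hypothesis F_sq : forall N, (N * N <= F N)%N.
Hypothesis F_mono : forall N N', (N <= N')%N -> (F N <= F N')%N.
Hypothesis F_quad : forall N, (4 * F N <= F (N + N))%N.
Hypothesis F_add : forall N N', (F N + F N' <= F (N + N'))%N.
Hypothesis runs_mul : forall m p q r a b (A : 'M[K]_(p, q)) (B : 'M[K]_(q, r)) D c,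
  (p <= D)%N -> (q <= D)%N -> (r <= D)%N -> (F D <= c)%N ->
  holds m a A -> holds m b B ->
  runs m (mul p q r a b) c (fun m' c => holds m' c (A *m B)).

Definition addp (p q : nat) (a b : addrs) : comp K addrs :=
  opmx p q (fun i j => Defs.Add (a i j) (b i j)).
Definition subp (p q : nat) (a b : addrs) : comp K addrs :=
  opmx p q (fun i j => Defs.Sub (a i j) (b i j)).

Lemma mul_F p q D : (p <= D)%N -> (q <= D)%N -> (p * q <= F D)%N.
Proof. by move=> pD qD; apply: leq_trans (F_sq D); apply: leq_mul. Qed.

Lemma runs_addp m p q a b (A B : 'M[K]_(p, q)) D c :
  (p <= D)%N -> (q <= D)%N -> (F D <= c)%N -> holds m a A -> holds m b B ->
  runs m (addp p q a b) c (fun m' c => holds m' c (A + B)).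
Proof.
by move=> pD qD Dc aA bB; apply: runs_addmx => //; apply: leq_trans Dc; apply: mul_F.
Qed.

Lemma runs_subp m p q a b (A B : 'M[K]_(p, q)) D c :
  (p <= D)%N -> (q <= D)%N -> (F D <= c)%N -> holds m a A -> holds m b B ->
  runs m (subp p q a b) c (fun m' c => holds m' c (A - B)).
Proof.
by move=> pD qD Dc aA bB; apply: runs_submx => //; apply: leq_trans Dc; apply: mul_F.
Qed.

Fixpoint pw (k : nat) : nat := if k is k'.+1 then (pw k' + pw k')%N else 1%N.

Lemma pwE k : pw k = (2 ^ k)%N.
Proof. by elim: k => //= k ->; rewrite expnS mul2n addnn. Qed.

Definition quadrant h (a b : bool) (R : 'M[K]_(h + h)) : 'M[K]_h :=
  half_sel K h a *m R *m (half_sel K h b)^T.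

Lemma quadrantE h a b (R : 'M[K]_(h + h)) i j :
  quadrant a b R i j =
  R ((if a then @rshift h h else @lshift h h) i)
    ((if b then @rshift h h else @lshift h h) j).
Proof.
have rowE : half_sel K h a *m R = if a then dsubmx R else usubmx R.
  by rewrite -[in LHS](vsubmxK R) /half_sel; case: a;
    rewrite mul_row_col !(mul0mx, mul1mx) ?add0r ?addr0.
have colE (B : 'M[K]_(h, h + h)) :
    B *m (half_sel K h b)^T = if b then rsubmx B else lsubmx B.
  by rewrite -[in LHS](hsubmxK B) /half_sel; case: b;
    rewrite tr_row_mx trmx0 trmx1 mul_row_col !(mulmx0, mulmx1) ?add0r ?addr0.
by rewrite /quadrant rowE colE; case: a {rowE}; case: b {colE}; rewrite !mxE.
Qed.

(** So a zero quadrant stays zero if the quadrant in the same rows and in the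
    columns [be] is zero, or the one in the rows [al] and in the same columns. *)
Lemma quadrant_residue h (al be a b : bool) (R : 'M[K]_(h + h)) (Y : 'M[K]_h) :
  quadrant a b
    (R - R *m ((half_sel K h be)^T *m Y *m half_sel K h al) *m R) =
  quadrant a b R - quadrant a be R *m Y *m quadrant al b R.
Proof. by rewrite /quadrant mulmxBr mulmxBl !mulmxA. Qed.

Lemma quadrant_eq0 h (R : 'M[K]_(h + h)) :
  (forall a b, quadrant a b R = 0) -> R = 0.
Proof.
move=> R0; have tot := half_sel_total K h.
have z a b : (half_sel K h a)^T *m half_sel K h a *m R
    *m ((half_sel K h b)^T *m half_sel K h b) = 0.
  have -> : (half_sel K h a)^T *m half_sel K h a *m R
      *m ((half_sel K h b)^T *m half_sel K h b) =
      (half_sel K h a)^T *m quadrant a b R *m half_sel K h b.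
    by rewrite /quadrant !mulmxA.
  by rewrite R0 mulmx0 mul0mx.
by rewrite -[R]mul1mx -[_ *m R]mulmx1 -tot mulmxDl mulmxDl !mulmxDr !z !addr0.
Qed.

Definition quad_addr (h : nat) (a b : bool) (r : addrs) : addrs :=
  fun i j => r (if a then h + i else i)%N (if b then h + j else j)%N.

Lemma holds_quadrant m h a b r (R : 'M[K]_(h + h)) :
  holds m r R -> holds m (quad_addr h a b r) (quadrant a b R).
Proof. by move=> rR i j; rewrite quadrantE -rR; case: a; case: b. Qed.

Definition quad_embed (h z : nat) (a b : bool) (y : addrs) : addrs :=
  fun i j => if (nat_of_bool (h <= i) == b)%N && (nat_of_bool (h <= j) == a)%N
             then y (if b then i - h else i)%N (if a then j - h else j)%N else z.

Lemma holds_quad_embed m h z a b y (Y : 'M[K]_h) : onth m z = Some 0 ->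
  holds m y Y ->
  holds m (quad_embed h z a b y) ((half_sel K h b)^T *m Y *m half_sel K h a).
Proof.
move=> z0 yY i j; rewrite /quad_embed.
have e1 : ((half_sel K h b)^T *m Y *m half_sel K h a) =
    block_mx (if ~~ b && ~~ a then Y else 0) (if ~~ b && a then Y else 0)
             (if b && ~~ a then Y else 0) (if b && a then Y else 0).
  rewrite /half_sel; case: a; case: b => /=; rewrite tr_row_mx trmx0 trmx1;
    by rewrite mul_col_mx mul_col_row !mul0mx !mulmx0 !mul1mx !mulmx1.
rewrite e1; case: (split_ordP i) => i' ->; case: (split_ordP j) => j' ->;
  rewrite ?(block_mxEul, block_mxEur, block_mxEdl, block_mxEdr) /=;
  rewrite ?leq_addr ?[(h <= i')%N]leqNgt ?[(h <= j')%N]leqNgt ?ltn_ord /=;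
  by case: a {e1}; case: b => /=; rewrite ?mxE ?addKn ?yY ?z0.
Qed.

Definition ginv_step (h : nat) (rec : addrs -> comp K (addrs * seq nat * seq nat))
    (al be : bool) (a : addrs) (s : addrs * seq nat * seq nat) :
    comp K (addrs * seq nat * seq nat) :=
  let n := (h + h)%N in
  let '(z, si, sj) := s in
  let! az := mul n n n a z in
  let! aza := mul n n n az a in
  let! r := subp n n a aza in
  let! (y, si', sj') := rec (quad_addr h al be r) in
  let! o := Emit (Cst 0) (@Ret K nat) in
  let y := quad_embed h o al be y in
  let! za := mul n n n z a in
  let! zay := mul n n n za y in
  let! q := subp n n y zay in
  let! qa := mul n n n q a in
  let! qaz := mul n n n qa z in
  let! s1 := addp n n z q in
  let! z' := subp n n s1 qaz in
  Ret K (z', si ++ half_shift h al si', sj ++ half_shift h be sj').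

Definition ginv_spec p q (A : 'M[K]_(p, q)) m (r : addrs * seq nat * seq nat) : Prop :=
  exists Z : 'M[K]_(q, p), [/\ holds m r.1.1 Z, pivoting A Z r.1.2 r.2
                             & A *m Z *m A = A].

(** Loop invariant: [done] tells which quadrants of the residue are cleared. *)
Definition ginv_inv h (A : 'M[K]_(h + h)) (done : bool -> bool -> bool) m
    (r : addrs * seq nat * seq nat) : Prop :=
  exists Z : 'M[K]_(h + h), [/\ holds m r.1.1 Z, pivoting A Z r.1.2 r.2
    & forall a b, done a b -> quadrant a b (A - A *m Z *m A) = 0].

Lemma runs_ginv_step m h rec al be a s (A : 'M[K]_(h + h)) done c b :
  (c + 10 * F (h + h) <= b)%N ->
  (forall m' a' (A' : 'M[K]_h), holds m' a' A' ->
     runs m' (rec a') c (ginv_spec A')) ->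
  holds m a A -> ginv_inv A done m s ->
  (forall a b, done a b -> done a be || done al b) ->
  runs m (ginv_step h rec al be a s) b
    (fun m' s' => holds m' a A /\
       ginv_inv A (fun a b => done a b || ((a == al) && (b == be))) m' s').
Proof.
move=> le_b recP aA [Z [zZ piv dn]] doneP; case: s zZ piv => [[z I] J] /= zZ piv.
set n := (h + h)%N in le_b *; have nn : (n <= n)%N by [].
have F1 : (F n <= 1 * F n)%N by rewrite mul1n.
have {}le_b : (10 * F n + (c + 0) <= b)%N by rewrite addn0 addnC.
apply: (runs_leq le_b).
apply: (runs_bind_units (runs_mul nn nn nn F1 aA zZ)) => //.
move=> m1 az pre azE; refresh pre.
apply: (runs_bind_units (runs_mul nn nn nn F1 azE aA)) => //.
move=> m2 aza pre1 azaE; refresh pre1.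
apply: (runs_bind_units (runs_subp nn nn F1 aA azaE)) => //.
move=> m3 r pre2 rE; refresh pre2.
apply: (runs_bind_rest (recP _ _ _ (holds_quadrant al be rE))).
move=> m4 [[y I'] J'] pre3 [Y [/= yY pivY YE]]; refresh pre3.
apply: (runs_bind_units (runs_cst _ _ (0 * _))) => // m5 o pre4 o0; refresh pre4.
have yE := holds_quad_embed al be o0 yY.
set y' := quad_embed _ _ _ _ _ in yE *; set Y' := _ *m Y *m _ in yE *.
apply: (runs_bind_units (runs_mul nn nn nn F1 zZ aA)) => //.
move=> m6 za pre5 zaE; refresh pre5.
apply: (runs_bind_units (runs_mul nn nn nn F1 zaE yE)) => //.
move=> m7 zay pre6 zayE; refresh pre6.
apply: (runs_bind_units (runs_subp nn nn F1 yE zayE)) => //.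
move=> m8 q pre7 qE; refresh pre7.
apply: (runs_bind_units (runs_mul nn nn nn F1 qE aA)) => //.
move=> m9 qa pre8 qaE; refresh pre8.
apply: (runs_bind_units (runs_mul nn nn nn F1 qaE zZ)) => //.
move=> m10 qaz pre9 qazE; refresh pre9.
apply: (runs_bind_units (runs_addp nn nn F1 zZ qE)) => //.
move=> m11 s1 pre10 s1E; refresh pre10.
apply: (runs_bind_units (runs_subp nn nn F1 s1E qazE)) => //.
move=> m12 z' pre11 z'E; refresh pre11.
apply: runs_ret; split=> //; exists (pivot_step A Z Y'); split=> //=.
  exact/pivoting_step/pivoting_quadrant.
move=> i j ij; rewrite pivot_step_residue quadrant_residue.
case/orP: ij => [ij|/andP[/eqP -> /eqP ->]]; last by rewrite YE subrr.
rewrite dn //; case/orP: (doneP _ _ ij) => /dn ->.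
  by rewrite !mul0mx subr0.
by rewrite !mulmx0 subr0.
Qed.

Fixpoint ginv (k : nat) (a : addrs) : comp K (addrs * seq nat * seq nat) :=
  if k is k'.+1 then
    let h := pw k' in
    let! z := opmx (h + h) (h + h) (fun _ _ => Cst 0) in
    let! s := ginv_step h (ginv k') false false a (z, [::], [::]) in
    let! s := ginv_step h (ginv k') false true a s in
    let! s := ginv_step h (ginv k') true false a s in
    ginv_step h (ginv k') true true a s
  else
    IfZero (a 0 0)%N
      (let! z := Emit (Cst 0) (@Ret K nat) in Ret K (fun _ _ => z, [::], [::]))
      (let! o := Emit (Cst 1) (@Ret K nat) in
       let! q := Quot o (a 0 0)%N (@Ret K nat) in
       Ret K (fun _ _ => q, [:: 0%N], [:: 0%N])).

(** Four calls cost 4 F(h) <= F(2h) per unit, so each level of the recursion adds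
    the same amount: 4 * 10 units for the steps and one for the initial zero. *)
Lemma runs_ginv k m a (A : 'M[K]_(pw k)) b : (41 * k.+1 * F (pw k) <= b)%N ->
  holds m a A -> runs m (ginv k a) b (ginv_spec A).
Proof.
elim: k m a A b => [|k IH] m a A b le_b aA.
  rewrite -[pw 0]/1%N in A le_b aA *; have F1 := F_sq 1.
  have a0 := aA 0 0; apply: (runs_ifzero a0); first by lia.
    move=> A0; apply: (runs_bind (runs_cst _ _ 0)) => // m1 z pre z0.
    apply: runs_ret; exists 0; split=> /=; last first.
    - by rewrite mulmx0 mul0mx [A]mx11_scalar A0 raddf0.
    - exact: pivoting0.
    - by move=> i j; rewrite !ord1 mxE /= z0.
  move=> A0; apply: (runs_bind (runs_cst _ _ 0)) => // m1 o pre o1; refresh pre.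
  apply: (runs_bind (runs_quot o1 a0 A0)); first by lia.
  move=> m2 q pre2 qE; refresh pre2; apply: runs_ret.
  have dI : coord_proj K 1 [:: 0%N] = 1%:M.
    by apply/matrixP => i j; rewrite coord_projE !ord1 mxE.
  move: (A 0 0) (mx11_scalar A) A0 qE => x -> x0 qE.
  exists (x^-1)%:M; split=> /=.
  - by move=> i j; rewrite !ord1 mxE eqxx mulr1n -div1r.
  - by split; rewrite ?dI ?mul1mx ?mulmx1 //= -scalar_mxM ?divff ?mulVf.
  - by rewrite -!scalar_mxM divff ?mul1r.
rewrite -[pw k.+1]/(pw k + pw k)%N in A le_b aA *.
set h := pw k in A IH le_b aA *; set c := (41 * k.+1 * F h)%N.
have Fq := F_quad h.
have cb : (4 * c + 41 * F (h + h) <= b)%N.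
  apply: leq_trans le_b; rewrite /c.
  have : (41 * k.+1 * (4 * F h) <= 41 * k.+1 * F (h + h))%N by rewrite leq_mul2l Fq orbT.
  lia.
have recP m' a' (A' : 'M[K]_h) : holds m' a' A' -> runs m' (ginv k a') c (ginv_spec A').
  exact: IH.
apply: (runs_bind (runs_cstmx m (p := h + h) (q := h + h) (fun _ _ => 0) (F_sq _))).
  by lia.
move=> m1 z pre zE; refresh pre.
have inv0 : ginv_inv A (fun _ _ => false) m1 (z, [::], [::]).
  exists 0; split=> //=; last exact: pivoting0.
  by move=> i j; rewrite (zE i j) !mxE.
apply: (runs_bind (runs_ginv_step (leqnn _) recP aA inv0 _)) => //; first by lia.
move=> m2 s1 _ [{}aA inv1].
apply: (runs_bind (runs_ginv_step (leqnn _) recP aA inv1 _)) => //.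
- by case; case.
- by lia.
move=> m3 s2 _ [{}aA inv2].
apply: (runs_bind (runs_ginv_step (leqnn _) recP aA inv2 _)) => //.
- by case; case.
- by lia.
move=> m4 s3 _ [{}aA inv3].
apply: (runs_weaken (runs_ginv_step (leqnn _) recP aA inv3 _)) => //.
- by case; case.
- by lia.
move=> m5 s4 _ [_ [Z [zZ piv dn]]]; exists Z; split=> //.
apply/esym/eqP; rewrite -subr_eq0; apply/eqP/quadrant_eq0 => i j.
by apply: dn; case: i; case: j.
Qed.

(** * Programs for row bases and Krylov matrices *)

Definition pad_exp (p q : nat) : nat := up_log 2 (maxn p q).

Lemma leq_pad_exp p q : (maxn p q <= pw (pad_exp p q))%N.
Proof. by rewrite pwE up_logP. Qed.

Lemma pw_up_log n D : (2 * n <= D)%N -> (0 < D)%N -> (2 ^ up_log 2 n <= D)%N.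
Proof.
move=> nD D0; have [n1|n1] := leqP n 1.
  by have /eqP -> : up_log 2 n == 0%N by rewrite up_log_eq0 n1 orbT.
have := up_log_bounds (isT : (1 < 2)%N) n1; rewrite /=.
have : (0 < up_log 2 n)%N by rewrite up_log_gt0 n1.
by case: (up_log 2 n) => // k _ /=; rewrite expnS; lia.
Qed.

Lemma pad_exp_leq p q D : (2 * p <= D)%N -> (2 * q <= D)%N -> (0 < D)%N ->
  (pw (pad_exp p q) <= D)%N.
Proof. by move=> pD qD D0; rewrite pwE pw_up_log //; lia. Qed.

Definition ginvp (p q : nat) (a : addrs) : comp K (addrs * seq nat * seq nat) :=
  let! z := Emit (Cst 0) (@Ret K nat) in
  ginv (pad_exp p q) (padaddr p q z a).

Lemma runs_ginvp p q D L m a (A : 'M[K]_(p, q)) b :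
  (2 * p <= D)%N -> (2 * q <= D)%N -> (0 < D)%N -> (D <= 2 ^ L)%N ->
  (41 * L.+1 * F D <= b)%N -> holds m a A ->
  runs m (ginvp p q a) b (ginv_spec A).
Proof.
move=> pD qD D0 DL le_b aA; set k := pad_exp p q.
have := leq_pad_exp p q; rewrite geq_max -/k => /andP[pk qk].
have kD : (pw k <= D)%N by apply: pad_exp_leq.
have kL : (k <= L)%N by rewrite -(@leq_exp2l 2) // -pwE (leq_trans kD).
apply: (runs_bind (runs_cst _ _ 0)) => // m1 z pre z0; refresh pre.
have padA := holds_pad (N := pw k) z0 aA.
apply: (runs_weaken (runs_ginv (leqnn _) padA)).
  by rewrite subn0 (leq_trans _ le_b) // leq_mul // ?F_mono // leq_mul.
move=> m2 [[y si] sj] _ [Z [/= yZ piv ZE]].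
have [piv' ZE'] := pivoting_unpad pk qk piv.
exists (pid_mx q *m Z *m pid_mx p); split=> //=; last exact: ZE'.
exact: holds_sub yZ.
Qed.

Definition rowbasep (p d : nat) (a : addrs) : comp K (nat * addrs * addrs) :=
  let! (z, si, sj) := ginvp p d a in
  let! za := mul d p d z a in
  let! e := opmx d d (fun i j => Cst (i == j)%:R) in
  let! x := subp d d e za in
  let! o0 := Emit (Cst 0) (@Ret K nat) in
  let! o1 := Emit (Cst 1) (@Ret K nat) in
  let r := size si in
  let jc := compl d sj in
  Ret K (r,
    fun i j => if (i < r)%N then a (nth 0%N si i) j
               else if nth 0%N jc (i - r) == j then o1 else o0,
    fun i j => if (j < r)%N then z i (nth 0%N si j)
               else x i (nth 0%N jc (j - r))).

Definition rowbase_spec p d (A : 'M[K]_(p, d)) m (s : nat * addrs * addrs) : Prop :=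
  exists d2 (W : 'M[K]_(s.1.1 + d2, d)) (Wi : 'M[K]_(d, s.1.1 + d2)),
    [/\ (s.1.1 + d2)%N = d, holds m s.1.2 W, holds m s.2 Wi,
        Wi *m W = 1%:M & (usubmx W :=: A)%MS].

Lemma runs_rowbasep p d D L m a (A : 'M[K]_(p, d)) b :
  (2 * p <= D)%N -> (2 * d <= D)%N -> (0 < D)%N -> (D <= 2 ^ L)%N ->
  (41 * L.+1 * F D + 3 * F D <= b)%N -> holds m a A ->
  runs m (rowbasep p d a) b (rowbase_spec A).
Proof.
move=> pD dD D0 DL le_b aA.
have pD' : (p <= D)%N by lia.
have dD' : (d <= D)%N by lia.
apply: (runs_bind (runs_ginvp pD dD D0 DL (leqnn _) aA)); first by lia.
move=> m1 [[z si] sj] pre [Z [/= zZ piv AZA]]; refresh pre.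
apply: (runs_bind (runs_mul dD' pD' dD' (leqnn _) zZ aA)); first by lia.
move=> m2 za pre2 zaE; refresh pre2.
apply: (runs_bind (runs_cstmx m2 (p := d) (q := d) _ (mul_F dD' dD'))).
  by lia.
move=> m3 e pre3 eE; refresh pre3.
apply: (runs_bind (runs_subp dD' dD' (leqnn _) eE zaE)); first by lia.
move=> m4 x pre4 xE; refresh pre4.
apply: (runs_bind (runs_cst _ _ 0)) => // m5 o0 pre5 o0E; refresh pre5.
apply: (runs_bind (runs_cst _ _ 0)) => // m6 o1 pre6 o1E; refresh pre6.
apply: runs_ret.
have IE : \matrix_(i < d, j < d) ((i : nat) == j)%:R = 1%:M :> 'M[K]_d.
  by apply/matrixP => i j; rewrite !mxE.
rewrite IE in xE.
have [_ _ _ /allP lI /allP lJ _ _ _ _] := piv.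
exists (size (compl d sj)), (rowbasis A si sj), (rowbasis_inv A Z si sj).
split=> /=; last 2 first.
- exact: rowbasisVK piv.
- exact: rowbasis_span AZA.
- exact: rowbasis_dim piv.
- move=> i j; rewrite /rowbasis; case: (split_ordP i) => i' ->.
    rewrite col_mxEu /= ?ltn_ord.
    have ip : (nth 0%N si i' < p)%N by apply/lI/mem_nth.
    by rewrite (@mul_rowsel _ _ _ _ _ _ (Ordinal ip)) // -aA.
  rewrite col_mxEd /= ?ltnNge ?leq_addr /= ?addKn mxE.
  by case: eqP => _; rewrite ?o1E ?o0E.
- move=> i j; rewrite /rowbasis_inv; case: (split_ordP j) => j' ->.
    rewrite row_mxEl /= ?ltn_ord.
    have jp : (nth 0%N si j' < p)%N by apply/lI/mem_nth.
    rewrite -[Z]trmxK -trmx_mul mxE (@mul_rowsel _ _ _ _ _ _ (Ordinal jp)) //.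
    by rewrite mxE -zZ.
  rewrite row_mxEr /= ?ltnNge ?leq_addr /= ?addKn.
  have jd : (nth 0%N (compl d sj) j' < d)%N.
    have := mem_nth 0%N (ltn_ord j').
    by rewrite mem_filter mem_iota => /and3P[].
  rewrite -[1%:M - _]trmxK -trmx_mul mxE (@mul_rowsel _ _ _ _ _ _ (Ordinal jd)) //.
  by rewrite mxE -xE.
Qed.

Definition stack (w : nat) (a b : addrs) : addrs :=
  fun i j => if (i < w)%N then a i j else b (i - w)%N j.

Lemma holds_stack m w w' d a b (A : 'M[K]_(w, d)) (B : 'M[K]_(w', d)) :
  holds m a A -> holds m b B -> holds m (stack w a b) (col_mx A B).
Proof.
move=> aA bB i j; rewrite /stack; case: (split_ordP i) => i' ->.
  by rewrite col_mxEu /= ?ltn_ord.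
by rewrite col_mxEd /= ?ltnNge ?leq_addr /= ?addKn.
Qed.

(** Doubling: rows r A^i for i < w, and A^w, give rows for i < 2w, and A^2w. *)
Fixpoint kryp (l d w : nat) (p a : addrs) : comp K addrs :=
  if l is l'.+1 then
    let! b := mul w d d a p in
    let! p2 := mul d d d p p in
    kryp l' d (w + w) p2 (stack w a b)
  else Ret K a.

Lemma kry_add w w' d (A : 'M[K]_d) x :
  kry (w + w') A x = col_mx (kry w A x) (kry w' A x *m A ^+ w).
Proof.
apply/row_matrixP => i; rewrite row_kry; case: (split_ordP i) => i' ->.
  by rewrite rowKu row_kry.
rewrite rowKd row_mul row_kry -mulmxA mulmxE -exprD.
by rewrite [(i' + w)%N]addnC.
Qed.

Lemma runs_kryp l d w D m p a (A : 'M[K]_d) x b :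
  (d <= D)%N -> (w * 2 ^ l <= D)%N -> (2 * l * F D <= b)%N ->
  holds m p (A ^+ w) -> holds m a (kry w A x) ->
  runs m (kryp l d w p a) b
    (fun m' c => forall n, (n <= w * 2 ^ l)%N -> holds m' c (kry n A x)).
Proof.
elim: l w m p a b => [|l IH] w m p a b dD wD le_b pA aK /=.
  apply: runs_ret => n; rewrite expn0 muln1 => nw i j.
  by have := aK (widen_ord nw i) j; rewrite !mxE.
have wD' : (w <= D)%N.
  by apply: leq_trans wD; rewrite -{1}[w]muln1 leq_mul2l expn_gt0 orbT.
have wl : ((w + w) * 2 ^ l)%N = (w * 2 ^ l.+1)%N by rewrite expnS; lia.
have bE : (2 * l.+1 * F D = 2 * F D + 2 * l * F D)%N by lia.
rewrite bE in le_b.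
apply: (runs_bind (runs_mul wD' dD dD (leqnn _) aK pA)); first by lia.
move=> m1 c pre cE; refresh pre.
apply: (runs_bind (runs_mul dD dD dD (leqnn _) pA pA)); first by lia.
move=> m2 p2 pre2 p2E; refresh pre2.
rewrite -wl; apply: IH => //.
- by rewrite wl.
- by lia.
- by rewrite exprD -mulmxE.
- by rewrite kry_add; apply: holds_stack.
Qed.

Definition krylov (l d : nat) (p x : addrs) : comp K addrs := kryp l d 1 p x.

Lemma runs_krylov l d D m p a (A : 'M[K]_d) (x : 'rV[K]_d) b :
  (d <= D)%N -> (2 ^ l <= D)%N -> (2 * l * F D <= b)%N ->
  holds m p A -> holds m a x ->
  runs m (krylov l d p a) b
    (fun m' c => forall n, (n <= 2 ^ l)%N -> holds m' c (kry n A x)).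
Proof.
move=> dD lD le_b pA ax; have lD1 : (1 * 2 ^ l <= D)%N by rewrite mul1n.
have pA1 : holds m p (A ^+ 1) by rewrite expr1.
have aK : holds m a (kry 1 A x) by move=> i j; rewrite ord1 ax mxE mulmx1.
apply: (runs_weaken (runs_kryp dD lD1 le_b pA1 aK)) => // m' c _ cK n nl.
by apply: cK; rewrite mul1n.
Qed.

Fixpoint squares (l d : nat) (p : addrs) : comp K addrs :=
  if l is l'.+1 then let! p2 := mul d d d p p in squares l' d p2 else Ret K p.

Lemma runs_squares l d D m p (A : 'M[K]_d) b :
  (d <= D)%N -> (l * F D <= b)%N -> holds m p A ->
  runs m (squares l d p) b (fun m' c => holds m' c (A ^+ (2 ^ l))).
Proof.
elim: l m p A b => [|l IH] m p A b dD le_b pA /=; first exact: runs_ret.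
rewrite mulSn in le_b.
apply: (runs_bind (runs_mul dD dD dD (leqnn _) pA pA)); first by lia.
move=> m1 p2 pre p2E.
apply: (runs_weaken (IH _ _ _ (b - F D)%N dD _ p2E)) => //; first by lia.
by move=> m2 c _; rewrite mulmxE -expr2 -exprM -expnS.
Qed.

(** Doubling for several vectors; the rows are replaced by a basis at each step,
    so that their number stays at most d. *)
Fixpoint bkry (l d w : nat) (p u : addrs) : comp K (nat * addrs) :=
  if l is l'.+1 then
    let! v := mul w d d u p in
    let! (r, s, _) := rowbasep (w + w) d (stack w u v) in
    let! p2 := mul d d d p p in
    bkry l' d r p2 s
  else Ret K (w, u).

Lemma runs_bkry i l d h w D L m p a (A : 'M[K]_d) (U : 'M[K]_(h, d))
    (S : 'M[K]_(w, d)) b :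
  (4 * d <= D)%N -> (4 * w <= D)%N -> (0 < D)%N -> (D <= 2 ^ L)%N ->
  (l * (41 * L.+1 * F D + 5 * F D) <= b)%N ->
  holds m p (A ^+ (2 ^ i)) -> holds m a S -> krylov_upto A U i S ->
  runs m (bkry l d w p a) b
    (fun m' s => (4 * s.1 <= D)%N /\ exists2 S' : 'M[K]_(s.1, d),
       holds m' s.2 S' & krylov_upto A U (i + l) S').
Proof.
elim: l i w m p a S b => [|l IH] i w m p a S b dD wD D0 DL le_b pA aS kS /=.
  by apply: runs_ret; split=> //; exists S; rewrite ?addn0.
rewrite mulSn in le_b.
have dD' : (d <= D)%N by lia.
have wD' : (w <= D)%N by lia.
apply: (runs_bind (runs_mul wD' dD' dD' (leqnn _) aS pA)); first by lia.
move=> m1 v pre vE; refresh pre.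
have ww : (2 * (w + w) <= D)%N by lia.
have dd : (2 * d <= D)%N by lia.
apply: (runs_bind (runs_rowbasep ww dd D0 DL (leqnn _) (holds_stack aS vE))).
  by lia.
move=> m2 [[r s] t] pre2 [d2 [W [Wi [/= rd sW _ _ WS]]]]; refresh pre2.
apply: (runs_bind (runs_mul dD' dD' dD' (leqnn _) pA pA)); first by lia.
move=> m3 p2 pre3 p2E; refresh pre3.
apply: (runs_weaken (IH i.+1 r m3 p2 s (usubmx W) _ dD _ D0 DL (leqnn _) _ _ _)).
- by lia.
- by rewrite expnS mul2n -addnn exprD -mulmxE.
- by move=> k j; rewrite mxE -sW.
- exact: krylov_uptoS kS WS.
- by lia.
- by move=> m4 x _; rewrite addSnnS.
Qed.

(** * The cyclic vector program *)

Lemma ginv_spec_unit n (A : 'M[K]_n) m r : A \in unitmx ->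
  ginv_spec A m r -> holds m r.1.1 (invmx A).
Proof.
move=> Au [Z [zZ _ AZA]]; suff <- : Z = invmx A by [].
have := congr1 (fun X => invmx A *m X *m invmx A) AZA.
by rewrite !mulmxA mulVmx // !mul1mx mulmxK.
Qed.

Definition beside (d1 : nat) (a b : addrs) : addrs :=
  fun i j => if (j < d1)%N then a i j else b i (j - d1)%N.
Definition shift_cols (c : nat) (a : addrs) : addrs := fun i j => a i (c + j)%N.
Definition shift_rows (r : nat) (a : addrs) : addrs := fun i j => a (r + i)%N j.

Lemma holds_beside m p d1 d2 a b (A : 'M[K]_(p, d1)) (B : 'M[K]_(p, d2)) :
  holds m a A -> holds m b B -> holds m (beside d1 a b) (row_mx A B).
Proof.
move=> aA bB i j; rewrite /beside; case: (split_ordP j) => j' ->.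
  by rewrite row_mxEl /= ?ltn_ord.
by rewrite row_mxEr /= ?ltnNge ?leq_addr /= ?addKn.
Qed.

Lemma holds_lsub m p d1 d2 a (A : 'M[K]_(p, d1 + d2)) :
  holds m a A -> holds m a (lsubmx A).
Proof. by move=> aA i j; rewrite mxE -aA. Qed.

Lemma holds_rsub m p d1 d2 a (A : 'M[K]_(p, d1 + d2)) :
  holds m a A -> holds m (shift_cols d1 a) (rsubmx A).
Proof. by move=> aA i j; rewrite mxE -aA. Qed.

Lemma holds_usub m p1 p2 d a (A : 'M[K]_(p1 + p2, d)) :
  holds m a A -> holds m a (usubmx A).
Proof. by move=> aA i j; rewrite mxE -aA. Qed.

Lemma holds_dsub m p1 p2 d a (A : 'M[K]_(p1 + p2, d)) :
  holds m a A -> holds m (shift_rows p1 a) (dsubmx A).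
Proof. by move=> aA i j; rewrite mxE -aA. Qed.

Lemma holds_row m p d a (A : 'M[K]_(p, d)) (i : 'I_p) :
  holds m a A -> holds m (shift_rows i a) (row i A).
Proof. by move=> aA i' j; rewrite !ord1 mxE -aA /shift_rows /= addn0. Qed.

(** Computes the cyclic vector of [merge_generates]; row d2 of the Krylov matrix
    of (0, y) is the row (0, y) M^d2 used by [merge_defect]. *)
Definition mergep (d1 d2 : nat) (a x y : addrs) : comp K addrs :=
  let d := (d1 + d2)%N in
  let l := up_log 2 d1 in
  let! z := Emit (Cst 0) (@Ret K nat) in
  let! yk := krylov (up_log 2 d2.+1) d a (beside d1 (fun _ _ => z) y) in
  let r := shift_rows d2 yk in
  let! (g, _, _) := ginvp d2 d2 (shift_cols d1 yk) in
  let! t := mul 1 d2 d2 (shift_cols d1 r) g in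
  let! t := mul 1 d2 d1 t yk in
  let! w := subp 1 d1 r t in
  let! xk := krylov l d1 a x in
  let! wk := krylov l d1 a w in
  let! (g, _, _) := ginvp d1 d1 xk in
  let! e := mul d1 d1 d1 g wk in
  let! t := squares l d1 e in
  let! ss := mul d1 d1 d1 t t in
  let! (g, _, _) := ginvp d1 d1 ss in
  let! u := mul 1 d1 d1 x t in
  let! u := mul 1 d1 d1 u g in
  let! u := mul 1 d1 d1 u t in
  let! v := subp 1 d1 x u in
  Ret K (beside d1 v y).

Arguments mergep : simpl never.

Lemma runs_mergep d1 d2 D L m a x y (A1 : 'M[K]_d1) (B : 'M[K]_(d2, d1))
    (A2 : 'M[K]_d2) (X : 'rV[K]_d1) (Y : 'rV[K]_d2) b :
  (0 < d1)%N -> (0 < d2)%N -> (4 * (d1 + d2) <= D)%N -> (D <= 2 ^ L)%N ->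
  (140 * (L.+1 * F D) <= b)%N ->
  holds m a (block_mx A1 0 B A2) -> holds m x X -> holds m y Y ->
  nonderog (block_mx A1 0 B A2) -> generates A1 X -> generates A2 Y ->
  runs m (mergep d1 d2 a x y) b (fun m' c => exists2 Z : 'rV[K]_(d1 + d2),
    holds m' c Z & generates (block_mx A1 0 B A2) Z).
Proof.
case: d1 => // d1 in A1 B X *; case: d2 => // d2 in B A2 Y * => _ _.
set M := block_mx _ _ _ _ => dD DL le_b aM xX yY nd gX gY.
have dd : (d1.+1 + d2.+1 <= D)%N by lia.
have d1D : (d1.+1 <= D)%N by lia.
have d2D : (d2.+1 <= D)%N by lia.
have D1 : (2 * d1.+1 <= D)%N by lia.
have D2 : (2 * d2.+1 <= D)%N by lia.
have D0 : (0 < D)%N by lia.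
have D0' : (1 <= D)%N by lia.
set l := up_log 2 d1.+1; set l2 := up_log 2 d2.+2.
have lD : (2 ^ l <= D)%N by apply: pw_up_log.
have l2D : (2 ^ l2 <= D)%N by apply: pw_up_log => //; lia.
have lL : (l <= L)%N by rewrite -(@leq_exp2l 2) // (leq_trans lD).
have l2L : (l2 <= L)%N by rewrite -(@leq_exp2l 2) // (leq_trans l2D).
have dl : (d1.+1 <= 2 ^ l)%N by apply: up_logP.
have dl2 : (d2.+2 <= 2 ^ l2)%N by apply: up_logP.
set N := (L.+1 * F D)%N in le_b.
have FN : (F D <= 1 * N)%N by rewrite mul1n leq_pmull.
have kN k : (k <= L)%N -> (2 * k * F D <= 2 * N)%N.
  by move=> kL; rewrite -mulnA leq_mul2l /= leq_mul2r ltnW ?orbT // ltnS.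
have gN : (41 * L.+1 * F D <= 41 * N)%N by rewrite mulnA.
have sN : (l * F D <= 1 * N)%N by rewrite mul1n leq_mul2r ltnW ?orbT // ltnS.
apply: (runs_leq le_b); rewrite -[(140 * N)%N]addn0.
apply: (runs_bind_units (runs_cst _ _ (0 * _))) => // m1 z pre z0; refresh pre.
have y0E : holds m1 (beside d1.+1 (fun _ _ => z) y) (row_mx (0 : 'rV[K]_d1.+1) Y).
  by apply: holds_beside => // i j; rewrite mxE.
apply: (runs_bind_units (runs_krylov dd l2D (kN _ l2L) aM y0E)) => //.
move=> m2 yk pre2 ykE; refresh pre2.
have ykE2 := ykE d2.+1 (ltnW dl2).
have rE : holds m2 (shift_rows d2.+1 yk) (row_mx (0 : 'rV[K]_d1.+1) Y *m M ^+ d2.+1).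
  have := holds_row ord_max (ykE d2.+2 dl2).
  by rewrite row_kry.
clear ykE.
have y2u : rsubmx (kry d2.+1 M (row_mx (0 : 'rV[K]_d1.+1) Y)) \in unitmx.
  by rewrite kry_quotient kry_full.
apply: (runs_bind_units (runs_ginvp D2 D2 D0 DL gN
  (holds_rsub ykE2))) => //.
move=> m3 [[g si] sj] pre3 /(ginv_spec_unit y2u) /= gE; refresh pre3.
apply: (runs_bind_units (runs_mul D0' d2D d2D FN (holds_rsub rE) gE)) => //.
move=> m4 t pre4 tE; refresh pre4.
apply: (runs_bind_units (runs_mul D0' d2D d1D FN tE (holds_lsub ykE2))) => //.
move=> m5 t' pre5 {}tE; refresh pre5.
apply: (runs_bind_units (runs_subp D0' d1D FN (holds_lsub rE) tE)) => //.
move=> m6 w pre6 wE; refresh pre6.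
rewrite -[_ - _]/(merge_defect A1 B A2 Y) in wE.
have aA1 : holds m6 a A1.
  by have := holds_lsub (holds_usub aM); rewrite -/(ulsubmx _) block_mxKul.
apply: (runs_bind_units (runs_krylov d1D lD (kN _ lL) aA1 xX)) => //.
move=> m7 xk pre7 /(_ _ dl) xkE; refresh pre7.
apply: (runs_bind_units (runs_krylov d1D lD (kN _ lL) aA1 wE)) => //.
move=> m8 wk pre8 /(_ _ dl) wkE; refresh pre8.
apply: (runs_bind_units (runs_ginvp D1 D1 D0 DL gN xkE)) => //.
move=> m9 [[g' si'] sj'] pre9 /(ginv_spec_unit (kry_full gX)) /= g'E; refresh pre9.
apply: (runs_bind_units (runs_mul d1D d1D d1D FN g'E wkE)) => //.
move=> m10 e pre10 eE; refresh pre10.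
rewrite -[_ *m _]/(merge_endo A1 B A2 X Y) in eE.
apply: (runs_bind_units (runs_squares d1D sN eE)) => //.
move=> m11 s pre11 sE; refresh pre11.
apply: (runs_bind_units (runs_mul d1D d1D d1D FN sE sE)) => //.
move=> m12 ss pre12 ssE; refresh pre12.
apply: (runs_bind_units (runs_ginvp D1 D1 D0 DL gN ssE)) => //.
move=> m13 [[g2 si2] sj2] pre13 [G [/= g2E _ TGT]]; refresh pre13.
apply: (runs_bind_units (runs_mul D0' d1D d1D FN xX sE)) => //.
move=> m14 u pre14 uE; refresh pre14.
apply: (runs_bind_units (runs_mul D0' d1D d1D FN uE g2E)) => //.
move=> m15 u1 pre15 u1E; refresh pre15.
apply: (runs_bind_units (runs_mul D0' d1D d1D FN u1E sE)) => //.
move=> m16 u2 pre16 u2E; refresh pre16.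
apply: (runs_bind_units (runs_subp D0' d1D FN xX u2E)) => //.
move=> m17 v pre17 vE; refresh pre17.
apply: runs_ret; eexists; first exact: holds_beside vE yY.
refine (merge_generates nd gX gY dl TGT).
Qed.

(** [u] holds 2^k generating rows.  If the Krylov space of the first half is 0 or
    everything, one half of the rows already generates and nothing is split. *)
Fixpoint cyclicp (k d : nat) (a u : addrs) : comp K addrs :=
  if k is k'.+1 then
    let h := pw k' in
    let u2 := shift_rows h u in
    let! (w, s) := bkry (up_log 2 d) d h a u in
    let! (d1, b, bi) := rowbasep w d s in
    if d1 == 0%N then cyclicp k' d a u2
    else if d1 == d then cyclicp k' d a u
    else
      let d2 := (d - d1)%N in
      let! c := mul d d d b a in
      let! c := mul d d d c bi in
      let! v1 := mul h d d u bi in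
      let! v2 := mul h d d u2 bi in
      let! x := cyclicp k' d1 c v1 in
      let! y := cyclicp k' d2 (shift_rows d1 (shift_cols d1 c)) (shift_cols d1 v2) in
      let! z := mergep d1 d2 c x y in
      mul 1 d d z b
  else Ret K u.

(** Here 2^L bounds all dimensions padded on the way.  A node costs at most 300
    units (L + 1)^2 F(4 max(d, h)), for h half the number of rows.  The right-hand
    side absorbs it at each level since F is superadditive: the sizes of the two
    blocks add up to d and the numbers of rows to 2^k. *)
Lemma runs_cyclicp k d L m a u (A : 'M[K]_d) (U : 'M[K]_(pw k, d)) b :
  (4 * d <= 2 ^ L)%N -> (4 * pw k <= 2 ^ L)%N ->
  (300 * (L.+1 * L.+1) * (k.+1 * (F (4 * d) + F (4 * pw k))) <= b)%N ->
  holds m a A -> holds m u U -> nonderog A -> generates A U ->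
  runs m (cyclicp k d a u) b (fun m' c => exists2 Z : 'rV[K]_d,
    holds m' c Z & generates A Z).
Proof.
elim: k d m a u A U b => [|k IH] d m a u A U b dL kL le_b aA uU nd gU /=.
  by apply: runs_ret; exists U.
rewrite -[pw k.+1]/(pw k + pw k)%N in U kL le_b uU gU *.
set h := pw k in IH U kL le_b uU gU *.
have h0 : (0 < h)%N by rewrite /h pwE expn_gt0.
pose D := (4 * maxn d h)%N.
have D0 : (0 < D)%N by rewrite /D; lia.
have DL : (D <= 2 ^ L)%N by rewrite /D; lia.
have dD4 : (4 * d <= D)%N by rewrite /D; lia.
have hD4 : (4 * h <= D)%N by rewrite /D; lia.
have dD : (d <= D)%N by lia.
have hD : (h <= D)%N by lia.
have dD2 : (2 * d <= D)%N by lia.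
have oD : (1 <= D)%N by [].
set N := (L.+1 * L.+1 * F D)%N.
have N1 : (L.+1 * F D <= N)%N by rewrite leq_mul2r leq_pmulr ?orbT.
have FN : (F D <= 1 * N)%N by rewrite mul1n leq_pmull // muln_gt0.
pose c := (300 * (L.+1 * L.+1))%N.
pose S := (F (4 * d) + F (4 * (h + h)))%N.
have Fhh : (F (4 * h) + F (4 * h) <= F (4 * (h + h)))%N by rewrite mulnDr F_add.
have FDS : (F D <= S)%N.
  rewrite /S /D; case: (leqP d h) => _; lia.
have NS : (300 * N + c * (k.+1 * S) <= b)%N.
  apply: leq_trans le_b; rewrite -/S -/c (mulSn k.+1) mulnDr leq_add2r.
  by rewrite /N /c !mulnA leq_mul.
have le1 : (300 * N + c * (k.+1 * (F (4 * d) + F (4 * h))) <= b)%N.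
  apply: leq_trans NS; rewrite leq_add2l !leq_mul // /S leq_add2l; lia.
set l := up_log 2 d.
have dl : (d <= 2 ^ l)%N by apply: up_logP.
have lL : (l <= L)%N.
  by rewrite -(@leq_exp2l 2) // (leq_trans _ DL) // pw_up_log.
have bN : (l * (41 * L.+1 * F D + 5 * F D) <= 46 * N)%N.
  have : (l * (46 * (L.+1 * F D)) <= L.+1 * (46 * (L.+1 * F D)))%N.
    by rewrite leq_mul2r ltnW ?orbT // ltnS.
  have : (l * (41 * L.+1 * F D + 5 * F D) <= l * (46 * (L.+1 * F D)))%N.
    rewrite leq_mul2l; have : (F D <= L.+1 * F D)%N by rewrite leq_pmull.
    by lia.
  rewrite /N; lia.
have rN : (41 * L.+1 * F D + 3 * F D <= 44 * N)%N.
  by rewrite -mulnA; lia.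
have aA1 : holds m a (A ^+ (2 ^ 0)) by rewrite expn0 expr1.
apply: (runs_bind (runs_bkry dD4 hD4 D0 DL bN aA1
  (holds_usub uU) (krylov_upto0 _ _))); first by lia.
move=> m1 [w s] pre [/= wD [S' sS kS]]; refresh pre; rewrite add0n in kS.
have wD2 : (2 * w <= D)%N by lia.
apply: (runs_bind (runs_rowbasep wD2 dD2 D0 DL rN sS)).
  by lia.
move=> m2 [[d1 bw] bi] pre2 [d2 [W [Wi [/= dE bwW biWi WiW WS]]]]; refresh pre2.
have kW : krylov_upto A (usubmx U) l (usubmx W).
  by case: kS => U1 U2; split=> [i il|V UV AV]; rewrite WS; [apply: U1 | apply: U2].
have uU1 := holds_usub uU; have uU2 := holds_dsub uU.
have gU' : generates A (col_mx (usubmx U) (dsubmx U)) by rewrite vsubmxK.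
have [d10|d10] := eqVneq d1 0%N.
  have gU2 : generates A (dsubmx U).
    have [US _] := krylov_upto_stable dl kW.
    move=> V UV; apply: gU'; rewrite col_mx_sub UV andbT.
    apply: submx_trans US _; move: (usubmx W); rewrite d10 => W0.
    by rewrite flatmx0 sub0mx.
  apply: (runs_weaken (IH _ _ _ _ _ _ (b - 90 * N)%N _ _ _ _ uU2 nd gU2)) => //.
  - by lia.
  - by rewrite -/c -/h; lia.
  - by lia.
subst d.
case: eqP => [d1E|d12].
  have d20 : d2 = 0%N by lia.
  have gU1 : generates A (usubmx U).
    case: kW => _ Wmin V UV AV; apply: submx_trans (Wmin V UV AV).
    rewrite -WiW; apply: submx_trans (submxMl _ _) _.
    clear -d20; subst d2; rewrite -{1}[W]vsubmxK.
    by rewrite col_mx_sub submx_refl flatmx0 sub0mx.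
  apply: (runs_weaken (IH _ _ _ _ _ _ (b - 90 * N)%N _ _ _ _ uU1 nd gU1)) => //.
  - by lia.
  - by rewrite -/c -/h; lia.
  - by lia.
have d1_gt0 : (0 < d1)%N by rewrite lt0n.
have d2_gt0 : (0 < d2)%N by lia.
rewrite addKn; have WWi : W *m Wi = 1%:M := mulmx1C WiW.
pose b1 := (c * (k.+1 * (F (4 * d1) + F (4 * h))))%N.
pose b2 := (c * (k.+1 * (F (4 * d2) + F (4 * h))))%N.
have le2 : (300 * N + b1 + b2 <= b)%N.
  apply: leq_trans NS; rewrite -addnA leq_add2l /b1 /b2 -mulnDr -mulnDr.
  rewrite !leq_mul // /S; have := F_add (4 * d1) (4 * d2).
  rewrite -mulnDr; lia.
(* 46 + 44 of the 300 units are spent; the rest pays the products and the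
   gluing *)
have {}le2 : (210 * N + (b1 + (b2 + 0)) <= b - 46 * N - 44 * N)%N by lia.
apply: (runs_leq le2).
apply: (runs_bind_units (runs_mul dD dD dD FN bwW aA)) => //.
move=> m3 c1 pre3 c1E; refresh pre3.
apply: (runs_bind_units (runs_mul dD dD dD FN c1E biWi)) => //.
move=> m4 c2 pre4 c2E; refresh pre4; clear c1E.
apply: (runs_bind_units (runs_mul hD dD dD FN uU1 biWi)) => //.
move=> m5 v1 pre5 v1E; refresh pre5.
apply: (runs_bind_units (runs_mul hD dD dD FN uU2 biWi)) => //.
move=> m6 v2 pre6 v2E; refresh pre6.
set A' := W *m A *m Wi in c2E.
have nd' : nonderog A' by apply: nonderog_conj.
have Ablock := split_block WWi dl kW.
have gl := split_generates_l WWi dl kW.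
have gr := split_generates_r WWi dl kW gU'.
rewrite -/A' in Ablock gl gr.
have nd1 : nonderog (ulsubmx A').
  move: nd'; rewrite {1}Ablock.
  move: (ulsubmx A') (dlsubmx A') (drsubmx A'); clear -d1_gt0 d2_gt0 => A1 A2 A3.
  by case: d1 d2 d1_gt0 d2_gt0 A1 A2 A3 => [|d1] [|d2] // _ _ A1 A2 A3;
    apply: nonderog_ul.
have nd2 : nonderog (drsubmx A').
  move: nd'; rewrite {1}Ablock.
  move: (ulsubmx A') (dlsubmx A') (drsubmx A'); clear -d1_gt0 d2_gt0 => A1 A2 A3.
  by case: d1 d2 d1_gt0 d2_gt0 A1 A2 A3 => [|d1] [|d2] // _ _ A1 A2 A3;
    apply: nonderog_dr.
apply: (runs_bind_rest (IH d1 _ _ _ _ _ b1 _ _ (leqnn _) (holds_lsub (holds_usub c2E))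
  (holds_lsub v1E) nd1 gl)).
- by lia.
- by lia.
move=> m7 x pre7 [X xX gX]; refresh pre7.
apply: (runs_bind_rest (IH d2 _ _ _ _ _ b2 _ _ (leqnn _) _ (holds_rsub v2E) nd2 gr)).
- by lia.
- by lia.
- exact: holds_rsub (holds_dsub c2E).
move=> m8 y pre8 [Y yY gY]; refresh pre8.
rewrite Ablock in c2E nd'.
have N140 : (140 * (L.+1 * F D) <= 140 * N)%N by rewrite leq_mul2l.
apply: (runs_bind_units (runs_mergep d1_gt0 d2_gt0 dD4 DL
  N140 c2E xX yY nd' gX gY)) => //.
move=> m9 z pre9 [Z zZ gZ]; refresh pre9.
apply: (runs_weaken (runs_mul oD dD dD FN zZ bwW)).
  by rewrite addn0 leq_mul2r orbT.
move=> m10 r _ rE; exists (Z *m W) => //.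
by apply: generates_conj WWi _; rewrite -/A' Ablock.
Qed.

(** * The factorization program *)

Lemma onth_allpairs S T R (f : S -> T -> R) (s : seq S) (t : seq T) x0 y0 i j :
  (i < size s)%N -> (j < size t)%N ->
  onth [seq f x y | x <- s, y <- t] (i * size t + j) =
  Some (f (nth x0 s i) (nth y0 t j)).
Proof.
elim: s i => // x s IH [|i] /= il jl.
  by rewrite onth_cat size_map jl onthE -map_comp (nth_map y0).
rewrite onth_cat size_map mulSn -addnA ltnNge leq_addr /= addKn.
exact: IH.
Qed.

Definition input_addr (n : nat) : addrs := fun i j => (i * n + j)%N.

Lemma holds_input n (M : 'M[K]_n) : holds (mx_input M) (input_addr n) M.
Proof.
move=> i j; have := @onth_allpairs _ _ _ (fun i j => M i j) (enum 'I_n) (enum 'I_n) i j i j.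
by rewrite size_enum_ord !nth_ord_enum => ->.
Qed.

(** The coefficient k of a monic polynomial of degree n, the lower ones being
    given by [c]. *)
Definition monic_addr (n : nat) (c : addrs) (o0 o1 k : nat) : nat :=
  if (k < n)%N then c 0%N k else if k == n then o1 else o0.

Definition factorp (n : nat) : comp K (seq nat * 'M[nat]_n * 'M[nat]_n * seq nat) :=
  let k := up_log 2 n in
  let a := input_addr n in
  let! u := opmx (pw k) n (fun i j => Cst (i == j)%:R) in
  let! r := cyclicp k n a u in
  let! rk := krylov (up_log 2 n.+1) n a r in
  let! (ri, _, _) := ginvp n n rk in
  let! c := mul 1 n n (shift_rows n rk) ri in
  let! z := opmx 1 n (fun _ _ => Cst 0) in
  let! c := subp 1 n z c in
  let! o0 := Emit (Cst 0) (@Ret K nat) in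
  let! o1 := Emit (Cst 1) (@Ret K nat) in
  let coef := monic_addr n c o0 o1 in
  let! h := mul n n n (fun i j => coef (i + j + 1)%N) rk in
  Ret K ([:: o1], \matrix_(i, j) ri i j, \matrix_(i, j) h j i,
         [seq coef k | k <- iota 0 n.+1]).

(** The unit is (k + 3)^3 F(4 * 2^k) with k = up_log 2 n: 600 units go to the
    cyclic vector and less than 50 to the rest. *)
Definition factor_cost (n : nat) : nat :=
  (1000 * (up_log 2 n).+3 ^ 3 * F (4 * 2 ^ up_log 2 n))%N.

Lemma generates_pid n N (M : 'M[K]_n) : (n <= N)%N ->
  generates M (pid_mx n : 'M[K]_(N, n)).
Proof.
move=> nN V UV _; apply: submx_trans UV.
by apply/submxP; exists (pid_mx n); rewrite pid_mxK.
Qed.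

Lemma runs_factorp n (M : 'M[K]_n) : nonderog M ->
  runs (mx_input M) (factorp n) (factor_cost n) (fun m s =>
    let '(a, p, q, x) := s in
    [/\ read_mx m p \in unitmx /\ read_mx m q \in unitmx,
        read_poly m x = char_poly M
      & comatrix_factorization M (read_poly m a) (read_mx m p) (read_mx m q)]).
Proof.
move=> nd; rewrite /factorp /factor_cost; set k := up_log 2 n.
have nk : (n <= pw k)%N by rewrite pwE up_logP.
have k0 : (0 < pw k)%N by rewrite pwE expn_gt0.
pose D := (4 * pw k)%N; rewrite -(pwE k) -/D.
pose L := k.+2.
have DL : (D <= 2 ^ L)%N by rewrite /D pwE -[4%N]/(2 ^ 2)%N -expnD.
have D0 : (0 < D)%N by rewrite /D; lia.
have oD : (1 <= D)%N by [].
have nD : (n <= D)%N by rewrite /D; lia.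
have kD : (pw k <= D)%N by rewrite /D; lia.
have nD2 : (2 * n <= D)%N by rewrite /D; lia.
set l := up_log 2 n.+1.
have nl : (n.+1 <= 2 ^ l)%N by apply: up_logP.
have lD : (2 ^ l <= D)%N by apply: pw_up_log => //; rewrite /D; lia.
have lL : (l <= L)%N by rewrite -(@leq_exp2l 2) // (leq_trans lD).
pose N := (L.+1 ^ 3 * F D)%N.
have L3 : (L.+1 <= L.+1 ^ 3)%N by rewrite -{1}[L.+1]expn1 leq_pexp2l.
have LN : (L.+1 * F D <= N)%N by rewrite leq_mul2r L3 orbT.
have FN : (F D <= 1 * N)%N by rewrite mul1n; apply: leq_trans LN; rewrite leq_pmull.
rewrite -mulnA -[(k.+3 ^ 3 * F D)%N]/N.
have le_cyc : (300 * (L.+1 * L.+1) * (k.+1 * (F (4 * n) + F (4 * pw k))) <= 600 * N)%N.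
  have Fn : (F (4 * n) <= F D)%N by apply: F_mono; rewrite /D; lia.
  rewrite -/D /N !expnS expn0 muln1.
  have -> : (600 * (L.+1 * (L.+1 * L.+1) * F D) =
      300 * (L.+1 * L.+1) * (L.+1 * (F D + F D)))%N by lia.
  by rewrite leq_mul2l leq_mul ?orbT // ?leq_add2r // /L; lia.
have lN : (2 * l * F D <= 2 * N)%N.
  rewrite -mulnA leq_mul2l /=; apply: leq_trans LN.
  by rewrite leq_mul2r ltnW ?orbT // ltnS.
have gN : (41 * L.+1 * F D <= 41 * N)%N by rewrite -mulnA leq_mul2l.
rewrite -[(1000 * N)%N]addn0.
have aM := holds_input M; set m0 := mx_input M in aM *.
apply: (runs_bind_units (runs_cstmx m0 (p := pw k) (q := n) _ (leq_trans (mul_F kD nD) FN))) => //.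
move=> m1 u pre uE; refresh pre.
have {}uE : holds m1 u (pid_mx n : 'M[K]_(pw k, n)).
  by move=> i j; rewrite uE !mxE; case: eqP => // ->; rewrite ltn_ord.
have n4 : (4 * n <= 2 ^ L)%N by apply: leq_trans DL; rewrite /D; lia.
apply: (runs_bind_units (runs_cyclicp n4 DL le_cyc
  aM uE nd (generates_pid nk))) => //.
move=> m2 r pre2 [R rR gR]; refresh pre2.
apply: (runs_bind_units (runs_krylov nD lD lN aM rR)) => //.
move=> m3 rk pre3 rkE; refresh pre3.
have rkE' := rkE n (ltnW nl).
have rnE : holds m3 (shift_rows n rk) (R *m M ^+ n).
  by have := holds_row ord_max (rkE n.+1 nl); rewrite row_kry.
clear rkE; have Ru := kry_full gR.
apply: (runs_bind_units (runs_ginvp nD2 nD2 D0 DL gN rkE')) => //.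
move=> m4 [[ri si] sj] pre4 /(ginv_spec_unit Ru) /= riE; refresh pre4.
apply: (runs_bind_units (runs_mul oD nD nD FN rnE riE)) => //.
move=> m5 c pre5 cE; refresh pre5.
apply: (runs_bind_units (runs_cstmx m5 (p := 1) (q := n) (fun _ _ => 0) (leq_trans (mul_F oD nD) FN))) => //.
move=> m6 z pre6 zE; refresh pre6.
apply: (runs_bind_units (runs_subp oD nD FN zE cE)) => //.
move=> m7 c' pre7 {}cE; refresh pre7.
apply: (runs_bind_units (runs_cst _ _ (0 * _))) => // m8 o0 pre8 o0E; refresh pre8.
apply: (runs_bind_units (runs_cst _ _ (0 * _))) => // m9 o1 pre9 o1E; refresh pre9.
set coef := monic_addr n c' o0 o1.
have coefE m i : prefix m9 m -> onth m (coef i) = Some (char_poly M)`_i.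
  move=> prem; rewrite /coef /monic_addr; case: ltngtP => [ltin|gtin|->].
  - have := prefix_onth prem (cE 0 (Ordinal ltin)) => /= ->; congr Some.
    have := char_poly_kry Ru (Ordinal ltin); rewrite /= !mxE => ->.
    by rewrite sub0r opprK.
  - by rewrite (prefix_onth prem o0E) nth_default // size_char_poly.
  - rewrite (prefix_onth prem o1E); congr Some.
    have := monicP (char_poly_monic M).
    by rewrite lead_coefE size_char_poly.
have hkE : holds m9 (fun i j => coef (i + j + 1)%N) (hankel n (char_poly M)).
  by move=> i j; rewrite coefE ?prefix_refl // /hankel mxE.
apply: (runs_bind_units (runs_mul nD nD nD FN hkE rkE')) => //.
move=> m10 h pre10 hE; have pre' := pre10; refresh pre10.
apply: runs_ret.
have -> : read_mx m10 (\matrix_(i, j) ri i j) = invmx (kry n M R).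
  by apply/matrixP => i j; rewrite !mxE (onth_val (riE i j)).
have -> : read_mx m10 (\matrix_(i, j) h j i) = (hankel n (char_poly M) *m kry n M R)^T.
  by apply/matrixP => i j; rewrite !mxE (onth_val (hE j i)) mxE.
have -> : read_poly m10 [:: o1] = 1.
  apply/polyP => i; rewrite /read_poly coef_Poly coef1.
  by case: i => [|[|i]] //=; rewrite (onth_val o1E).
split; first split.
- by rewrite unitmx_inv.
- rewrite unitmx_tr unitmx_mul Ru andbT.
  by apply: hankel_unit; rewrite ?char_poly_monic ?size_char_poly.
- rewrite /read_poly; set ks := iota 0 n.+1.
  have -> : [seq m10`_i | i <- [seq coef i | i <- ks]] =
            [seq m10`_(coef i) | i <- ks] by rewrite -map_comp.
  apply/polyP => i; rewrite /ks coef_Poly.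
  have [ltin|gein] := ltnP i n.+1.
    rewrite (nth_map 0%N) ?size_iota // nth_iota // add0n /=.
    exact/onth_val/coefE.
  by rewrite !nth_default ?size_map ?size_iota ?size_char_poly.
- exact: comatrix_factorization_kry.
Qed.
End FastLinearAlgebra.

(** * Matrix multiplication costs at least n^2, and regular cost bounds *)

Section SlpRuns.
Variable A : nzRingType.

Lemma size_slp_run (m : seq A) s : size (slp_run m s) = (size m + size s)%N.
Proof.
elim: s m => [|o s IH] m /=; first by rewrite addn0.
by rewrite -[slp_run _ _]/(slp_run (rcons m _) s) IH size_rcons addSnnS.
Qed.

Lemma nth_slp_run (m : seq A) s p : (p < size m)%N -> (slp_run m s)`_p = m`_p.
Proof.
elim: s m => [|o s IH] m //= pm.
rewrite -[slp_run _ _]/(slp_run (rcons m _) s) IH ?size_rcons ?leqW //.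
by rewrite nth_rcons pm.
Qed.

Lemma nth_slp_run_cst (m : seq A) s t x : (t < size s)%N ->
  nth (Defs.Add 0 0) s t = Cst x -> (slp_run m s)`_(size m + t) = x.
Proof.
elim: s m t => [|o s IH] m [|t] //= ts e;
  rewrite -[slp_run _ _]/(slp_run (rcons m _) s).
  rewrite nth_slp_run ?addn0 ?size_rcons //.
  by rewrite nth_rcons ltnn eqxx e.
by rewrite addnS -addSn -(size_rcons m (ring_op_eval m o)); apply: IH.
Qed.

Lemma slp_cost_count (s : seq (ring_op A)) :
  slp_cost s = count (fun o => (0 < ring_op_cost o)%N) s.
Proof. by rewrite /slp_cost; elim: s => //= o s ->; case: o. Qed.

Lemma size_mx_input n (M : 'M[A]_n) : size (mx_input M) = (n * n)%N.
Proof. by rewrite size_allpairs size_enum_ord. Qed.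

(** For each pair (i, j) some inputs give the entry (i, j) the value 1 and every
    other entry the value 0; so the n^2 outputs have distinct addresses.  Neither
    an input nor a constant can be an output, as the product vanishes when either
    factor does. *)
Lemma matmul_cost_ge n (s : seq (ring_op A)) (out : 'M[nat]_n) :
  (forall B C : 'M[A]_n,
     read_mx (slp_run (mx_input B ++ mx_input C) s) out = B *m C) ->
  (n * n <= slp_cost s)%N.
Proof.
move=> sP; pose inp (B C : 'M[A]_n) := mx_input B ++ mx_input C.
pose sz := (n * n + n * n)%N.
have sinp B C : size (inp B C) = sz by rewrite size_cat !size_mx_input.
have val B C i j : (slp_run (inp B C) s)`_(out i j) = (B *m C) i j.
  by rewrite -sP mxE.
have val1 i j : (slp_run (inp (delta_mx i i) (delta_mx i j)) s)`_(out i j) = 1.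
  by rewrite val mul_delta_mx mxE !eqxx.
have n10 : (1 : A) != 0 := oner_neq0 A.
pose P t := (0 < ring_op_cost (nth (Defs.Add 0 0) s t))%N.
have addrP i j : exists2 t, (t < size s)%N && P t & out i j = (sz + t)%N.
  have lt_out : (out i j < sz + size s)%N.
    rewrite ltnNge; apply/negP => ge_out; have := val1 i j.
    by rewrite nth_default ?size_slp_run ?sinp // => /esym/eqP; apply/negP.
  have ge_out : (sz <= out i j)%N.
    rewrite leqNgt; apply/negP => lt_in; have := val1 i j.
    have [lt1|ge1] := ltnP (out i j) (n * n).
      have := val (delta_mx i i) 0 i j; rewrite mulmx0 mxE => <-.
      rewrite !nth_slp_run ?sinp // !nth_cat !size_mx_input lt1 => e.
      move: (val1 i j) (val (delta_mx i i) 0 i j).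
      rewrite mulmx0 mxE !nth_slp_run ?sinp // !nth_cat !size_mx_input lt1 => -> /eqP.
      exact/negP.
    move=> _; move: (val1 i j) (val 0 (delta_mx i j) i j).
    rewrite mul0mx mxE !nth_slp_run ?sinp // !nth_cat !size_mx_input.
    by rewrite ltnNge ge1 /= => -> /eqP; apply/negP.
  have lt_t : (out i j - sz < size s)%N by lia.
  exists (out i j - sz)%N; last by rewrite subnKC.
  rewrite lt_t /P; case e : (nth _ _ _) => [x|||] //=; exfalso.
  have v B C : (slp_run (inp B C) s)`_(out i j) = x.
    rewrite -{1}(subnKC ge_out) -{1}(sinp B C).
    exact: nth_slp_run_cst e.
  move: (val1 i j) (val 0 0 i j); rewrite !v mul0mx mxE => -> /eqP.
  exact/negP.
pose addrs : seq nat := [seq out ij.1 ij.2 | ij <- enum {: 'I_n * 'I_n}].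
have uaddrs : uniq addrs.
  rewrite map_inj_uniq ?enum_uniq // => -[i j] [i' j'] /= eo.
  have := val1 i j; rewrite eo val mul_delta_mx mxE.
  by case: eqP => [->|_] /=; first case: eqP => [->|_] //=;
    move=> /esym/eqP; rewrite (negPf n10).
have := uniq_leq_size (s2 := [seq (sz + t)%N | t <- iota 0 (size s) & P t]) uaddrs.
rewrite size_map -cardE card_prod card_ord => le_size.
apply: leq_trans (le_size _) _.
  move=> _ /mapP[[i j] _ ->] /=; have [t /andP[ts Pt] ->] := addrP i j.
  by apply: map_f; rewrite mem_filter Pt mem_iota.
rewrite size_map size_filter slp_cost_count -[s in X in (_ <= X)%N](mkseq_nth (Defs.Add 0 0)).
by rewrite count_map.
Qed.
End SlpRuns.

Section CostFunction.
Variable mm : nat -> nat.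

(** n^2 h(n) with h nondecreasing, large enough to dominate [mm] at positive
    sizes. *)
Definition regular_cost (n : nat) : nat :=
  (n * n * (\max_(i < n.+1) (mm i %/ (i * i))).+1)%N.

Let h n := (\max_(i < n.+1) (mm i %/ (i * i))).+1.

Let h_mono n n' : (n <= n')%N -> (h n <= h n')%N.
Proof.
move=> nn'; rewrite ltnS; apply/bigmax_leqP => i _.
have lt_i : (i < n'.+1)%N by apply: leq_trans (ltn_ord i) _.
exact: (leq_bigmax (Ordinal lt_i)).
Qed.

Lemma regular_cost_ge n : (0 < n)%N -> (mm n <= regular_cost n)%N.
Proof.
move=> n0; have nn0 : (0 < n * n)%N by rewrite muln_gt0 n0.
have le_h : (mm n %/ (n * n) < h n)%N.
  by rewrite ltnS; apply: (leq_bigmax (ord_max : 'I_n.+1)).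
apply: ltnW; rewrite /regular_cost mulnC -ltn_divLR //.
Qed.

Lemma regular_cost_sq n : (n * n <= regular_cost n)%N.
Proof. by rewrite leq_pmulr. Qed.

Lemma regular_cost_mono n n' : (n <= n')%N -> (regular_cost n <= regular_cost n')%N.
Proof. by move=> nn'; rewrite leq_mul ?leq_mul ?h_mono. Qed.

Lemma regular_cost_add n n' :
  (regular_cost n + regular_cost n' <= regular_cost (n + n'))%N.
Proof.
apply: (@leq_trans ((n * n + n' * n') * h (n + n'))%N).
  by rewrite mulnDl leq_add // leq_mul2l h_mono ?orbT ?leq_addr ?leq_addl.
rewrite leq_mul2r; apply/orP; right; lia.
Qed.

Lemma regular_cost_quad n : (4 * regular_cost n <= regular_cost (n + n))%N.
Proof.
apply: (@leq_trans (4 * (n * n) * h (n + n))%N).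
  by rewrite -mulnA leq_mul2l /= leq_mul2l h_mono ?orbT ?leq_addr.
rewrite leq_mul2r; apply/orP; right; lia.
Qed.
End CostFunction.

(** * Asymptotic estimates *)

Section Asymptotics.
Local Open Scope classical_set_scope.
Local Open Scope ring_scope.
Variables (R : realType) (omega : R) (mm : nat -> nat).
Hypothesis mmO : (fun n : nat => (mm n)%:R : R) =O_\oo (fun n : nat => (n%:R : R) `^ omega).
Hypothesis mm_ge : forall n, (0 < n)%N -> (n * n <= mm n)%N.

Let mm_bound : exists2 C : R, 0 <= C & exists n0 : nat, forall n : nat, (n0 <= n)%N ->
  (mm n)%:R <= C * n%:R `^ omega.
Proof.
have /eqOP[k0 [_ kP]] := mmO; pose C := Num.max 0 k0 + 1.
have Ck : k0 < C by rewrite /C ltr_pwDr // le_max lexx orbT.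
have C0 : 0 <= C by rewrite addr_ge0 // le_max lexx.
have [n0 _ nP] := kP C Ck; exists C => //; exists n0 => n /nP /=.
by rewrite ger0_norm // ger0_norm // powR_ge0.
Qed.

(** Otherwise n^(2 - omega) would be bounded. *)
Lemma matmul_exponent_ge2 : 2%:R <= omega.
Proof.
have [C C0 [n0 CP]] := mm_bound; rewrite leNgt; apply/negP => om2.
pose e := 2%:R - omega; have e0 : 0 < e by rewrite subr_gt0.
pose x := (C + 1) `^ e^-1.
have x0 : 0 <= x by apply: powR_ge0.
pose n := (maxn n0 (Num.truncn x).+1).
have n_gt0 : (0 < n)%N by rewrite /n; lia.
have xn : x <= n%:R.
  apply: ltW; apply: lt_le_trans (truncnS_gt x) _.
  by rewrite ler_nat leq_maxr.
have nR0 : (0 : R) < n%:R by rewrite ltr0n.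
have : (n%:R : R) `^ e <= C.
  have : (n * n)%:R <= C * (n%:R : R) `^ omega.
    by apply: le_trans (CP n (leq_maxl _ _)); rewrite ler_nat mm_ge.
  have -> : ((n * n)%:R : R) = n%:R `^ e * n%:R `^ omega.
    rewrite -powRD; last by rewrite pnatr_eq0 -lt0n n_gt0 implybT.
    by rewrite subrK powR_mulrn ?ltW // natrM expr2.
  by rewrite ler_pM2r // powR_gt0.
apply/negP; rewrite -ltNge; apply: (@lt_le_trans _ _ (x `^ e)).
  by rewrite /x -powRrM mulVf ?gt_eqF // powRr1 ?ltrDl // addr_ge0.
by apply: ge0_ler_powR; rewrite ?nnegrE // ltW.
Qed.

(** h(n) exceeds a constant only through terms mm(i) / i^2 <= C i^(omega - 2), which
    are at most C n^(omega - 2) as omega >= 2. *)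
Lemma regular_cost_bound : exists2 C : R, 0 <= C & forall n : nat, (0 < n)%N ->
  (regular_cost mm n)%:R <= C * n%:R `^ omega.
Proof.
have [C C0 [n0 CP]] := mm_bound; have om2 := matmul_exponent_ge2.
pose c0 := (\sum_(i < n0) mm i)%N.
exists (1 + c0%:R + C) => [|n n_gt0]; first by rewrite !addr_ge0.
have nR0 : (0 : R) < n%:R by rewrite ltr0n.
have n1 : (1 : R) <= n%:R by rewrite ler1n.
pose p := (n%:R : R) `^ (omega - 2).
have p1 : 1 <= p by rewrite -(powRr0 n%:R) ler_powR // subr_ge0.
have pE : n%:R `^ omega = (n * n)%:R * p.
  rewrite natrM -expr2 -powR_mulrn ?ler0n // -powRD ?pnatr_eq0 -?lt0n ?n_gt0 ?implybT //.
  by rewrite addrC subrK.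
have hb : ((\max_(i < n.+1) (mm i %/ (i * i)))%:R : R) <= c0%:R + C * p.
  pose m := (\max_(i < n.+1) (mm i %/ (i * i)))%N.
  have [i _ mE] : exists2 i : 'I_n.+1, true & m = (mm i %/ (i * i))%N.
    have I0 : (0 < #|'I_n.+1|)%N by rewrite card_ord.
    have [i mi] := bigop.eq_bigmax (fun i : 'I_n.+1 => (mm i %/ (i * i))%N) I0.
    by exists i.
  rewrite -/m mE; have [i_lt|i_ge] := ltnP i n0.
    apply: (@le_trans _ _ c0%:R); last by rewrite lerDl mulr_ge0 // ltW // (lt_le_trans _ p1).
    rewrite ler_nat; apply: leq_trans (leq_div _ _) _.
    by rewrite /c0 (bigD1 (Ordinal i_lt)) //= leq_addr.
  apply: (@le_trans _ _ (C * p)); last by rewrite lerDr ler0n.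
  case: (posnP i) => [->|i0]; first by rewrite muln0 divn0 mulr_ge0 // powR_ge0.
  have iR0 : (0 : R) < (i : nat)%:R by rewrite ltr0n.
  have ii0 : (0 : R) < (i * i)%:R by rewrite ltr0n muln_gt0 i0.
  rewrite -(ler_pM2r ii0) -natrM.
  apply: le_trans (_ : (mm i)%:R <= _); first by rewrite ler_nat leq_trunc_div.
  apply: le_trans (CP i i_ge) _; rewrite -mulrA; apply: ler_wpM2l => //.
  have -> : (i : nat)%:R `^ omega = (i : nat)%:R `^ (omega - 2) * (i * i)%:R.
    rewrite natrM -expr2 -powR_mulrn ?ler0n // -powRD ?pnatr_eq0 -?lt0n ?i0 ?implybT //.
    by rewrite subrK.
  rewrite ler_pM2r //; apply: ge0_ler_powR; rewrite ?nnegrE ?subr_ge0 ?ler0n //.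
  by rewrite ler_nat -ltnS ltn_ord.
rewrite /regular_cost natrM -addn1 natrD pE mulrCA; apply: ler_wpM2l => //.
rewrite mulrDl; apply: (@le_trans _ _ (c0%:R + C * p + 1)); first by rewrite lerD2r.
rewrite addrAC lerD2r addrC ler_peMr // addr_ge0 //.
Qed.
End Asymptotics.

Section SoftO.
Variables (R : realType) (omega C : R) (F : nat -> nat).
Hypothesis C0 : 0 <= C.
Hypothesis FC : forall n : nat, (0 < n)%N -> (F n)%:R <= C * n%:R `^ omega.
Hypothesis F_mono : forall N N', (N <= N')%N -> (F N <= F N')%N.
Hypothesis omega0 : 0 <= omega.

Lemma ln_ge1_gt1 (n : nat) : 1 <= ln (n%:R : R) -> (1 < n)%N.
Proof.
move=> lnn1; rewrite ltnNge; apply/negP => n1.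
have : ln (n%:R : R) <= 0 by rewrite ln_le0 // lern1.
by move/(le_trans lnn1); rewrite ler10.
Qed.

Lemma up_log_ln_bound (n : nat) : 1 <= ln (n%:R : R) ->
  (up_log 2 n).+3%:R <= ((ln (2%:R : R))^-1 + 4%:R) * ln (n%:R : R).
Proof.
move=> lnn1; have ln2 : 0 < ln (2%:R : R) by rewrite ln_gt0 // ltr1n.
have n1 := ln_ge1_gt1 lnn1.
have nR : (0 : R) < n%:R by rewrite ltr0n ltnW.
have l0 : (0 < up_log 2 n)%N by rewrite up_log_gt0 n1.
have : ln (2%:R : R) *+ (up_log 2 n).-1 <= ln (n%:R : R).
  rewrite -lnXn // ler_ln ?posrE ?exprn_gt0 // -natrX ler_nat ltnW //.
  exact: up_log_gtn.
rewrite -[X in X <= _]mulr_natl -ler_pdivlMr // => le_l.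
have -> : ((up_log 2 n).+3%:R : R) = (up_log 2 n).-1%:R + 4%:R.
  by rewrite -natrD; congr (_%:R); lia.
rewrite mulrDl [_^-1 * _]mulrC lerD // -[X in X <= _]mulr1 ler_wpM2l //.
Qed.

Lemma factor_cost_softO :
  softO (fun n => (factor_cost F n)%:R : R) (fun n => (n%:R : R) `^ omega).
Proof.
exists 3%N; apply/eqOP.
pose c := (ln (2%:R : R))^-1 + 4%:R.
pose B := 1000%:R * c ^+ 3 * (C * 8%:R `^ omega).
have ln2 : 0 < ln (2%:R : R) by rewrite ln_gt0 // ltr1n.
have c0 : 0 <= c by rewrite addr_ge0 // invr_ge0 ltW.
exists B; split; first exact: num_real.
move=> k Bk; near=> n.
have n3 : expR 1 <= (n%:R : R).
  near: n; exists (Num.truncn (expR 1 : R)).+1 => // n /= le_n.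
  by apply: ltW; apply: lt_le_trans (truncnS_gt _) _; rewrite ler_nat.
have nR : (0 : R) < n%:R by apply: lt_le_trans n3; apply: expR_gt0.
have n0 : (0 < n)%N by rewrite -(ltr0n R).
have lnn1 : 1 <= ln (n%:R : R).
  by rewrite -[X in X <= _]expRK ler_ln // posrE // expR_gt0.
have n1 := ln_ge1_gt1 lnn1.
rewrite ger0_norm // ger0_norm; last first.
  by rewrite mulr_ge0 ?powR_ge0 // exprn_ge0 // (le_trans _ lnn1).
have g0 : 0 <= (n%:R : R) `^ omega * ln (n%:R : R) ^+ 3.
  by rewrite mulr_ge0 ?powR_ge0 // exprn_ge0 // (le_trans _ lnn1).
apply: (@le_trans _ _ (B * (n%:R `^ omega * ln (n%:R : R) ^+ 3))); last first.
  by rewrite ler_wpM2r // ltW.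
have FB : (F (4 * 2 ^ up_log 2 n))%:R <= C * 8%:R `^ omega * (n%:R : R) `^ omega.
  have le8 : (4 * 2 ^ up_log 2 n <= 8 * n)%N.
    have := up_log_gtn (isT : (1 < 2)%N) n1.
    have : (0 < up_log 2 n)%N by rewrite up_log_gt0 n1.
    by case: (up_log 2 n) => // l _ /=; rewrite expnS; lia.
  apply: (@le_trans _ _ (F (8 * n))%:R); first by rewrite ler_nat F_mono.
  apply: le_trans (FC _) _; first by rewrite muln_gt0 n0.
  by rewrite natrM powRM // mulrA.
rewrite /factor_cost natrM natrM natrX /B.
have lB := up_log_ln_bound lnn1.
have l3 : ((up_log 2 n).+3%:R : R) ^+ 3 <= c ^+ 3 * ln (n%:R : R) ^+ 3.
  by rewrite -exprMn; apply: lerXn2r; rewrite ?nnegrE // mulr_ge0 // (le_trans _ lnn1).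
have -> : 1000%:R * c ^+ 3 * (C * 8 `^ omega) * (n%:R `^ omega * ln n%:R ^+ 3) =
    1000%:R * (c ^+ 3 * ln n%:R ^+ 3) * (C * 8 `^ omega * n%:R `^ omega) :> R.
  have AC (x1 x2 x3 x4 x5 : R) : x1 * x2 * x3 * (x4 * x5) = x1 * (x2 * x5) * (x3 * x4).
    by ring.
  exact: AC.
move: (ler0n R 1000) => w0; move: (1000%:R : R) w0 => w w0.
by apply: ler_pM; rewrite ?mulr_ge0 ?exprn_ge0 ?ler0n // ler_wpM2l.
Unshelve. all: by end_near.
Qed.
End SoftO.

(** * The theorem *)

Theorem theorem4p1 (R : realType) (omega : R) (homega : matmul_exponent omega)
    (K : fieldType) (v : K -> int) (hv : complete_discrete_valuation v) :
  exists (T : forall n : nat,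
                act K (seq nat * 'M[nat]_n * 'M[nat]_n * seq nat))
         (cost : nat -> nat),
    softO (fun n : nat => (cost n)%:R : R) (fun n : nat => (n%:R : R) `^ omega) /\
    forall (n : nat) (M : 'M[K]_n), surjective_dchi v M ->
    exists (m : seq K) (a : seq nat) (p q : 'M[nat]_n) (x : seq nat) (c : nat),
      [/\ act_run (T n) (mx_input M) = Some (m, (a, p, q, x), c),
          (c <= cost n)%N,
          read_mx m p \in unitmx /\ read_mx m q \in unitmx,
          read_poly m x = char_poly M
        & comatrix_factorization M (read_poly m a) (read_mx m p) (read_mx m q)].
Proof.
have [s [out [sP sO]]] := homega K.
pose mm n := slp_cost (s n).
have mm_ge n : (0 < n)%N -> (n * n <= mm n)%N by move=> _; apply: matmul_cost_ge (sP n).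
pose F := regular_cost mm.
have F_sq := regular_cost_sq mm : forall N, (N * N <= F N)%N.
have F_mono := @regular_cost_mono mm : forall N N', (N <= N')%N -> (F N <= F N')%N.
have F_add := regular_cost_add mm : forall N N', (F N + F N' <= F (N + N'))%N.
have F_quad := regular_cost_quad mm : forall N, (4 * F N <= F (N + N))%N.
(* F 0 = 0 need not bound the cost of [s 0], but 0 x 0 products are free *)
pose s' N := if N is 0 then [::] else s N.
have s'P N (B C : 'M[K]_N) :
    read_mx (slp_run (mx_input B ++ mx_input C) (s' N)) (out N) = B *m C.
  by case: N B C => [|N] B C; [rewrite [LHS]flatmx0 [RHS]flatmx0 | apply: sP].
have F_mm N : (slp_cost (s' N) <= F N)%N.
  by case: N => [|N] //; apply: regular_cost_ge.
have runs_mul := @runs_mulp K s' out s'P F F_mm F_mono.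
have [C C0 FC] := regular_cost_bound sO mm_ge.
have omega0 : 0 <= omega by apply: le_trans (matmul_exponent_ge2 sO mm_ge).
exists (fun n => compile (factorp (mulp s' out) n) (n * n)%N), (factor_cost F).
split; first by apply: factor_cost_softO FC F_mono _.
move=> n M /(surjective_dchi_nonderog (proj1 hv)) nd.
have [m [[[[a p] q] x] [c [run le_c _ [pq xE fac]]]]] :=
  runs_factorp F_sq F_mono F_quad F_add runs_mul nd.
exists m, a, p, q, x, c; split=> //.
by rewrite -run size_mx_input.
Qed.
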